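(* Let $n\ge1$. The assignment $$\Gamma\mapsto\bigoplus_{c\in\Gamma}\mathfrak{M}([c])$$ defines a bijection from the set $\mathrm{Tri}(S(A_n))$ of all triangulations of $S(A_n)$ to the set of isomorphism classes of basic support $\tau$-tilting $A_n$-modules.
   Context: $\Bbbk$ is an algebraically closed field, $A_n=\Bbbk\mathcal{Q}$ is the path algebra of the quiver $\mathcal{Q}:1\to2\to\cdots\to n$; modules are finitely generated right modules. An $A$-module $M$ is $\tau$-rigid if $\operatorname{Hom}_A(M,\tau M)=0$, $\tau$-tilting if moreover $|M|=|A|$ (number of non-isomorphic indecomposable summands), and support $\tau$-tilting if it is a $\tau$-tilting $A/\langle e\rangle$-module for some idempotent $e$ of $A$. The surface $S(A_n)$ is a closed disk with $n+3$ points on its boundary, in counterclockwise order $p,x_0,x_1,\dots,x_n,x_{n+1}$. The points $p,x_1,\dots,x_n$ are the marked points and $x_0,x_{n+1}$ are the two extra marked points. The disk carries the $n$ arcs $px_1,\dots,px_n$, the arc $px_i$ corresponding to the vertex $i$ of $\mathcal{Q}$. Permissible curves in $S(A_n)$ (up to equivalence) are the curves joining two of these $n+3$ points, taken up to isotopy fixing endpoints and with minimal intersection; there is one for each pair of distinct points. A boundary segment is a segment of the boundary circle between two consecutive points among the $n+3$ points. A triangulation of $S(A_n)$ is a maximal set of permissible curves, none homotopic to a boundary segment, any two of which do not meet in the interior of the disk. For a permissible curve $c$, $\mathfrak{M}([c])$ is the string module determined by the arcs that $c$ crosses in the interior: for $0\le i<j\le n+1$ with $j-i\ge2$, $\mathfrak{M}([x_ix_j])$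 is the indecomposable $A_n$-module with support $\{i+1,\dots,j-1\}$; trivial curves, i.e. those crossing no arc $px_i$ in the interior, correspond to the zero module. *)

(* Defs.v *)
From HB Require Import structures.
From mathcomp Require Import all_boot all_order all_algebra.

Set Implicit Arguments.
Unset Strict Implicit.
Unset Printing Implicit Defensive.

Import GRing.Theory.
Local Open Scope ring_scope.

(* Finite-dimensional algebras; MathComp's falgType excludes the zero algebra *)
(* (which occurs below as A/<1>), and its algebra structures over possibly    *)
(* zero rings cannot be joined with vectType.                                 *)
HB.mixin Record Vector_isFDAlgebra (k : fieldType) A of Vector k A := {
  fdone : A;
  fdmul : A -> A -> A;
  fdmulA : associative fdmul;
  fdmul1l : left_id fdone fdmul;
  fdmul1r : right_id fdone fdmul;
  fdmul_linearl : forall y, linear (fdmul^~ y);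
  fdmul_linearr : forall x, linear (fdmul x)
}.

#[short(type="fdAlgType")]
HB.structure Definition FDAlgebra (k : fieldType) :=
  { A of Vector k A & Vector_isFDAlgebra k A }.

Notation "x ** y" := (fdmul x y) (at level 40, left associativity) : ring_scope.

Lemma linear_build (k : fieldType) (U V : vectType k) (f : U -> V) :
  linear f -> exists g : {linear U -> V}, g = f :> (U -> V).
Proof.
move=> lf.
pose h := GRing.isSemilinear.Build k U V _ f (GRing.semilinear_linear lf).
by exists (HB.pack_for {linear U -> V} f h).
Qed.

Lemma linfunE (k : fieldType) (U V : vectType k) (f : U -> V) :
  linear f -> forall x, linfun f x = f x.
Proof. by case/linear_build=> g <- x; rewrite lfunE. Qed.

(* The quotient V/U is realized on a complement of U; quot_pi is the          *)
(* projection onto that complement along U.                                   *)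
Section QuotientSpace.
Variables (k : fieldType) (V : vectType k) (U : {vspace V}).

Definition quot_pi (x : V) : subvs_of U^C := vsproj U^C (x - projv U x).

Lemma val_quot_pi x : vsval (quot_pi x) = x - projv U x.
Proof. by rewrite vsprojK // memv_projC. Qed.

Lemma quot_pi_linear : linear quot_pi.
Proof.
move=> c x y; apply/val_inj; rewrite /= val_quot_pi.
rewrite !val_quot_pi linearP /=.
by rewrite scalerBr opprD addrACA.
Qed.
HB.instance Definition _ := GRing.isSemilinear.Build k V (subvs_of U^C) _ quot_pi
  (GRing.semilinear_linear quot_pi_linear).

Lemma quot_piK y : quot_pi (vsval y) = y.
Proof.
apply/val_inj; rewrite /= val_quot_pi.
suff: vsval y \in lker (projv U) by rewrite memv_ker => /eqP ->; rewrite subr0.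
by rewrite lker_proj subvsP.
Qed.

Lemma quot_pi_eq0 x : (quot_pi x == 0) = (x \in U).
Proof.
apply/idP/idP => [/eqP/(congr1 vsval)|xU].
  rewrite val_quot_pi /= => /eqP; rewrite subr_eq0 => /eqP ->.
  exact: memv_proj.
by apply/eqP/val_inj; rewrite /= val_quot_pi projv_id // subrr.
Qed.

Lemma quot_pi_eq x y : (quot_pi x == quot_pi y) = (x - y \in U).
Proof. by rewrite -quot_pi_eq0 linearB subr_eq0. Qed.

End QuotientSpace.

Section PrincipalIdeal.
Variables (k : fieldType) (A : fdAlgType k).
Implicit Types a b e x : A.

Definition lmul_lfun a : 'End(A) := linfun (fdmul a).

Lemma lmul_lfunE a x : lmul_lfun a x = a ** x.
Proof. exact/linfunE/fdmul_linearr. Qed.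

Definition rmul_lfun a : 'End(A) := linfun (fdmul^~ a).

Lemma rmul_lfunE a x : rmul_lfun a x = x ** a.
Proof. exact/linfunE/fdmul_linearl. Qed.

Lemma fdmulBl a x y : (x - y) ** a = x ** a - y ** a.
Proof. by rewrite -!rmul_lfunE linearB. Qed.

Lemma fdmulBr a x y : a ** (x - y) = a ** x - a ** y.
Proof. by rewrite -!lmul_lfunE linearB. Qed.

(* the two-sided ideal <e> *)
Definition ideal_gen e : {vspace A} :=
  <<[seq x ** e ** y | x <- vbasis {:A}, y <- vbasis {:A}]>>%VS.

Lemma mem_ideal_gen e a b : a ** e ** b \in ideal_gen e.
Proof.
pose F y := (rmul_lfun y \o rmul_lfun e)%VF.
have E x y : x ** e ** y = F y x by rewrite comp_lfunE !rmul_lfunE.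
rewrite E (coord_vbasis (memvf a)) linear_sum rpred_sum // => i _.
rewrite linearZ rpredZ //= -E -lmul_lfunE.
rewrite (coord_vbasis (memvf b)) linear_sum rpred_sum // => j _.
rewrite linearZ rpredZ //= lmul_lfunE memv_span //.
by apply: (allpairs_f (fun x y => x ** e ** y)); apply: mem_nth; rewrite size_tuple.
Qed.

Lemma ideal_gen_ind e (V : {vspace A}) :
  (forall a b, a ** e ** b \in V) -> (ideal_gen e <= V)%VS.
Proof. by move=> h; apply/span_subvP => _ /allpairsP[p [_ _ ->]]. Qed.

Lemma ideal_gen_mull e a x : x \in ideal_gen e -> a ** x \in ideal_gen e.
Proof.
suff /subvP h : (ideal_gen e <= lmul_lfun a @^-1: ideal_gen e)%VS.
  by move=> /h; rewrite -memv_preim lmul_lfunE.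
apply: ideal_gen_ind => b c; rewrite -memv_preim lmul_lfunE !fdmulA.
exact: mem_ideal_gen.
Qed.

Lemma ideal_gen_mulr e a x : x \in ideal_gen e -> x ** a \in ideal_gen e.
Proof.
suff /subvP h : (ideal_gen e <= rmul_lfun a @^-1: ideal_gen e)%VS.
  by move=> /h; rewrite -memv_preim rmul_lfunE.
apply: ideal_gen_ind => b c; rewrite -memv_preim rmul_lfunE -fdmulA.
exact: mem_ideal_gen.
Qed.

Definition quot_alg e := subvs_of (ideal_gen e)^C.

End PrincipalIdeal.

Section QuotientAlgebra.
Variables (k : fieldType) (A : fdAlgType k) (e : A).
Local Notation Q := (quot_alg e).
Local Notation pi := (quot_pi (ideal_gen e)).

HB.instance Definition _ := Vector.copy Q (subvs_of (ideal_gen e)^C).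

Definition qmul (x y : Q) : Q := pi (vsval x ** vsval y).

Lemma quot_pi_diff (x : A) : vsval (pi x) - x \in ideal_gen e.
Proof. by rewrite -quot_pi_eq quot_piK. Qed.

Lemma qmul_pi x y : qmul (pi x) (pi y) = pi (x ** y).
Proof.
apply/eqP; rewrite quot_pi_eq.
have -> : vsval (pi x) ** vsval (pi y) - x ** y =
   (vsval (pi x) - x) ** vsval (pi y) + x ** (vsval (pi y) - y).
  by rewrite fdmulBl fdmulBr addrA subrK.
by apply: rpredD; [apply: ideal_gen_mulr|apply: ideal_gen_mull];
  apply: quot_pi_diff.
Qed.

Fact qmulA : associative qmul.
Proof.
move=> x y z; rewrite -(quot_piK x) -(quot_piK y) -(quot_piK z).
by rewrite !qmul_pi fdmulA.
Qed.
Fact qmul1l : left_id (pi fdone : Q) qmul.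
Proof. by move=> x; rewrite -(quot_piK x) qmul_pi fdmul1l. Qed.
Fact qmul1r : right_id (pi fdone : Q) qmul.
Proof. by move=> x; rewrite -(quot_piK x) qmul_pi fdmul1r. Qed.
Fact qmul_linearl y : linear (qmul^~ y).
Proof. by move=> c x z; rewrite /qmul linearP /= fdmul_linearl linearP. Qed.
Fact qmul_linearr x : linear (qmul x).
Proof. by move=> c y z; rewrite /qmul linearP /= fdmul_linearr linearP. Qed.

HB.instance Definition _ := Vector_isFDAlgebra.Build k Q
  qmulA qmul1l qmul1r qmul_linearl qmul_linearr.

Definition alg_pi (a : A) : Q := pi a.

Lemma alg_pi_linear : linear alg_pi. Proof. exact: quot_pi_linear. Qed.
Lemma alg_pi1 : alg_pi fdone = fdone. Proof. by []. Qed.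
Lemma alg_piM a b : alg_pi (a ** b) = alg_pi a ** alg_pi b.
Proof. by rewrite -[RHS]/(qmul _ _) qmul_pi. Qed.
Lemma alg_pi_eq0 a : (alg_pi a == 0) = (a \in ideal_gen e).
Proof. exact: quot_pi_eq0. Qed.

End QuotientAlgebra.

(* Over a finite-dimensional algebra, finitely generated modules are those    *)
(* of finite dimension.                                                       *)
Record rmod (k : fieldType) (A : fdAlgType k) := RMod {
  rmod_sort :> vectType k;
  ract : rmod_sort -> A -> rmod_sort;
  ract_linearl : forall a, linear (ract^~ a);
  ract_linearr : forall x, linear (ract x);
  ract1 : forall x, ract x fdone = x;
  ractM : forall x a b, ract x (a ** b) = ract (ract x a) b
}.

Record lmod (k : fieldType) (A : fdAlgType k) := LMod {
  lmod_sort :> vectType k;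
  lact : A -> lmod_sort -> lmod_sort;
  lact_linearr : forall a, linear (lact a);
  lact_linearl : forall x, linear (lact^~ x);
  lact1 : forall x, lact fdone x = x;
  lactM : forall a b x, lact (a ** b) x = lact a (lact b x)
}.

Section Hom.
Variables (k : fieldType) (A : fdAlgType k).

Definition ract_lfun (M : rmod A) (a : A) : 'End(M) := linfun ((@ract _ _ M)^~ a).

Lemma ract_lfunE (M : rmod A) a x : ract_lfun M a x = ract x a.
Proof. exact/linfunE/ract_linearl. Qed.

Definition lact_lfun (L : lmod A) (a : A) : 'End(L) := linfun (@lact _ _ L a).

Lemma lact_lfunE (L : lmod A) a x : lact_lfun L a x = lact a x.
Proof. exact/linfunE/lact_linearr. Qed.

Definition comm_defect (M N : rmod A) (a : A) (f : 'Hom(M, N)) : 'Hom(M, N) :=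
  ((f \o ract_lfun M a) - (ract_lfun N a \o f))%VF.

(* Hom_A(M, N) as a subspace of Hom_k(M, N); see homspaceP *)
Definition homspace (M N : rmod A) : {vspace 'Hom(M, N)} :=
  (\bigcap_(i < \dim {:A}) lker (linfun (comm_defect (vbasis {:A})`_i)))%VS.

Lemma comm_defectE M N a f x :
  @comm_defect M N a f x = f (ract x a) - ract (f x) a.
Proof. by rewrite add_lfunE opp_lfunE !comp_lfunE !ract_lfunE. Qed.

Lemma comm_defect_linear M N a : linear (@comm_defect M N a).
Proof.
move=> c f g; apply/lfunP => x.
rewrite !(comm_defectE, add_lfunE, scale_lfunE).
by rewrite ract_linearl scalerBr opprD addrACA.
Qed.

Lemma homspaceP (M N : rmod A) (f : 'Hom(M, N)) :
  reflect (forall x a, f (ract x a) = ract (f x) a) (f \in homspace M N).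
Proof.
have E a : comm_defect a f = 0 <-> forall x, f (ract x a) = ract (f x) a.
  split=> [/lfunP h x|h].
    have := h x; rewrite comm_defectE zero_lfunE => /eqP.
    by rewrite subr_eq0 => /eqP.
  by apply/lfunP => x; rewrite comm_defectE h subrr zero_lfunE.
apply: (iffP idP) => [|h].
  rewrite memvE => /subv_bigcapP h x a.
  have {}h i : f (ract x (vbasis {:A})`_i) = ract (f x) (vbasis {:A})`_i.
    case: (ltnP i (\dim {:A})) => [lti|lei].
      have := h (Ordinal lti) isT; rewrite -memvE memv_ker.
      by rewrite linfunE; [move/eqP/E; apply|exact: comm_defect_linear].
    rewrite nth_default ?size_tuple //.
    have r0 (K : rmod A) (y : K) : ract y 0 = 0.
      by have := ract_linearr y (-1) 0 0; rewrite scaler0 addr0 scaleN1r addNr.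
    by rewrite !r0 linear0.
  pose F (K : rmod A) (y : K) := linfun (@ract _ _ K y).
  have FE (K : rmod A) (y : K) b : ract y b = F K y b.
    by rewrite linfunE //; exact: ract_linearr.
  rewrite (coord_vbasis (memvf a)) !FE !linear_sum /=.
  by apply: eq_bigr => i _; rewrite !linearZ /= -!FE h.
rewrite memvE; apply/subv_bigcapP => i _; rewrite -memvE memv_ker.
rewrite linfunE; last exact: comm_defect_linear.
by apply/eqP/E => x; apply: h.
Qed.

Definition rhom (M N : rmod A) := subvs_of (homspace M N).

End Hom.

Section Modules.
Variables (k : fieldType) (A : fdAlgType k).
Implicit Types M N X Y P : rmod A.

Definition iso M N :=
  exists (f : rhom M N) (g : rhom N M), cancel (vsval f) (vsval g)
                                     /\ cancel (vsval g) (vsval f).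

Definition regmod : rmod A :=
  @RMod k A A fdmul (@fdmul_linearl k A) (@fdmul_linearr k A)
    (@fdmul1r k A) (@fdmulA k A).

Fact rV0_eq (x y : 'rV[k]_0) : x = y. Proof. by apply/rowP; case. Qed.

Definition zeromod : rmod A :=
  @RMod k A 'rV[k]_0 (fun x _ => x) (fun _ _ _ _ => rV0_eq _ _)
    (fun _ _ _ _ => rV0_eq _ _) (fun _ => rV0_eq _ _) (fun _ _ _ => rV0_eq _ _).

Section DirectSum.
Variables M N : rmod A.

Definition dsum_act (x : M * N) (a : A) : M * N := (ract x.1 a, ract x.2 a).

Fact dsum_linearl a : linear (dsum_act^~ a).
Proof. by move=> c x y; rewrite /dsum_act /= !ract_linearl. Qed.
Fact dsum_linearr x : linear (dsum_act x).
Proof. by move=> c a b; rewrite /dsum_act /= !ract_linearr. Qed.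
Fact dsum_act1 x : dsum_act x fdone = x.
Proof. by case: x => x y; rewrite /dsum_act !ract1. Qed.
Fact dsum_actM x a b : dsum_act x (a ** b) = dsum_act (dsum_act x a) b.
Proof. by rewrite /dsum_act !ractM. Qed.

Definition dsum : rmod A :=
  @RMod k A (M * N)%type dsum_act dsum_linearl dsum_linearr dsum_act1 dsum_actM.
End DirectSum.

Definition summand X M := exists Y, iso M (dsum X Y).

Definition indecomposable M :=
  ~ iso M zeromod /\
  forall X Y, iso M (dsum X Y) -> iso X zeromod \/ iso Y zeromod.

(* |M| = r *)
Definition num_summands M (r : nat) :=
  exists X : 'I_r -> rmod A,
    [/\ forall i, indecomposable (X i) /\ summand (X i) M,
        forall i j, iso (X i) (X j) -> i = j
      & forall Y, indecomposable Y -> summand Y M -> exists i, iso Y (X i)].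

Definition basic M :=
  exists (m : nat) (X : 'I_m -> rmod A),
    [/\ forall i, indecomposable (X i),
        forall i j, iso (X i) (X j) -> i = j
      & iso M (\big[dsum/zeromod]_(i < m) X i)].

Definition projective P :=
  forall X Y (g : rhom X Y) (f : rhom P Y), limg (vsval g) = fullv ->
  exists h : rhom P X, forall x, vsval g (vsval h x) = vsval f x.

Definition submodule M (U : {vspace M}) :=
  forall x a, x \in U -> ract x a \in U.

Definition superfluous M (U : {vspace M}) :=
  forall W : {vspace M}, submodule W -> (U + W)%VS = fullv -> W = fullv.

Definition min_proj_presentation P1 P0 M (f : rhom P1 P0) (g : rhom P0 M) :=
  [/\ projective P1, projective P0,
      limg (vsval g) = fullv, limg (vsval f) = lker (vsval g)
    & superfluous (lker (vsval g)) /\ superfluous (lker (vsval f))].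

(* Hom_A(P, A), a left module by (a h)(x) = a (h x) *)
Section Star.
Variable P : rmod A.

Definition star_act (a : A) (h : rhom P regmod) : rhom P regmod :=
  vsproj (homspace P regmod) (lmul_lfun a \o vsval h)%VF.

Lemma star_actE a h x : vsval (star_act a h) x = a ** vsval h x.
Proof.
rewrite vsprojK ?comp_lfunE ?lmul_lfunE //; apply/homspaceP => y b.
rewrite !comp_lfunE !lmul_lfunE /=.
by rewrite (homspaceP _ (subvsP h)) /= fdmulA.
Qed.

Fact star_linearr a : linear (star_act a).
Proof.
move=> c f g; apply/val_inj/lfunP => x /=; rewrite star_actE.
rewrite !(add_lfunE, scale_lfunE).
by rewrite !star_actE fdmul_linearr.
Qed.
Fact star_linearl h : linear (star_act^~ h).
Proof.
move=> c a b; apply/val_inj/lfunP => x /=; rewrite star_actE.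
rewrite !(add_lfunE, scale_lfunE).
by rewrite !star_actE fdmul_linearl.
Qed.
Fact star_act1 h : star_act fdone h = h.
Proof. by apply/val_inj/lfunP => x /=; rewrite star_actE fdmul1l. Qed.
Fact star_actM a b h : star_act (a ** b) h = star_act a (star_act b h).
Proof. by apply/val_inj/lfunP => x /=; rewrite !star_actE fdmulA. Qed.

Definition star : lmod A :=
  @LMod k A (rhom P regmod) star_act star_linearr star_linearl
    star_act1 star_actM.
End Star.

(* Hom_A(f, A) : Hom_A(P0, A) -> Hom_A(P1, A) *)
Section Transpose.
Variables (P1 P0 : rmod A) (f : rhom P1 P0).

Definition star_map (h : star P0) : star P1 :=
  vsproj (homspace P1 regmod) (vsval h \o vsval f)%VF.

Lemma star_mapE h x : vsval (star_map h) x = vsval h (vsval f x).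
Proof.
rewrite vsprojK ?comp_lfunE //; apply/homspaceP => y b; rewrite !comp_lfunE.
by rewrite (homspaceP _ (subvsP f)) (homspaceP _ (subvsP h)).
Qed.

Fact star_map_linear : linear star_map.
Proof.
move=> c h h'; apply/val_inj/lfunP => x /=; rewrite star_mapE.
rewrite !(add_lfunE, scale_lfunE).
by rewrite !star_mapE.
Qed.

Definition star_img : {vspace star P1} := limg (linfun star_map).

Lemma star_img_act a h : h \in star_img -> lact a h \in star_img.
Proof.
case/memv_imgP => g _ ->; rewrite linfunE; last exact: star_map_linear.
apply/memv_imgP; exists (lact a g); rewrite ?memvf //.
rewrite linfunE; last exact: star_map_linear.
by apply/val_inj/lfunP => x /=; rewrite star_actE !star_mapE star_actE.
Qed.

Local Notation pi := (quot_pi star_img).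

Definition tr_act (a : A) (c : subvs_of star_img^C) : subvs_of star_img^C :=
  pi (lact a (vsval c)).

Lemma tr_act_pi a h : tr_act a (pi h) = pi (lact a h).
Proof.
apply/eqP; rewrite quot_pi_eq.
have -> : lact a (vsval (pi h)) - lact a h = lact a (vsval (pi h) - h).
  by rewrite -!lact_lfunE linearB.
by apply: star_img_act; rewrite -quot_pi_eq quot_piK.
Qed.

Fact tr_linearr a : linear (tr_act a).
Proof.
move=> c x y; rewrite /tr_act.
have -> : vsval (c *: x + y) = c *: vsval x + vsval y by [].
by rewrite lact_linearr linearP.
Qed.
Fact tr_linearl x : linear (tr_act^~ x).
Proof. by move=> c a b; rewrite /tr_act lact_linearl linearP. Qed.
Fact tr_act1 x : tr_act fdone x = x.
Proof. by rewrite /tr_act lact1 quot_piK. Qed.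
Fact tr_actM a b x : tr_act (a ** b) x = tr_act a (tr_act b x).
Proof. by rewrite {3}/tr_act tr_act_pi /tr_act lactM. Qed.

(* the cokernel of Hom_A(f, A) *)
Definition transpose : lmod A :=
  @LMod k A (subvs_of star_img^C) tr_act tr_linearr tr_linearl tr_act1 tr_actM.

End Transpose.

(* D = Hom_k(-, k) *)
Section Dual.
Variable L : lmod A.

Definition dual_act (phi : 'Hom(L, k^o)) (a : A) : 'Hom(L, k^o) :=
  (phi \o lact_lfun L a)%VF.

Lemma dual_actE phi a x : dual_act phi a x = phi (lact a x).
Proof. by rewrite comp_lfunE lact_lfunE. Qed.

Fact dual_linearl a : linear (dual_act^~ a).
Proof.
move=> c p q; apply/lfunP => x.
by rewrite dual_actE !(add_lfunE, scale_lfunE) !dual_actE.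
Qed.
Fact dual_linearr phi : linear (dual_act phi).
Proof.
move=> c a b; apply/lfunP => x.
rewrite dual_actE !(add_lfunE, scale_lfunE) !dual_actE.
by rewrite lact_linearl linearP.
Qed.
Fact dual_act1 phi : dual_act phi fdone = phi.
Proof. by apply/lfunP => x; rewrite dual_actE lact1. Qed.
Fact dual_actM phi a b : dual_act phi (a ** b) = dual_act (dual_act phi a) b.
Proof. by apply/lfunP => x; rewrite !dual_actE lactM. Qed.

Definition dual : rmod A :=
  @RMod k A 'Hom(L, k^o) dual_act dual_linearl dual_linearr dual_act1 dual_actM.
End Dual.

(* N is (up to isomorphism) tau M = D Tr M *)
Definition is_tau M N :=
  exists P1 P0 (f : rhom P1 P0) (g : rhom P0 M),
    min_proj_presentation f g /\ iso N (dual (transpose f)).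

Definition tau_rigid M := exists N, is_tau M N /\ homspace M N = 0%VS.

Definition tau_tilting M := tau_rigid M /\
  exists r, num_summands M r /\ num_summands regmod r.

End Modules.

Arguments zeromod {k A}.

Section SupportTauTilting.
Variables (k : fieldType) (A : fdAlgType k).

(* an A/<e>-module viewed as an A-module *)
Section Inflation.
Variables (e : A) (N : rmod (quot_alg e)).

Definition infl_act (x : N) (a : A) : N := ract x (alg_pi e a).

Fact infl_linearl a : linear (infl_act^~ a).
Proof. exact: ract_linearl. Qed.
Fact infl_linearr x : linear (infl_act x).
Proof. by move=> c a b; rewrite /infl_act alg_pi_linear ract_linearr. Qed.
Fact infl_act1 x : infl_act x fdone = x.
Proof. by rewrite /infl_act alg_pi1 ract1. Qed.
Fact infl_actM x a b : infl_act x (a ** b) = infl_act (infl_act x a) b.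
Proof. by rewrite /infl_act alg_piM ractM. Qed.

Definition inflation : rmod A :=
  @RMod k A N infl_act infl_linearl infl_linearr infl_act1 infl_actM.
End Inflation.

Definition support_tau_tilting (M : rmod A) :=
  exists e : A, e ** e = e /\
  exists N : rmod (quot_alg e), tau_tilting N /\ iso M (inflation N).

End SupportTauTilting.

(* Vertex i of the quiver 1 -> 2 -> ... -> n is the element of 'I_n of value  *)
(* i - 1. A path is determined by its source and its target.                  *)
Notation qpath n := {p : 'I_n * 'I_n | (p.1 <= p.2)%N}.

Section PathAlgebra.
Variables (k : fieldType) (n : nat).
Implicit Types p q r : qpath n.

Definition psrc p : 'I_n := (val p).1.
Definition ptgt p : 'I_n := (val p).2.

(* concatenation: first p, then q *)
Definition pcomp p q : option (qpath n) :=
  if ptgt p == psrc q then (insub (psrc p, ptgt q) : option (qpath n)) else None.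

Definition path_alg := {ffun qpath n -> k^o}.
HB.instance Definition _ := Vector.copy path_alg {ffun qpath n -> k^o}.
Implicit Types a b c : path_alg.

Definition pone : path_alg := [ffun p => (psrc p == ptgt p)%:R].
Definition pmul a b : path_alg :=
  [ffun r => \sum_p \sum_(q | pcomp p q == Some r) a p * b q].

Definition pcoef a : 'M[k]_n :=
  \matrix_(i, j) (if (insub (i, j) : option (qpath n)) is Some p then a p else 0 : k).

Lemma pcoefE a p : pcoef a (psrc p) (ptgt p) = a p.
Proof.
rewrite mxE; case: insubP => [u _ eu|]; last by rewrite (valP p).
by congr (a _); apply/val_inj; rewrite eu /psrc /ptgt; case: (val p).
Qed.

Lemma pcoef_inj : injective pcoef.
Proof. by move=> a b e; apply/ffunP => p; rewrite -!pcoefE e. Qed.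

Lemma pcoef0 a (i j : 'I_n) : ~~ (i <= j)%N -> pcoef a i j = 0.
Proof. by move=> h; rewrite mxE insubN. Qed.

Lemma pcoef_sum a (i j : 'I_n) (P : pred (qpath n)) :
  \sum_(p | [&& psrc p == i, ptgt p == j & P p]) a p =
  if (insub (i, j) : option (qpath n)) is Some p then (if P p then a p else 0) else 0.
Proof.
case: insubP => [u _ eu|h].
  have E p : [&& psrc p == i, ptgt p == j & P p] = (p == u) && P u.
    rewrite andbA; have -> : (psrc p == i) && (ptgt p == j) = (p == u).
      by rewrite -[p == u]val_eqE eu /psrc /ptgt; case: (val p).
    by case: eqP => // ->.
  rewrite (eq_bigl _ _ E); case: (P u).
    by rewrite (eq_bigl (pred1 u)) ?big_pred1_eq // => p; rewrite andbT.
  by rewrite big_pred0 // => p; rewrite andbF.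
rewrite big_pred0 // => p; apply/negP => /and3P[/eqP ei /eqP ej _].
by move: h; rewrite -ei -ej (valP p).
Qed.

Lemma pcoefM a b : pcoef (pmul a b) = pcoef a *m pcoef b.
Proof.
apply/matrixP => i j; rewrite [RHS]mxE.
have [le_ij|nle_ij] := boolP (i <= j)%N; last first.
  rewrite pcoef0 // big1 // => l _.
  have [le_il|] := boolP (i <= l)%N; last by move/pcoef0 ->; rewrite mul0r.
  rewrite [pcoef b _ _]pcoef0 ?mulr0 //.
  by apply: contra nle_ij; apply: leq_trans.
pose r : qpath n := Sub (i, j) le_ij.
rewrite -[i]/(psrc r) -[j]/(ptgt r) pcoefE ffunE.
rewrite (partition_big ptgt xpredT) //=; apply: eq_bigr => l _.
have -> : pcoef a i l = \sum_(p | [&& psrc p == i, ptgt p == l & true]) a p.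
  by rewrite pcoef_sum mxE; case: insub.
have -> : pcoef b l j = \sum_(p | [&& psrc p == l, ptgt p == j & true]) b p.
  by rewrite pcoef_sum mxE; case: insub.
rewrite big_distrl /= [LHS]big_mkcond [RHS]big_mkcond /=.
apply: eq_bigr => p _; rewrite andbT.
have [tp|] := eqVneq (ptgt p) l; last by rewrite andbF.
rewrite andbT; have [sp|nsp] := eqVneq (psrc p) i.
  rewrite big_distrr /=; apply: eq_bigl => q; rewrite andbT /pcomp tp.
  rewrite [psrc q == l]eq_sym; case: (eqVneq l) => //= lq.
  apply/eqP/eqP => [h|h].
    by have := congr1 (omap val) h; case: insubP => //= u _ -> [].
  case: insubP => [u _ eu|]; last by rewrite sp h /= le_ij.
  by congr Some; apply/val_inj; rewrite eu sp h.
rewrite big_pred0 // => q; rewrite /pcomp; case: ifP => // _.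
apply/negP => /eqP h; have := congr1 (omap val) h; case: insubP => //= u _ ->.
by case=> e; rewrite e eqxx in nsp.
Qed.

Lemma pcoef1 : pcoef pone = 1%:M.
Proof.
apply/matrixP => i j; rewrite !mxE; case: insubP => [u _ eu|].
  by rewrite ffunE /psrc /ptgt eu.
by case: eqP => // -> /=; rewrite leqnn.
Qed.

Lemma pcoef_linear : linear pcoef.
Proof.
move=> c a b; apply/matrixP => i j; rewrite !mxE.
by case: insub => [u|]; rewrite ?ffunE ?mulr0 ?addr0.
Qed.
HB.instance Definition _ := GRing.isSemilinear.Build k path_alg 'M[k]_n _ pcoef
  (GRing.semilinear_linear pcoef_linear).

Fact pmulA : associative pmul.
Proof. by move=> a b c; apply: pcoef_inj; rewrite !pcoefM mulmxA. Qed.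
Fact pmul1l : left_id pone pmul.
Proof. by move=> a; apply: pcoef_inj; rewrite pcoefM pcoef1 mul1mx. Qed.
Fact pmul1r : right_id pone pmul.
Proof. by move=> a; apply: pcoef_inj; rewrite pcoefM pcoef1 mulmx1. Qed.
Fact pmul_linearl b : linear (pmul^~ b).
Proof.
move=> c a a'; apply: pcoef_inj; rewrite linearP /= !pcoefM linearP /=.
by rewrite mulmxDl scalemxAl.
Qed.
Fact pmul_linearr a : linear (pmul a).
Proof.
move=> c b b'; apply: pcoef_inj; rewrite linearP /= !pcoefM linearP /=.
by rewrite mulmxDr scalemxAr.
Qed.
HB.instance Definition _ := Vector_isFDAlgebra.Build k path_alg
  pmulA pmul1l pmul1r pmul_linearl pmul_linearr.

(* The string module with support S: basis (z_i)_(i in S), a path from i to j *)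
(* sends z_i to z_j if it runs inside S, and all other z_l, l <> i, to 0.     *)
Section StringModule.
Variable S : {set 'I_n}.

Definition inside p := [forall l : 'I_n, (psrc p <= l <= ptgt p)%N ==> (l \in S)].

Definition string_space := {ffun {i : 'I_n | i \in S} -> k^o}.

Definition string_act (x : string_space) (a : path_alg) : string_space :=
  [ffun j => \sum_i
    \sum_(p | [&& psrc p == val i, ptgt p == val j & inside p]) a p * x i].

Definition scoef a (i j : 'I_n) : k :=
  if [forall l : 'I_n, (i <= l <= j)%N ==> (l \in S)] then pcoef a i j else 0.

Lemma string_actE x a j :
  string_act x a j = \sum_i scoef a (val i) (val j) * x i.
Proof.
rewrite ffunE; apply: eq_bigr => i _; rewrite -big_distrl /=; congr (_ * _).
rewrite pcoef_sum /scoef mxE; case: insubP => [u _ eu|]; last by case: ifP.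
by rewrite /inside /psrc /ptgt eu.
Qed.

Lemma string_spaceE (c : k) (x y : string_space) i :
  (c *: x + y) i = c * x i + y i.
Proof. by rewrite !ffunE. Qed.

Fact string_linearl a : linear (string_act^~ a).
Proof.
move=> c x y; apply/ffunP => j; rewrite string_spaceE !string_actE.
rewrite big_distrr -big_split /=; apply: eq_bigr => i _.
by rewrite string_spaceE mulrDr mulrCA.
Qed.
Fact string_linearr x : linear (string_act x).
Proof.
move=> c a b; apply/ffunP => j; rewrite string_spaceE !string_actE.
rewrite big_distrr -big_split /=; apply: eq_bigr => i _.
rewrite /scoef; case: ifP => _; last by rewrite !mul0r mulr0 addr0.
by rewrite linearP /= !mxE mulrDl mulrA.
Qed.
Fact string_act1 x : string_act x fdone = x.
Proof.
apply/ffunP => j; rewrite string_actE (bigD1 j) //= big1 => [|i ne_ij].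
  rewrite addr0 /scoef pcoef1 mxE eqxx.
  case: ifP => [|/negP []]; first by rewrite mul1r.
  apply/forallP => l; apply/implyP => /anti_leq/val_inj <-; exact: valP.
rewrite /scoef pcoef1 mxE val_eqE (negPf ne_ij) mulr0n.
by case: ifP; rewrite mul0r.
Qed.
Fact string_actM x a b : string_act x (a ** b) = string_act (string_act x a) b.
Proof.
apply/ffunP => j; rewrite !string_actE.
under [RHS]eq_bigr => l _ do rewrite string_actE big_distrr /=.
rewrite exchange_big /=; apply: eq_bigr => i _.
transitivity ((\sum_(l : {i | i \in S})
    scoef a (val i) (val l) * scoef b (val l) (val j)) * x i); last first.
  by rewrite big_distrl /=; apply: eq_bigr => l _; rewrite mulrCA mulrA.
congr (_ * _).
rewrite -(big_sub [pred l | l \in S]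
  (fun l => scoef a (val i) l * scoef b l (val j))) /=.
have ine (u v : 'I_n) c : ~~ (u <= v)%N -> scoef c u v = 0.
  by move=> h; rewrite /scoef; case: ifP => // _; apply: pcoef0.
rewrite [LHS]/scoef; case: forallP => [h|nh]; last first.
  rewrite big1 // => l _.
  have [il|/ine->] := boolP (val i <= l)%N; last by rewrite mul0r.
  have [lj|/ine->] := boolP (l <= val j)%N; last by rewrite mulr0.
  rewrite /scoef; case: forallP => [h1|_]; last by rewrite mul0r.
  case: forallP => [h2|_]; last by rewrite mulr0.
  case: nh => m; apply/implyP => /andP[im mj].
  case: (leqP m l) => [ml|/ltnW lm].
    by have := h1 m; rewrite im ml.
  by have := h2 m; rewrite lm mj.
rewrite pcoefM mxE (bigID [pred l | l \in S]) /= addrC big1 ?add0r => [|l nlS].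
  apply: eq_bigr => l lS.
  have [il|nil] := boolP (val i <= l)%N; last first.
    by rewrite (ine _ _ _ nil) mul0r pcoef0 ?mul0r.
  have [lj|nlj] := boolP (l <= val j)%N.
    rewrite /scoef; case: forallP => [_|[]]; last first.
      move=> m; apply/implyP => /andP[im ml].
      by have := h m; rewrite im (leq_trans ml lj).
    case: forallP => [_|[]] // m; apply/implyP => /andP[lm mj].
    by have := h m; rewrite mj (leq_trans il lm).
  by rewrite (ine _ _ _ nlj) mulr0 [pcoef b _ _]pcoef0 ?mulr0.
have [il|nil] := boolP (val i <= l)%N; last by rewrite pcoef0 ?mul0r.
have [lj|nlj] := boolP (l <= val j)%N; last by rewrite [pcoef b _ _]pcoef0 ?mulr0.
by have := h l; rewrite il lj (negPf nlS).
Qed.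

Definition string_mod : rmod path_alg :=
  @RMod k path_alg string_space string_act string_linearl string_linearr
    string_act1 string_actM.
End StringModule.

End PathAlgebra.

(* The boundary points of the disk are numbered counterclockwise by 'I_n.+3:  *)
(* ord0 is p and the element of value i + 1 is x_i. The class of a permissible *)
(* curve is determined by its two endpoints, so curves are pairs of points.   *)
Section Surface.
Variable n : nat.
Local Notation point := 'I_n.+3.

Definition curve := {c : {set point} | #|c| == 2}.
HB.instance Definition _ := Finite.on curve.
Definition endpoints (c : curve) : {set point} := val c.

(* Curves in minimal position meet in the interior of the disk, i.e. away     *)
(* from their endpoints, iff their endpoints alternate on the boundary circle. *)
Definition alternate (c d : {set point}) :=
  [exists a in c, exists u in d, exists b in c, exists v in d,
    [&& a < u, u < b & b < v]%N].
Definition crosses (c d : {set point}) := alternate c d || alternate d c.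

(* ordS is the cyclic successor *)
Definition boundary_segment (c : {set point}) :=
  [exists q : point, c == [set q; ordS q]].

Definition noncrossing (G : {set curve}) :=
  [forall c in G, ~~ boundary_segment (endpoints c)] &&
  [forall c in G, forall d in G, ~~ crosses (endpoints c) (endpoints d)].

Definition triangulation (G : {set curve}) := maxset noncrossing G.

(* the arc px_(i+1), which corresponds to the vertex i : 'I_n *)
Definition arc (i : 'I_n) : {set point} := [set ord0; inord i.+2].

Definition crossed (c : curve) : {set 'I_n} :=
  [set i | crosses (endpoints c) (arc i)].

Lemma crosses_arc (a b : point) (i : 'I_n) : (a < b)%N ->
  crosses [set a; b] (arc i) = [&& 0 < a, a < i.+2 & i.+2 < b]%N.
Proof.
move=> ltab; have vi : (inord i.+2 : point) = i.+2 :> nat.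
  by apply: inordK; exact: ltnW (ltn_ord i).
apply/idP/idP => [/orP[]|/and3P[h0 h1 h2]].
- case/exists_inP => x; rewrite !inE => xab /exists_inP[u].
  rewrite !inE => ud /exists_inP[y]; rewrite !inE => yab /exists_inP[v].
  rewrite !inE => vd /and3P[xu uy yv].
  case/orP: ud => /eqP ud; first by rewrite ud in xu.
  case/orP: vd => /eqP vd; first by rewrite vd in yv.
  by have := ltn_trans uy yv; rewrite ud vd ltnn.
- case/exists_inP => x; rewrite !inE => xd /exists_inP[u].
  rewrite !inE => ud /exists_inP[y]; rewrite !inE => yd /exists_inP[v].
  rewrite !inE => vd /and3P[xu uy yv].
  case/orP: yd => /eqP yd; first by rewrite yd in uy.
  rewrite yd vi in uy yv.
  case/orP: ud => /eqP ud; case/orP: vd => /eqP vd; rewrite ud vd in xu uy yv.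
  + by have := ltn_trans uy yv; rewrite ltnn.
  + by rewrite uy yv (leq_ltn_trans _ xu).
  + by have := ltn_trans uy (ltn_trans yv ltab); rewrite ltnn.
  + by have := ltn_trans uy yv; rewrite ltnn.
apply/orP; right; apply/exists_inP; exists ord0; first by rewrite !inE eqxx.
apply/exists_inP; exists a; first by rewrite !inE eqxx.
apply/exists_inP; exists (inord i.+2); first by rewrite !inE eqxx orbT.
apply/exists_inP; exists b; first by rewrite !inE eqxx orbT.
by rewrite vi h0 h1 h2.
Qed.

End Surface.

Definition curve_mod (k : fieldType) (n : nat) (c : curve n) : rmod (path_alg k n) :=
  string_mod k (crossed c).

Definition tri_mod (k : fieldType) (n : nat) (G : {set curve n}) :
    rmod (path_alg k n) :=
  \big[@dsum k (path_alg k n)/zeromod]_(c in G) curve_mod k c.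

(* Main.v *)
(** A crossing-free set of diagonals of the (n+3)-gon splits into chords
    [x_(a-1) x_(b+1)], that is, intervals [a,b] of vertices, and arcs [p x_j],
    that is, a set J of vertices; it is maximal iff it has n elements.
    An arc [p x_j] and a chord cross iff j lies in the interval, and two chords
    cross iff there is a nonsplit extension between the interval modules.

    On the module side, the ranks of the maps [M e_i -> M e_j] are additive and
    determine M: a vector of M with the earliest start and the longest life
    generates an interval summand. So modules are finite multisets of intervals.
    An idempotent e only matters through J = {i | e_ii = 1}: the ideal <e> is
    spanned by the paths meeting J, modules over the quotient are the multisets
    of intervals avoiding J, and its regular module has n - |J| summands.
    Finally Hom(X, tau M) = 0 iff every map from P1 to X extends along the
    minimal presentation P1 -> P0 of M, which for sums of intervals says that no
    two of the intervals are joined by a nonsplit extension. *)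

Require Import Defs.
From mathcomp Require Import all_boot all_order all_algebra.
From mathcomp Require Import zify.

Set Implicit Arguments.
Unset Strict Implicit.
Unset Printing Implicit Defensive.

Import GRing.Theory.
Local Open Scope ring_scope.

(** * Modules and homomorphisms *)

(** Support tau-tilting ranges over all idempotents e, and each quotient is another algebra; its
    modules are inflated to A, where one notion of multiplicity serves for every e. Rigidity over
    the quotient gives the same relation between intervals as over A: if [a,b] and [c,d] avoid J and
    have a nonsplit extension, its middle term [a,d] + [c,b] avoids J as well, since c <= b+1. The
    translate tau M is given only up to isomorphism, through some minimal presentation, and is never
    computed. For projective P the maps x |-> m h(x), with m in X and h in Hom(P, A), span Hom(P,
    X); this relates Hom(X, D Tr M) to the dual of the cokernel of Hom(P0, X) -> Hom(P1, X), so that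
    one vanishes iff the other does. The module M does not carry the set J. Counting bridges the
    gap: n curves in a triangulation against n - |J| pairwise nonisomorphic indecomposable summands.
    For injectivity, two triangulations with the same chords have a crossing-free union, so
    maximality makes them equal. *)

Section LinearMaps.
Variables (k : fieldType) (U V : vectType k).

Lemma lfun_build (F : U -> V) : linear F -> exists f : 'Hom(U, V), f =1 F.
Proof. by move=> lF; exists (linfun F) => x; rewrite linfunE. Qed.

Lemma limg_full (f : 'Hom(U, V)) :
  limg f = fullv <-> forall y, exists x, f x = y.
Proof.
split=> [fs y|fs].
  have /memv_imgP[x _ ->] : y \in limg f by rewrite fs memvf.
  by exists x.
apply/eqP; rewrite eqEsubv subvf; apply/subvP => y _.
by have [x <-] := fs y; rewrite memv_img ?memvf.
Qed.

Lemma exists_functional (v : V) : v != 0 -> exists f : 'Hom(V, k^o), f v = 1.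
Proof.
move=> nzv; have /freeP fr : free [tuple v] by rewrite seq1_free.
have E : v = (in_tuple [:: v])`_(@ord0 0) by [].
exists (linfun (coord (in_tuple [:: v]) ord0 : V -> k^o)); rewrite lfunE /=.
by rewrite {2}E coord_free ?eqxx // seq1_free.
Qed.

End LinearMaps.

Section Modules.
Variables (k : fieldType) (A : fdAlgType k).
Implicit Types M N X Y P : rmod A.

Lemma ract0 M (a : A) : ract (0 : M) a = 0.
Proof. by rewrite -ract_lfunE linear0. Qed.
Lemma ractD M (a : A) (x y : M) : ract (x + y) a = ract x a + ract y a.
Proof. by rewrite -!ract_lfunE linearD. Qed.
Lemma ractZ M (a : A) c (x : M) : ract (c *: x) a = c *: ract x a.
Proof. by rewrite -!ract_lfunE linearZ. Qed.
Lemma ract_suml M (a : A) I (r : seq I) (Q : pred I) (F : I -> M) :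
  ract (\sum_(i <- r | Q i) F i) a = \sum_(i <- r | Q i) ract (F i) a.
Proof. by rewrite -!ract_lfunE linear_sum; apply: eq_bigr => i _; exact: ract_lfunE. Qed.

Definition ractr_lfun M (x : M) : 'Hom(A, M) := linfun (@ract _ _ M x).
Lemma ractr_lfunE M (x : M) a : ractr_lfun x a = ract x a.
Proof. exact/linfunE/ract_linearr. Qed.

Lemma ractr0 M (x : M) : ract x 0 = 0.
Proof. by rewrite -ractr_lfunE linear0. Qed.
Lemma ractr_sum M (x : M) I (r : seq I) (Q : pred I) (F : I -> A) :
  ract x (\sum_(i <- r | Q i) F i) = \sum_(i <- r | Q i) ract x (F i).
Proof. by rewrite -ractr_lfunE linear_sum; apply: eq_bigr => i _; exact: ractr_lfunE. Qed.
Lemma ractrZ M (x : M) c a : ract x (c *: a) = c *: ract x a.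
Proof. by rewrite -!ractr_lfunE linearZ. Qed.

Definition hom_of M N (f : 'Hom(M, N)) : rhom M N := vsproj (homspace M N) f.

Lemma hom_ofE M N (f : 'Hom(M, N)) : f \in homspace M N -> vsval (hom_of f) = f.
Proof. exact: vsprojK. Qed.

Lemma hom_build M N (F : M -> N) : linear F ->
  (forall x a, F (ract x a) = ract (F x) a) ->
  exists2 f : 'Hom(M, N), f \in homspace M N & f =1 F.
Proof.
move=> /lfun_build[f fE] h; exists f => //; apply/homspaceP => x a.
by rewrite !fE h.
Qed.

Lemma homspace_comp M N P (f : 'Hom(N, P)) (g : 'Hom(M, N)) :
  f \in homspace N P -> g \in homspace M N -> (f \o g)%VF \in homspace M P.
Proof.
move=> /homspaceP hf /homspaceP hg; apply/homspaceP => x a.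
by rewrite !comp_lfunE hg hf.
Qed.

Lemma isoP M N : iso M N <->
  exists f : 'Hom(M, N), f \in homspace M N /\ bijective f.
Proof.
split=> [[f [g [fg gf]]]|[f [hf [g fg gf]]]].
  by exists (vsval f); split; [exact: subvsP|exists (vsval g)].
have lg : linear g.
  by move=> c x y; apply: (can_inj fg); rewrite linearP /= !gf.
have [h hE] := lfun_build lg.
have hh : h \in homspace N M.
  apply/homspaceP => x a; rewrite !hE; apply: (can_inj fg).
  by rewrite (homspaceP _ hf) !gf.
by exists (hom_of f), (hom_of h); rewrite !hom_ofE //; split=> x; rewrite hE.
Qed.

Lemma iso_build M N (F : M -> N) (G : N -> M) : linear F ->
  (forall x a, F (ract x a) = ract (F x) a) ->
  cancel F G -> cancel G F -> iso M N.
Proof.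
move=> lF hF FG GF; have [f hf fE] := hom_build lF hF.
apply/isoP; exists f; split=> //; exists G => x; rewrite fE //; exact: FG.
Qed.

Lemma iso_refl M : iso M M.
Proof. by apply: (@iso_build _ _ id id). Qed.

Lemma iso_sym M N : iso M N -> iso N M.
Proof. by case=> f [g [fg gf]]; exists g, f. Qed.

Lemma iso_trans N M P : iso M N -> iso N P -> iso M P.
Proof.
move=> /isoP[f [hf bf]] /isoP[g [hg bg]]; apply/isoP.
exists (g \o f)%VF; split; first exact: homspace_comp.
by apply: (eq_bij (bij_comp bg bf)) => x; rewrite comp_lfunE.
Qed.

Lemma iso_dsum M M' N N' : iso M M' -> iso N N' -> iso (dsum M N) (dsum M' N').
Proof.
move=> /isoP[f [hf [f' ff' f'f]]] /isoP[g [hg [g' gg' g'g]]].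
apply: (@iso_build (dsum M N) (dsum M' N')
  (fun x => (f x.1, g x.2)) (fun x => (f' x.1, g' x.2))).
- by move=> c [x y] [z t] /=; rewrite !linearP.
- move=> [x y] a; rewrite /ract /= /dsum_act /=.
  by rewrite (homspaceP _ hf) (homspaceP _ hg).
- by move=> [x y] /=; rewrite ff' gg'.
- by move=> [x y] /=; rewrite f'f g'g.
Qed.

Lemma iso_zero M : iso M zeromod <-> forall x : M, x = 0.
Proof.
split=> [/isoP[f [_ /bij_inj fi]] x|z].
  by apply: fi; apply/rowP; case.
apply: (@iso_build M zeromod (fun _ => 0) (fun _ => 0)).
- by move=> c x y; rewrite scaler0 addr0.
- by move=> x a; apply/rowP; case.
- by move=> x; rewrite [x]z.
- by move=> x; apply/rowP; case.
Qed.

Section Submodule.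
Variables (M : rmod A) (U : {vspace M}).
Hypothesis hU : submodule U.

Definition submod_act (x : subvs_of U) (a : A) : subvs_of U :=
  vsproj U (ract (vsval x) a).

Lemma submod_actE x a : vsval (submod_act x a) = ract (vsval x) a.
Proof. by rewrite vsprojK // hU // subvsP. Qed.

Fact submod_linearl a : linear (submod_act^~ a).
Proof.
move=> c x y; apply/val_inj; rewrite [LHS]submod_actE.
rewrite -[RHS]/(c *: vsval (submod_act x a) + vsval (submod_act y a)).
by rewrite !submod_actE -ractZ -ractD.
Qed.
Fact submod_linearr x : linear (submod_act x).
Proof.
move=> c a b; apply/val_inj; rewrite [LHS]submod_actE.
rewrite -[RHS]/(c *: vsval (submod_act x a) + vsval (submod_act x b)).
by rewrite !submod_actE ract_linearr.
Qed.
Fact submod_act1 x : submod_act x fdone = x.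
Proof. by apply/val_inj; rewrite [LHS]submod_actE ract1. Qed.
Fact submod_actM x a b : submod_act x (a ** b) = submod_act (submod_act x a) b.
Proof. by apply/val_inj; rewrite [LHS]submod_actE [RHS]submod_actE submod_actE ractM. Qed.

Definition submod : rmod A :=
  @RMod k A (subvs_of U) submod_act submod_linearl submod_linearr
    submod_act1 submod_actM.
End Submodule.

Lemma submodule_lker M N (f : 'Hom(M, N)) :
  f \in homspace M N -> submodule (lker f).
Proof.
move=> /homspaceP hf x a; rewrite !memv_ker hf => /eqP ->.
by rewrite ract0.
Qed.

(** The complement is the kernel of [g]: every x is f (g x) plus x - f (g x), and the second term
    lies in that kernel. *)
Lemma retract_dsum M X (f : 'Hom(X, M)) (g : 'Hom(M, X)) :
  f \in homspace X M -> g \in homspace M X -> cancel f g -> summand X M.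
Proof.
move=> hf hg fg; pose K := submod (submodule_lker hg); exists K.
have hk x : x - f (g x) \in lker g by rewrite memv_ker linearB /= fg subrr.
apply: iso_sym.
apply: (@iso_build (dsum X K) M (fun x => f x.1 + vsval x.2)
  (fun x => (g x, vsproj (lker g) (x - f (g x)) : K))).
- move=> c [x y] [z t] /=; rewrite !linearP /= scalerDr.
  by rewrite addrACA.
- move=> [x y] a; rewrite ractD {1}/ract /= (homspaceP _ hf); congr (_ + _).
  by rewrite submod_actE //; apply: submodule_lker.
- move=> [x y] /=; have gy : g (vsval y) = 0.
    by apply/eqP; rewrite -memv_ker subvsP.
  congr pair; first by rewrite linearD /= fg gy addr0.
  by apply/val_inj; rewrite [LHS]vsprojK // linearD /= fg gy addr0 addrC addKr.
- by move=> x /=; rewrite vsprojK // addrC subrK.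
Qed.

End Modules.

(** * Homomorphisms into the Auslander-Reiten translate *)

Section ProjectiveModules.
Variables (k : fieldType) (A : fdAlgType k).
Implicit Types M N X Y P : rmod A.

Lemma projective_lift P X Y (g : 'Hom(X, Y)) (f : 'Hom(P, Y)) :
  projective P -> g \in homspace X Y -> f \in homspace P Y -> limg g = fullv ->
  exists2 h : 'Hom(P, X), h \in homspace P X & forall x, g (h x) = f x.
Proof.
move=> prP hg hf gs; have := prP _ _ (hom_of g) (hom_of f).
rewrite !hom_ofE // => /(_ gs)[h hE].
by exists (vsval h) => //; apply: subvsP.
Qed.

Lemma projectiveI P :
  (forall X Y (g : 'Hom(X, Y)) (f : 'Hom(P, Y)),
    g \in homspace X Y -> f \in homspace P Y -> limg g = fullv ->
    exists2 h : 'Hom(P, X), h \in homspace P X & forall x, g (h x) = f x) ->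
  projective P.
Proof.
move=> prP X Y g f gs; have [h hh hE] := prP _ _ _ _ (subvsP g) (subvsP f) gs.
by exists (hom_of h) => x; rewrite hom_ofE.
Qed.

Section FreeModule.
Variable m : nat.

Definition free_act (x : {ffun 'I_m -> A}) (a : A) : {ffun 'I_m -> A} :=
  [ffun i => x i ** a].
Fact free_linearl a : linear (free_act^~ a).
Proof. by move=> c x y; apply/ffunP => i; rewrite !ffunE fdmul_linearl. Qed.
Fact free_linearr x : linear (free_act x).
Proof. by move=> c a b; apply/ffunP => i; rewrite !ffunE fdmul_linearr. Qed.
Fact free_act1 x : free_act x fdone = x.
Proof. by apply/ffunP => i; rewrite !ffunE fdmul1r. Qed.
Fact free_actM x a b : free_act x (a ** b) = free_act (free_act x a) b.
Proof. by apply/ffunP => i; rewrite !ffunE fdmulA. Qed.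

Definition free_mod : rmod A :=
  @RMod k A {ffun 'I_m -> A} free_act free_linearl free_linearr
    free_act1 free_actM.
End FreeModule.

(** The data of the dual basis lemma, which makes elements of P and of [star P] computable by finite
    sums. *)
Definition dual_basis P m (p : 'I_m -> P) (h : 'I_m -> star P) :=
  forall x, x = \sum_i ract (p i) (vsval (h i) x).

(** A k-basis of P defines a surjection from a free module; the functionals are the coordinates of a
    splitting of it. *)
Lemma projective_dual_basis P : projective P ->
  exists m (p : 'I_m -> P) (h : 'I_m -> star P), dual_basis p h.
Proof.
move=> prP; pose m := \dim {:P}; pose p (i : 'I_m) : P := (vbasis {:P})`_i.
have [g hg gE] : exists2 g : 'Hom(free_mod m, P), g \in homspace (free_mod m) P
    & g =1 fun x : {ffun 'I_m -> A} => \sum_i ract (p i) (x i).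
  apply: hom_build => [c x y|x a] /=.
    rewrite scaler_sumr -big_split /=; apply: eq_bigr => i _.
    by rewrite !ffunE ract_linearr.
  by rewrite ract_suml; apply: eq_bigr => i _; rewrite ffunE ractM.
have gs : limg g = fullv.
  apply/limg_full => y; exists [ffun i => coord (vbasis {:P}) i y *: fdone].
  rewrite gE [RHS](coord_vbasis (memvf y)); apply: eq_bigr => i _.
  by rewrite ffunE ractrZ ract1.
have h1 : \1%VF \in homspace P P by apply/homspaceP => x a; rewrite !id_lfunE.
have [h hh hE] := projective_lift prP hg h1 gs.
have hi i : exists h' : star P, forall x, vsval h' x = (h x : {ffun 'I_m -> A}) i.
  have [f hf fE] : exists2 f : 'Hom(P, regmod A), f \in homspace P (regmod A)
      & f =1 fun x => (h x : {ffun 'I_m -> A}) i.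
    apply: hom_build => [c x y|x a] /=; first by rewrite linearP !ffunE.
    by rewrite (homspaceP _ hh) ffunE.
  by exists (hom_of f) => x; rewrite hom_ofE.
have [H HE] : exists H : 'I_m -> star P,
    forall i x, vsval (H i) x = (h x : {ffun 'I_m -> A}) i.
  exact: (fin_all_exists hi).
exists m, p, H => x; rewrite -{1}[x]id_lfunE -hE gE.
by apply: eq_bigr => i _; rewrite HE.
Qed.

Lemma dual_basis_star P m (p : 'I_m -> P) (h : 'I_m -> star P) (g : star P) :
  dual_basis p h -> g = \sum_i lact (vsval g (p i)) (h i).
Proof.
move=> ph; apply/val_inj/lfunP => x /=; rewrite linear_sum sum_lfunE /=.
rewrite {1}(ph x) linear_sum /=; apply: eq_bigr => i _.
by rewrite star_actE (homspaceP _ (subvsP g)).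
Qed.

End ProjectiveModules.

Section HomToTau.
Variables (k : fieldType) (A : fdAlgType k).
Variables (P1 P0 : rmod A) (f : rhom P1 P0) (X : rmod A).
Hypotheses (prP1 : projective P1) (prP0 : projective P0).

(** Surjectivity of Hom(f, X). For a minimal presentation of M it replaces the vanishing of Hom(X,
    tau M), by the two lemmas of this section. *)
Definition extends_along :=
  forall u : 'Hom(P1, X), u \in homspace P1 X ->
  exists2 v : 'Hom(P0, X), v \in homspace P0 X & forall x, u x = v (vsval f x).

(** The image of the tensor of m and h under the canonical map from X (x) [star P] to Hom(P, X). For
    projective P these maps span, by a dual basis. *)
Let mul P (m : X) (h : star P) : 'Hom(P, X) := (ractr_lfun m \o vsval h)%VF.

Let mulE P m (h : star P) x : mul m h x = ract m (vsval h x).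
Proof. by rewrite comp_lfunE ractr_lfunE. Qed.

Let mul_hom P m (h : star P) : mul m h \in homspace P X.
Proof.
by apply/homspaceP => x a; rewrite !mulE (homspaceP _ (subvsP h)) ractM.
Qed.

Local Notation pi := (quot_pi (star_img f)).

(* A functional l on Hom(P1, X) that vanishes on the maps extending to P0      *)
(* induces the map X -> D Tr sending m to (h |-> l (x |-> m h(x))).            *)
Lemma hom_tau_extends :
  homspace X (dual (transpose f)) = 0%VS -> extends_along.
Proof.
move=> hom0 u hu.
have lc : linear (fun v : 'Hom(P0, X) => v \o vsval f)%VF.
  by move=> c v w; apply/lfunP => x; rewrite !(comp_lfunE, add_lfunE, scale_lfunE).
have [C CE] := lfun_build lc.
pose I := (C @: homspace P0 X)%VS.
have [uI|nuI] := boolP (u \in I).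
  case/memv_imgP: uI => v hv ->; exists v => // x.
  by rewrite CE comp_lfunE.
(* Otherwise some functional vanishes on I and is 1 at u. The homomorphism from X that it induces is
   zero by hypothesis, so it vanishes on all [mul m h], and u is a sum of such maps. *)
have [l0 l0u] : exists l : 'Hom(subvs_of I^C, k^o), l (quot_pi I u) = 1.
  by apply: exists_functional; rewrite quot_pi_eq0.
pose l v := l0 (quot_pi I v).
have lI v : v \in I -> l v = 0.
  by rewrite -quot_pi_eq0 /l => /eqP ->; rewrite linear0.
have ll : linear l by move=> c v w; rewrite /l !linearP.
pose F (m : X) : dual (transpose f) :=
  linfun (fun c : subvs_of (star_img f)^C => l (mul m (vsval c)) : k^o).
have mulDr m c (h h' : star P1) : mul m (c *: h + h') = c *: mul m h + mul m h'.
  apply/lfunP => x; rewrite !(mulE, add_lfunE, scale_lfunE) /=.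
  by rewrite ract_linearr.
have mulDl m m' c (h : star P1) : mul (c *: m + m') h = c *: mul m h + mul m' h.
  by apply/lfunP => x; rewrite !(mulE, add_lfunE, scale_lfunE) ract_linearl.
have FE m c : F m c = l (mul m (vsval c)).
  by rewrite /F linfunE // => a x y /=; rewrite -ll -mulDr.
(* The functional descends to the cokernel: changing h by an element of [star_img f] changes
   [mul m h] by a map that factors through f. *)
have Lpi m h : l (mul m (vsval (pi h))) = l (mul m h).
  have /memv_imgP[g _ sE] : vsval (pi h) - h \in star_img f.
    by rewrite -quot_pi_eq quot_piK.
  rewrite linfunE in sE; last exact: star_map_linear.
  have -> : vsval (pi h) = 1 *: star_map f g + h by rewrite scale1r -sE subrK.
  rewrite mulDr ll scale1r lI ?add0r //.
  apply/memv_imgP; exists (mul m g); first exact: mul_hom.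
  by rewrite CE; apply/lfunP => x; rewrite [RHS]comp_lfunE !mulE star_mapE.
have [Fh hF FhE] : exists2 Fh, Fh \in homspace X (dual (transpose f)) & Fh =1 F.
  apply: hom_build => [c x y|x a]; apply/lfunP => t.
    by rewrite add_lfunE scale_lfunE !FE mulDl ll.
  rewrite [RHS]dual_actE !FE Lpi; congr l; apply/lfunP => y.
  by rewrite !mulE star_actE ractM.
have L0 m h : l (mul m h) = 0.
  rewrite -Lpi -FE -FhE; move: hF; rewrite hom0 memv0 => /eqP ->.
  by rewrite !zero_lfunE.
have [m [p [h ph]]] := projective_dual_basis prP1.
have uE : u = \sum_i mul (u (p i)) (h i).
  apply/lfunP => x; rewrite sum_lfunE {1}(ph x) linear_sum /=.
  by apply: eq_bigr => i _; rewrite mulE (homspaceP _ hu).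
have [L LE] := lfun_build ll.
have := oner_eq0 k; rewrite -l0u -/(l u) -LE uE linear_sum big1 ?eqxx //= => i _.
by rewrite LE L0.
Qed.

(** A homomorphism F from X to D Tr amounts to a pairing b of X with [star P1] that is balanced over
    A and vanishes on [star_img f]. Extending [mul m h] along f moves every value of b into that
    image. *)
Lemma extends_hom_tau :
  extends_along -> homspace X (dual (transpose f)) = 0%VS.
Proof.
move=> ext; apply/eqP; rewrite -subv0; apply/subvP => F hF.
rewrite memv0; apply/eqP/lfunP => m; rewrite zero_lfunE; apply/lfunP => c.
rewrite zero_lfunE; pose b m h := (F m : 'Hom(transpose f, k^o)) (pi h).
have bal x a h : b (ract x a) h = b x (lact a h).
  rewrite /b (homspaceP _ hF) [LHS]dual_actE; congr (F x _).
  exact: tr_act_pi.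
have bsum x I (r : seq I) (G : I -> star P1) :
    b x (\sum_(i <- r) G i) = \sum_(i <- r) b x (G i).
  by rewrite /b !linear_sum.
have bsuml h I (r : seq I) (G : I -> X) :
    b (\sum_(i <- r) G i) h = \sum_(i <- r) b (G i) h.
  by rewrite /b linear_sum sum_lfunE.
have [r [p [h ph]]] := projective_dual_basis prP1.
have [s [q [g qg]]] := projective_dual_basis prP0.
have bE x t : b x t = \sum_i b (mul x t (p i)) (h i).
  rewrite {1}(dual_basis_star t ph) bsum; apply: eq_bigr => i _.
  by rewrite -bal mulE.
rewrite -[c](quot_piK) -/(b m _) bE.
have [v hv vE] := ext _ (mul_hom m (vsval c)).
(* Expand f (p i) in the dual basis of P0 and move the coefficients across b; summing over i then
   reassembles [star_map f (g j)] from the dual basis of P1. *)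
under eq_bigr => i _.
  rewrite vE (qg (vsval f (p i))) linear_sum /= bsuml.
  under eq_bigr => j _ do rewrite (homspaceP _ hv) -star_mapE bal.
  over.
rewrite exchange_big big1 //= => j _.
rewrite -bsum -dual_basis_star // /b.
suff /eqP -> : pi (star_map f (g j)) == 0 by rewrite linear0.
rewrite quot_pi_eq0; apply/memv_imgP; exists (g j); rewrite ?memvf //.
by rewrite linfunE //; apply: star_map_linear.
Qed.

End HomToTau.

(** * Direct sums of presentations *)

Section DirectSums.
Variables (k : fieldType) (A : fdAlgType k).
Implicit Types M N X Y P : rmod A.

Lemma dsum_inl M N : exists2 i : 'Hom(M, dsum M N),
  i \in homspace M (dsum M N) & i =1 fun x => (x, 0).
Proof.
apply: hom_build => [c x y|x a]; first by congr pair; rewrite /= scaler0 addr0.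
by rewrite /= /dsum_act /= ract0.
Qed.

Lemma dsum_inr M N : exists2 i : 'Hom(N, dsum M N),
  i \in homspace N (dsum M N) & i =1 fun x => (0, x).
Proof.
apply: hom_build => [c x y|x a]; first by congr pair; rewrite /= scaler0 addr0.
by rewrite /= /dsum_act /= ract0.
Qed.

Lemma dsum_fst M N : exists2 p : 'Hom(dsum M N, M),
  p \in homspace (dsum M N) M & p =1 fun x : M * N => x.1.
Proof. by apply: hom_build. Qed.

Lemma dsum_snd M N : exists2 p : 'Hom(dsum M N, N),
  p \in homspace (dsum M N) N & p =1 fun x : M * N => x.2.
Proof. by apply: hom_build. Qed.

Lemma dsum_map M M' N N' (f : 'Hom(M, M')) (g : 'Hom(N, N')) :
  f \in homspace M M' -> g \in homspace N N' ->
  exists2 h : 'Hom(dsum M N, dsum M' N'), h \in homspace (dsum M N) (dsum M' N')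
    & h =1 fun x : M * N => (f x.1, g x.2).
Proof.
move=> hf hg; apply: hom_build => [c x y|x a]; first by rewrite /= !linearP.
by rewrite /= (homspaceP _ hf) (homspaceP _ hg).
Qed.

Lemma hom_combine M N X (f : 'Hom(M, X)) (g : 'Hom(N, X)) :
  f \in homspace M X -> g \in homspace N X ->
  exists2 h : 'Hom(dsum M N, X), h \in homspace (dsum M N) X
    & h =1 fun x : M * N => f x.1 + g x.2.
Proof.
move=> hf hg; apply: hom_build => [c x y|x a].
  by rewrite /= !linearP scalerDr addrACA.
by rewrite /= (homspaceP _ hf) (homspaceP _ hg) ractD.
Qed.

Lemma hom_pair M N X (f : 'Hom(X, M)) (g : 'Hom(X, N)) :
  f \in homspace X M -> g \in homspace X N ->
  exists2 h : 'Hom(X, dsum M N), h \in homspace X (dsum M N)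
    & h =1 fun x => (f x, g x).
Proof.
move=> hf hg; apply: hom_build => [c x y|x a]; first by rewrite !linearP.
by rewrite (homspaceP _ hf) (homspaceP _ hg).
Qed.

Lemma projective_zero P : (forall x : P, x = 0) -> projective P.
Proof.
move=> z; apply: projectiveI => X Y g f _ _ _; exists 0; first exact: mem0v.
by move=> x; rewrite [x]z !linear0.
Qed.

Lemma projective_dsum P P' :
  projective P -> projective P' -> projective (dsum P P').
Proof.
move=> prP prP'; apply: projectiveI => X Y g f hg hf gs.
have [i1 hi1 i1E] := dsum_inl P P'; have [i2 hi2 i2E] := dsum_inr P P'.
have [h1 hh1 h1E] := projective_lift prP hg (homspace_comp hf hi1) gs.
have [h2 hh2 h2E] := projective_lift prP' hg (homspace_comp hf hi2) gs.
have [h hh hE] := hom_combine hh1 hh2; exists h => // -[x y].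
rewrite hE linearD /= h1E h2E !comp_lfunE -linearD /= i1E i2E.
by congr (f _); congr pair; rewrite /= ?addr0 ?add0r.
Qed.

Lemma superfluousS M (U V : {vspace M}) :
  (V <= U)%VS -> superfluous U -> superfluous V.
Proof.
move=> VU sU W sW VW; apply: sU => //; apply/eqP; rewrite eqEsubv subvf /= -VW.
exact: addvS.
Qed.

Lemma superfluous0 M : superfluous (0%VS : {vspace M}).
Proof. by move=> W _; rewrite add0v. Qed.

(** The preimage of W together with U is all of M, hence the preimage alone is; so W contains the
    image of f. *)
Lemma superfluous_img M N (f : 'Hom(M, N)) U :
  f \in homspace M N -> superfluous U -> superfluous (f @: U)%VS.
Proof.
move=> /homspaceP hf sU W sW fUW.
have T : (f @^-1: W)%VS = fullv.
  apply: sU => [x a|]; first by rewrite -!memv_preim hf; apply: sW.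
  apply/eqP; rewrite eqEsubv subvf; apply/subvP => m _.
  have : f m \in (f @: U + W)%VS by rewrite fUW memvf.
  case/memv_addP => _ /memv_imgP[u uU ->] [w wW E].
  apply/memv_addP; exists u => //.
  exists (m - u); last by rewrite addrC subrK.
  by rewrite -memv_preim linearB /= E addrC addKr.
rewrite -fUW; apply/esym/addv_idPr; apply/subvP => _ /memv_imgP[u _ ->].
by rewrite memv_preim T memvf.
Qed.

Lemma superfluousD M (U V : {vspace M}) :
  submodule V -> superfluous U -> superfluous V -> superfluous (U + V)%VS.
Proof.
move=> mV sU sV W sW; rewrite -addvA => UVW; apply: (sV) => //; apply: sU => //.
move=> x a /memv_addP[v vV [w wW ->]]; rewrite ractD; apply: memv_add.
  exact: mV.
exact: sW.
Qed.

Lemma submodule_img M N (f : 'Hom(M, N)) U :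
  f \in homspace M N -> submodule U -> submodule (f @: U)%VS.
Proof.
move=> /homspaceP hf sU _ a /memv_imgP[x xU ->].
by rewrite -hf memv_img ?sU.
Qed.

Lemma superfluous_dsum M N (U : {vspace M}) (V : {vspace N})
    (W : {vspace (dsum M N)}) :
  submodule V -> superfluous U -> superfluous V ->
  (forall x : M * N, x \in W -> x.1 \in U /\ x.2 \in V) -> superfluous W.
Proof.
move=> mV sU sV WUV.
have [i1 hi1 i1E] := dsum_inl M N; have [i2 hi2 i2E] := dsum_inr M N.
apply: (@superfluousS _ (i1 @: U + i2 @: V)%VS).
  apply/subvP => -[x y] /WUV /= [xU yV].
  have -> : (x, y) = i1 x + i2 y.
    by rewrite i1E i2E; congr pair; rewrite /= ?addr0 ?add0r.
  by rewrite memv_add ?memv_img.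
apply: superfluousD; first exact: submodule_img.
  exact: superfluous_img.
exact: superfluous_img.
Qed.

(** For X = M this is tau-rigidity. Separating the two roles of M allows induction over the summands
    of the presented module and of the target one at a time. *)
Definition has_extending_presentation M X :=
  exists P1 P0 (f : rhom P1 P0) (g : rhom P0 M),
    min_proj_presentation f g /\ extends_along f X.

Lemma extending_presentation_zero X :
  has_extending_presentation zeromod X.
Proof.
have z (x : (zeromod : rmod A)) : x = 0 by apply/rowP; case.
have prz : projective (zeromod : rmod A) by apply: projective_zero.
have full0 (U : {vspace (zeromod : rmod A)}) : U = 0%VS.
  by apply/eqP; rewrite -subv0; apply/subvP => x _; rewrite memv0 [x]z.
exists zeromod, zeromod, 0, 0; split; last first.
  move=> u _; exists 0; first exact: mem0v.
  by move=> x; rewrite [x]z !linear0.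
split=> //; rewrite ?[LHS]full0 ?[RHS]full0 //.
by split; rewrite [X in superfluous X]full0; apply: superfluous0.
Qed.

Lemma extending_presentation_dsum M M' X :
  has_extending_presentation M X -> has_extending_presentation M' X ->
  has_extending_presentation (dsum M M') X.
Proof.
move=> [P1 [P0 [f [g [[prP1 prP0 gs fg [sg sf]] ext]]]]].
move=> [P1' [P0' [f' [g' [[prP1' prP0' gs' fg' [sg' sf']] ext']]]]].
have [F hF FE] := dsum_map (subvsP f) (subvsP f').
have [G hG GE] := dsum_map (subvsP g) (subvsP g').
exists (dsum P1 P1'), (dsum P0 P0'), (hom_of F), (hom_of G).
rewrite /extends_along !hom_ofE //; split; last first.
  move=> u hu.
  have [i1 hi1 i1E] := dsum_inl P1 P1'; have [i2 hi2 i2E] := dsum_inr P1 P1'.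
  have [v1 hv1 v1E] := ext _ (homspace_comp hu hi1).
  have [v2 hv2 v2E] := ext' _ (homspace_comp hu hi2).
  have [v hv vE] := hom_combine hv1 hv2; exists v => // -[x y].
  rewrite vE FE /= -v1E -v2E !comp_lfunE -linearD /= i1E i2E.
  by congr (u _); congr pair; rewrite /= ?addr0 ?add0r.
split; rewrite ?hom_ofE //.
- exact: projective_dsum.
- exact: projective_dsum.
- apply/limg_full => -[x y].
  move/limg_full/(_ x): gs => [x' <-]; move/limg_full/(_ y): gs' => [y' <-].
  by exists (x', y'); rewrite GE.
- apply/vspaceP => -[x y]; rewrite memv_ker GE.
  transitivity ((x \in lker (vsval g)) && (y \in lker (vsval g'))); last first.
    by rewrite !memv_ker.
  rewrite -fg -fg'; apply/memv_imgP/andP => [[z _]|].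
    by rewrite FE => -[-> ->]; rewrite !memv_img ?memvf.
  case=> /memv_imgP[x' _ ->] /memv_imgP[y' _ ->].
  by exists (x', y'); rewrite ?memvf ?FE.
split.
- apply: (superfluous_dsum _ sg sg'); first exact: submodule_lker (subvsP g').
  by move=> [x y] /=; rewrite !memv_ker GE => /eqP[-> ->].
- apply: (superfluous_dsum _ sf sf'); first exact: submodule_lker (subvsP f').
  by move=> [x y] /=; rewrite !memv_ker FE => /eqP[-> ->].
Qed.

Lemma extends_along_zero P1 P0 (f : rhom P1 P0) : extends_along f zeromod.
Proof.
by move=> u _; exists 0; [exact: mem0v|move=> x; apply/rowP; case].
Qed.

Lemma extends_along_dsum P1 P0 (f : rhom P1 P0) X Y :
  extends_along f X -> extends_along f Y -> extends_along f (dsum X Y).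
Proof.
have [p hp pE] := dsum_fst X Y; have [q hq qE] := dsum_snd X Y.
move=> eX eY u hu.
have [v1 hv1 v1E] := eX _ (homspace_comp hp hu).
have [v2 hv2 v2E] := eY _ (homspace_comp hq hu).
have [v hv vE] := hom_pair hv1 hv2; exists v => // x.
by rewrite vE -v1E -v2E !comp_lfunE pE qE -surjective_pairing.
Qed.

Lemma tau_rigidP M : tau_rigid M <-> has_extending_presentation M M.
Proof.
split=> [|[P1 [P0 [f [g [pres ext]]]]]]; last first.
  exists (dual (transpose f)); have [prP1 prP0 _ _ _] := pres; split.
    by exists P1, P0, f, g; split=> //; apply: iso_refl.
  exact: extends_hom_tau.
move=> [N [[P1 [P0 [f [g [pres /isoP[i [hi bi]]]]]]] hom0]].
have [prP1 prP0 _ _ _] := pres; exists P1, P0, f, g; split=> //.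
apply: hom_tau_extends => //; have /iso_sym/isoP[j [hj bj]] : iso N (dual (transpose f)).
  by apply/isoP; exists i.
apply/eqP; rewrite -subv0; apply/subvP => F hF; rewrite memv0.
have := homspace_comp hj hF; rewrite hom0 memv0 => /eqP/lfunP z.
apply/eqP/lfunP => x; rewrite zero_lfunE; apply: (bij_inj bj).
by rewrite -comp_lfunE z zero_lfunE linear0.
Qed.

End DirectSums.

(** * Interval modules *)

Section IntervalModules.
Variables (k : fieldType) (n : nat).
Local Notation A := (path_alg k n).
Implicit Types (p q : qpath n) (M N X Y : rmod (path_alg k n)).

(* The path from vertex [i] to vertex [j]; it is zero if [j < i] or [n <= j]. *)
Definition pe (i j : nat) : A :=
  [ffun p => ((psrc p == i :> nat) && (ptgt p == j :> nat))%:R].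

Lemma pcoef_pe i j (s t : 'I_n) :
  pcoef (pe i j) s t = ([&& s == i :> nat, t == j :> nat & i <= j]%N)%:R.
Proof.
have [le_st|nle_st] := boolP (s <= t)%N.
  rewrite -[s]/(psrc (Sub (s, t) le_st)) -[t]/(ptgt (Sub (s, t) le_st)) pcoefE.
  rewrite ffunE /psrc /ptgt /=.
  by do 2![case: eqP => //= <-]; rewrite le_st.
rewrite pcoef0 //; case: eqP => //= <-; case: eqP => //= <-.
by rewrite (negPf nle_st).
Qed.

Lemma peM i j l : (i <= j)%N -> (j <= l)%N -> pe i j ** pe j l = pe i l.
Proof.
move=> ij jl; apply: pcoef_inj; rewrite pcoefM; apply/matrixP => s t.
rewrite mxE pcoef_pe (leq_trans ij jl) andbT.
under eq_bigr => r _ do rewrite !pcoef_pe ij jl !andbT.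
have [ltjn|gejn] := ltnP j n; last first.
  rewrite big1 => [|r _].
    by case: (t =P l :> nat) => [tl|]; rewrite ?andbF //;
      have := ltn_ord t; rewrite tl ltnNge (leq_trans gejn jl).
  have /negPf -> : r != j :> nat by rewrite neq_ltn (leq_trans (ltn_ord r)).
  by rewrite andbF mul0r.
rewrite (bigD1 (Ordinal ltjn)) //= big1 ?addr0 => [|r].
  by rewrite eqxx andbT -natrM mulnb.
by rewrite -val_eqE /= => /negPf ->; rewrite andbF mul0r.
Qed.

Lemma peM0 i j j' l : j != j' -> pe i j ** pe j' l = 0.
Proof.
move=> nj; apply: pcoef_inj; rewrite pcoefM; apply/matrixP => s t.
rewrite [pcoef 0]linear0 !mxE big1 // => r _; rewrite !pcoef_pe.
case: (r =P j :> nat) => [->|_]; last by rewrite andbF mul0r.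
by rewrite (negPf nj) mulr0.
Qed.

Lemma path_alg_sum (a : A) : a = \sum_p a p *: pe (psrc p) (ptgt p).
Proof.
apply/ffunP => q; rewrite sum_ffunE (bigD1 q) //= big1 => [|p npq].
  by rewrite addr0 !ffunE !eqxx [RHS]mulr1.
rewrite !ffunE; suff -> : (psrc q == psrc p :> nat) && (ptgt q == ptgt p :> nat) = false.
  by rewrite [LHS]mulr0.
apply: contraNF npq => /andP[/eqP/val_inj e1 /eqP/val_inj e2].
apply/eqP/val_inj; move: e1 e2; rewrite /psrc /ptgt.
by case: (val p) (val q) => [? ?] [? ?] /= -> ->.
Qed.

Lemma path_alg_one : (fdone : A) = \sum_(i < n) pe i i.
Proof.
apply: pcoef_inj; rewrite pcoef1 linear_sum; apply/matrixP => s t.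
rewrite summxE mxE (bigD1 s) //= big1 ?addr0 => [|i].
  by rewrite pcoef_pe eqxx leqnn andbT /= eq_sym.
by rewrite pcoef_pe -val_eqE /= eq_sym => /negPf ->.
Qed.

Lemma pe_out i j : (n <= j)%N -> pe i j = 0.
Proof.
move=> nj; apply/ffunP => p; rewrite !ffunE.
by rewrite [_ == j]ltn_eqF ?andbF // (leq_trans (ltn_ord _)).
Qed.

Lemma homspace_path M N (f : 'Hom(M, N)) :
  (forall x i j, (i <= j)%N -> f (ract x (pe i j)) = ract (f x) (pe i j)) ->
  f \in homspace M N.
Proof.
move=> h; apply/homspaceP => x a; rewrite (path_alg_sum a) !ractr_sum linear_sum.
by apply: eq_bigr => p _; rewrite !ractrZ linearZ /= h // (valP p).
Qed.

Lemma ract_sum1 M (x : M) : x = \sum_(i < n) ract x (pe i i).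
Proof. by rewrite -ractr_sum -path_alg_one ract1. Qed.

Section Coordinates.
Variable S : {set 'I_n}.

(** Coordinates are indexed by all natural numbers and vanish off S, so that elements of different
    string modules can be compared without a change of index type. *)
Definition co (x : string_mod k S) (i : nat) : k :=
  \sum_(u : {l : 'I_n | l \in S} | val u == i :> nat) (x : string_space k S) u.

Lemma coE (x : string_mod k S) (u : {l : 'I_n | l \in S}) :
  co x (val u) = (x : string_space k S) u.
Proof. by rewrite /co (big_pred1 u) // => v; rewrite -!val_eqE. Qed.

Lemma coP (x y : string_mod k S) : (forall i, co x i = co y i) -> x = y.
Proof. by move=> e; apply/ffunP => u; rewrite -!coE e. Qed.

Lemma co_linear i : linear (fun x => co x i : k^o).
Proof.
move=> c x y; rewrite /co scaler_sumr -big_split /=; apply: eq_bigr => u _.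
by rewrite !ffunE.
Qed.

Lemma co_out (x : string_mod k S) (i : nat) :
  (forall u : 'I_n, u \in S -> u != i :> nat) -> co x i = 0.
Proof. by move=> h; rewrite /co big_pred0 // => u; apply/negbTE/h/valP. Qed.

Definition mk_string (F : nat -> k) : string_mod k S :=
  [ffun u : {l : 'I_n | l \in S} => (F (val u) : k^o)].
End Coordinates.

Definition itv p : {set 'I_n} := [set l : 'I_n | psrc p <= l <= ptgt p]%N.
Definition str p : rmod (path_alg k n) := string_mod k (itv p).

Implicit Types (i j l : nat).

Lemma co_str_out p (x : str p) i : ~~ (psrc p <= i <= ptgt p)%N -> co x i = 0.
Proof.
move=> h; apply: co_out => u; rewrite inE; apply: contraTN => /eqP ->.
exact: h.
Qed.

Lemma co_mk p F i :
  co (mk_string (itv p) F) i = if (psrc p <= i <= ptgt p)%N then F i else 0.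
Proof.
case: ifP => h; last by rewrite co_str_out ?h.
have lti : (i < n)%N by case/andP: h => _ /leq_ltn_trans; apply.
have hi : Ordinal lti \in itv p by rewrite inE.
pose u : {l | l \in itv p} := Sub (Ordinal lti) hi.
by rewrite -[i in co _ i]/(nat_of_ord (val u)) coE ffunE.
Qed.

(** Intervals are convex, so a path runs inside one as soon as its two ends lie in it. *)
Lemma co_ract p (x : str p) i j l : (i <= j)%N ->
  co (ract x (pe i j)) l =
  if [&& l == j, psrc p <= i & j <= ptgt p]%N then co x i else 0.
Proof.
move=> ij; have [h|h] := boolP (psrc p <= l <= ptgt p)%N; last first.
  rewrite co_str_out //; case: ifP => // /and3P[/eqP lj pi jp].
  by rewrite lj jp (leq_trans pi ij) in h.
have ltl : (l < n)%N by case/andP: h => _ /leq_ltn_trans; apply.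
have hl : Ordinal ltl \in itv p by rewrite inE.
pose u : {l | l \in itv p} := Sub (Ordinal ltl) hl.
rewrite -[l in co _ l]/(nat_of_ord (val u)) coE [LHS]string_actE.
rewrite (eq_bigr (fun v : {l | l \in itv p} =>
  if (val v == i :> nat) then (if [&& l == j, psrc p <= i & j <= ptgt p]%N then
    (x : string_space k _) v else 0) else 0)); last first.
  move=> v _; rewrite /scoef pcoef_pe ij andbT -[nat_of_ord (val u)]/l.
  have [vi|nvi] := eqVneq; last by case: ifP; rewrite mul0r.
  have [lj|nlj] := eqVneq l j; last by case: ifP; rewrite mul0r.
  have pv := valP v; rewrite inE vi in pv; case/andP: pv => pi ip.
  rewrite pi -lj; case/andP: h => pl ->.
  case: forallP => [_|[]]; first by rewrite mul1r.
  move=> r; apply/implyP; rewrite vi inE => /andP[ir rl].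
  rewrite (leq_trans pi ir) (leq_trans rl) //.
  by have := valP u; rewrite inE => /andP[].
rewrite -big_mkcond /=; case: ifP => // _; last by rewrite big1.
Qed.

End IntervalModules.

(** * The rank function and the classification of modules *)

Section RankFunction.
Variables (k : fieldType) (n : nat).
Local Notation A := (path_alg k n).
Local Notation pe := (@pe k n).
Local Notation str := (str k).
Implicit Types (p q : qpath n) (M N X Y : rmod (path_alg k n)) (i j l : nat).

Lemma co0 (S : {set 'I_n}) i : co (0 : string_mod k S) i = 0.
Proof. by rewrite /co big1 // => u _; rewrite ffunE. Qed.

Lemma coZ (S : {set 'I_n}) c (x : string_mod k S) i : co (c *: x) i = c * co x i.
Proof. by have := @co_linear k n S i c x 0; rewrite !addr0 co0 addr0. Qed.

(** The basis vector at the source generates [str p], since the paths inside the interval carry it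
    to all the others; homomorphisms from [str p] are determined by their value here. *)
Definition gen p : str p := mk_string (itv p) (fun i => (i == psrc p)%:R).

Lemma co_gen p i : co (gen p) i = (i == psrc p :> nat)%:R.
Proof.
rewrite co_mk; case: ifP => //; case: eqP => // -> /negP[].
by rewrite leqnn (valP p).
Qed.

Lemma str_gen p (x : str p) :
  x = \sum_(j < n) co x j *: ract (gen p) (pe (psrc p) j).
Proof.
apply: coP => l; have lc (i : nat) := lfun_build (@co_linear k n (itv p) i).
have [c cE] := lc l; rewrite -!cE linear_sum /= !cE.
under eq_bigr => j _ do rewrite linearZ /= cE.
have [ltl|gel] := ltnP l n; last first.
  rewrite co_out => [|u _]; last by rewrite ltn_eqF // (leq_trans (ltn_ord u)).
  rewrite big1 // => j _; rewrite [co _ l]co_out ?scaler0 // => u _.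
  by rewrite ltn_eqF // (leq_trans (ltn_ord u)).
rewrite (bigD1 (Ordinal ltl)) //= big1 ?addr0 => [|j nj]; last first.
  have [aj|ja] := leqP (psrc p) j; last first.
    by rewrite co_str_out ?scale0r // leqNgt ja.
  rewrite co_ract // [l == j]eq_sym.
  by move: nj; rewrite -val_eqE /= => /negPf ->; rewrite scaler0.
have [h|h] := boolP (psrc p <= l <= ptgt p)%N; last first.
  by rewrite co_str_out ?scale0r.
case/andP: h => al lb; rewrite co_ract // eqxx leqnn lb co_gen eqxx.
by rewrite [RHS]mulr1.
Qed.

Lemma hom_str p M (f : 'Hom(str p, M)) : f \in homspace (str p) M ->
  forall x, f x = \sum_(j < n) co x j *: ract (f (gen p)) (pe (psrc p) j).
Proof.
move=> /homspaceP hf x; rewrite {1}(str_gen x) linear_sum.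
by apply: eq_bigr => j _; rewrite linearZ /= hf.
Qed.

Lemma gen_out p j : (ptgt p < j)%N -> ract (gen p) (pe (psrc p) j) = 0.
Proof.
move=> bj; apply: coP => l; rewrite co0 co_ract; last first.
  by apply: leq_trans (ltnW bj); apply: (valP p).
by rewrite [(j <= _)%N]leqNgt bj !andbF.
Qed.

Lemma gen_src p : ract (gen p) (pe (psrc p) (psrc p)) = gen p.
Proof.
apply: coP => l; rewrite co_ract // !co_gen leqnn (valP p) /= andbT.
by case: eqP => // _; rewrite eqxx.
Qed.

(** The universal property of [str p]: its generator sits at the source, and the only relations kill
    the paths that run past the target. *)
Lemma str_hom p M (y : M) : ract y (pe (psrc p) (psrc p)) = y ->
  (forall j, (ptgt p < j)%N -> ract y (pe (psrc p) j) = 0) ->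
  exists2 f : 'Hom(str p, M), f \in homspace (str p) M & f (gen p) = y.
Proof.
move=> ya yb; set a := psrc p in ya yb *.
have [f fE] : exists f : 'Hom(str p, M),
    f =1 fun x => \sum_(j < n) co x j *: ract y (pe a j).
  apply: lfun_build => c x z; rewrite scaler_sumr -big_split /=.
  apply: eq_bigr => j _.
  by rewrite (@co_linear k n (itv p) j) scalerDl scalerA.
exists f; last first.
  rewrite fE (bigD1 a) //= big1 ?addr0 => [|j nj].
    by rewrite co_gen eqxx scale1r.
  by rewrite co_gen; case: eqP => [/val_inj/eqP|]; rewrite ?scale0r ?(negPf nj).
apply: homspace_path => x s t st; rewrite !fE ract_suml.
have [ltt|get] := ltnP t n; last first.
  rewrite pe_out // ractr0 big1 => [|j _]; last by rewrite co0 scale0r.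
  by rewrite big1 // => j _; rewrite ractr0.
have lts := leq_ltn_trans st ltt.
rewrite [RHS](bigD1 (Ordinal lts)) //= [in RHS]big1 ?addr0 => [|j nj]; last first.
  rewrite ractZ -ractM peM0 ?ractr0 ?scaler0 //.
rewrite (bigD1 (Ordinal ltt)) //= big1 ?addr0 => [|j nj]; last first.
  by rewrite co_ract //; move: nj; rewrite -val_eqE /= => /negPf ->; rewrite scale0r.
rewrite ractZ -ractM co_ract // eqxx /=.
have [as_|sa] := leqP a s; last first.
  by rewrite scale0r co_str_out ?scale0r // leqNgt sa.
rewrite peM //; case: leqP => //= bt; by rewrite yb // scaler0 scaler0.
Qed.

(** The path from i to j kills every M e_l with l different from i, so its rank on all of M is the
    rank of M e_i -> M e_j. For i = j this is the dimension of M e_i. *)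
Definition rk M i j : nat := \dim (limg (ract_lfun M (pe i j))).

Lemma rk_eq0P M i j : reflect (forall x : M, ract x (pe i j) = 0) (rk M i j == 0%N).
Proof.
rewrite /rk dimv_eq0 -lkerE; apply: (iffP subvP) => h x; last first.
  by move=> _; rewrite memv_ker ract_lfunE h.
by have := h x (memvf x); rewrite memv_ker ract_lfunE => /eqP.
Qed.

Lemma rk_gt M i j : (j < i)%N -> rk M i j = 0%N.
Proof.
move=> ji; apply/eqP/rk_eq0P => x; suff -> : pe i j = 0 by rewrite ractr0.
apply/ffunP => p; rewrite !ffunE; case: eqP => //= ip; case: eqP => // jp.
by have := valP p; rewrite -/(psrc p) -/(ptgt p) ip jp leqNgt ji.
Qed.

Lemma rk_out M i j : (n <= j)%N -> rk M i j = 0%N.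
Proof. by move=> nj; apply/eqP/rk_eq0P => x; rewrite pe_out ?ractr0. Qed.

Lemma rk_iso M N i j : iso M N -> rk M i j = rk N i j.
Proof.
move=> /isoP[f [/homspaceP hf [g fg gf]]]; rewrite /rk.
have fs : limg f = fullv by apply/limg_full => y; exists (g y).
rewrite -fs -limg_comp.
have -> : (ract_lfun N (pe i j) \o f)%VF = (f \o ract_lfun M (pe i j))%VF.
  by apply/lfunP => x; rewrite !comp_lfunE !ract_lfunE hf.
rewrite limg_comp [RHS]limg_dim_eq //; apply/eqP; rewrite -subv0; apply/subvP => x.
by rewrite memv_cap memv_ker memv0 => /andP[_ /eqP fx]; rewrite -[x]fg fx -(linear0 f) fg.
Qed.

Lemma rk_dsum M N i j : rk (dsum M N) i j = (rk M i j + rk N i j)%N.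
Proof.
have [f hf fE] := dsum_inl M N; have [g hg gE] := dsum_inr M N.
rewrite /rk; set R := ract_lfun _ _; set RM := ract_lfun M _; set RN := ract_lfun N _.
have -> : limg R = (f @: limg RM + g @: limg RN)%VS.
  apply/vspaceP => -[x y]; apply/memv_imgP/memv_addP.
    case=> -[x' y'] _; rewrite ract_lfunE => -[-> ->].
    exists (f (ract x' (pe i j))); first by rewrite memv_img // -ract_lfunE memv_img ?memvf.
    exists (g (ract y' (pe i j))); first by rewrite memv_img // -ract_lfunE memv_img ?memvf.
    by rewrite fE gE; congr pair; rewrite /= ?addr0 ?add0r.
  case=> _ /memv_imgP[_ /memv_imgP[x' _ ->] ->].
  case=> _ /memv_imgP[_ /memv_imgP[y' _ ->] ->] ->.
  exists (x', y'); rewrite ?memvf // !ract_lfunE fE gE.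
  by congr pair; rewrite /= ?addr0 ?add0r.
rewrite dimv_disjoint_sum; last first.
  apply/eqP; rewrite -subv0; apply/subvP => x; rewrite memv_cap memv0.
  case/andP=> /memv_imgP[y _ ->] /memv_imgP[z _]; rewrite fE gE => -[-> _].
  by [].
congr (_ + _)%N; apply: limg_dim_eq; apply/eqP; rewrite -subv0; apply/subvP => x;
  by rewrite memv_cap memv_ker memv0 ?fE ?gE => /andP[_ /eqP[->]].
Qed.

Lemma rk_zeromod i j : rk zeromod i j = 0%N.
Proof. by apply/eqP/rk_eq0P => x; apply/rowP; case. Qed.

Lemma rk_big I (r : seq I) (P : pred I) (F : I -> rmod A) i j :
  rk (\big[@dsum k A/zeromod]_(x <- r | P x) F x) i j =
  (\sum_(x <- r | P x) rk (F x) i j)%N.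
Proof.
apply: (big_morph (fun M => rk M i j)) => [M N|]; first exact: rk_dsum.
exact: rk_zeromod.
Qed.

Lemma rk_str p i j : (i <= j)%N ->
  rk (str p) i j = ((psrc p <= i) && (j <= ptgt p))%N.
Proof.
move=> ij; case: (boolP (_ && _)) => [/andP[ai jb]|h]; last first.
  by apply/eqP/rk_eq0P => x; apply: coP => l; rewrite co_ract // (negPf h) andbF co0.
pose z l : str p := mk_string (itv p) (fun i => (i == l)%:R).
have zE : ract (z i) (pe i j) = z j.
  apply: coP => s; rewrite co_ract // ai jb andbT !co_mk eqxx.
  rewrite ai (leq_trans ij jb); case: eqP => [->|]; last by case: ifP.
  by rewrite (leq_trans ai ij) jb.
have -> : rk (str p) i j = \dim <[z j]>; last first.
  rewrite dim_vline; case: eqP => // /(congr1 (fun x : str p => co x j)).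
  by rewrite co_mk (leq_trans ai ij) jb eqxx co0 => /eqP; rewrite oner_eq0.
congr (\dim _); apply/eqP; rewrite eqEsubv; apply/andP; split; last first.
  by rewrite -memvE -zE -ract_lfunE memv_img ?memvf.
apply/subvP => _ /memv_imgP[x _ ->]; rewrite ract_lfunE; apply/vlineP.
exists (co x i); apply: coP => l; rewrite co_ract // ai jb andbT.
have [c cE] := lfun_build (@co_linear k n (itv p) l).
rewrite -cE linearZ /= cE co_mk; case: eqP => [->|_]; last first.
  by case: ifP; rewrite scaler0.
by rewrite (leq_trans ai ij) jb [RHS]mulr1.
Qed.

Definition leading M p := [/\ rk M (psrc p) (ptgt p) != 0%N,
  forall j, (ptgt p < j)%N -> rk M (psrc p) j = 0%N &
  forall i, (i < psrc p)%N -> rk M i (ptgt p) = 0%N].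

(** With p = [a,b], pick y0 whose transport from a to b is nonzero and a functional c equal to 1 on
    it. The generator goes to y0 e_a, which dies after b; the retraction reads the coordinate at j
    by transporting to b and applying c. *)
Lemma leading_summand M p : leading M p -> summand (str p) M.
Proof.
case; set a := psrc p; set b := ptgt p => nz zb za.
have ab : (a <= b)%N := valP p.
have [y0 ny] : exists y0 : M, ract y0 (pe a b) != 0.
  have : limg (ract_lfun M (pe a b)) != 0%VS by rewrite -dimv_eq0.
  rewrite -subv0 => /subvPn[_ /memv_imgP[y _ ->]].
  by rewrite memv0 ract_lfunE; exists y.
pose y := ract y0 (pe a a).
have yE j : (a <= j)%N -> ract y (pe a j) = ract y0 (pe a j).
  by move=> aj; rewrite -ractM peM.
have [c cy] := exists_functional ny.
have [f hf fg] : exists2 f : 'Hom(str p, M), f \in homspace (str p) M & f (gen p) = y.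
  apply: str_hom; first by rewrite yE.
  move=> j bj; rewrite yE; last exact: leq_trans (ltnW bj).
  by have /eqP/rk_eq0P -> := zb j bj.
pose G (m : M) : str p := mk_string (itv p) (fun j => c (ract m (pe j b))).
have [g gE] : exists g : 'Hom(M, str p), g =1 G.
  apply: lfun_build => d u v; apply: coP => l.
  rewrite (@co_linear k n (itv p) l) !co_mk.
  by case: ifP => _; rewrite ?scaler0 ?addr0 // ractD ractZ linearP.
have hg : g \in homspace M (str p).
  apply: homspace_path => m s t st; rewrite !gE; apply: coP => l.
  rewrite co_ract // !co_mk -/a -/b -ractM.
  case: (eqVneq l t) => [->|nl] /=; last first.
    by rewrite peM0 1?eq_sym // ractr0 linear0; case: ifP.
  case: (leqP t b) => [tb|bt]; last by rewrite !andbF.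
  rewrite !andbT peM // (leq_trans st tb) andbT.
  case: (leqP a t) => at_; case: (leqP a s) => as_ //.
    (* Here s < a <= t <= b: the path enters the interval from outside, and no vector starting
       before a survives to b. *)
    by have /eqP/rk_eq0P -> := za s as_; rewrite linear0.
  by have := leq_trans as_ st; rewrite leqNgt at_.
apply: (retract_dsum hf hg) => x; rewrite gE; apply: coP => l.
rewrite co_mk -/a -/b; case: ifP => [/andP[al lb]|h]; last by rewrite co_str_out ?h.
have ltl : (l < n)%N := leq_ltn_trans lb (ltn_ord _).
rewrite (hom_str hf) fg ract_suml (bigD1 (Ordinal ltl)) //= big1 ?addr0 => [|j nj].
  by rewrite ractZ -!ractM !peM ?leqnn // linearZ /= cy [LHS]mulr1.
by rewrite ractZ -ractM peM0 ?ractr0 ?scaler0.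
Qed.

(** Minimality of a is taken over nonzero ranks with any target, and only then is b chosen maximal
    for this a. *)
Lemma leading_exists M i j : rk M i j != 0%N -> exists p, leading M p.
Proof.
pose P i := [exists j : 'I_n, rk M i j != 0%N].
have inP s t : rk M s t != 0%N -> P s.
  move=> nz; have ltn_t : (t < n)%N.
    by rewrite ltnNge; apply: contra nz => /rk_out ->.
  by apply/existsP; exists (Ordinal ltn_t).
move=> nz; have exP : exists s, P s by exists i; apply: inP nz.
case: (ex_minnP exP) => a /existsP[t nzt] amin.
have exQ : exists j, rk M a j != 0%N by exists t.
have bQ s : rk M a s != 0%N -> (s <= n)%N.
  by rewrite leqNgt; apply: contra => ns; rewrite rk_out // ltnW.
case: (ex_maxnP exQ bQ) => b nzb bmax.
have ab : (a <= b)%N by rewrite leqNgt; apply: contra nzb => /rk_gt ->.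
have bn : (b < n)%N by rewrite ltnNge; apply: contra nzb => /rk_out ->.
have an := leq_ltn_trans ab bn.
exists (exist _ (Ordinal an, Ordinal bn) ab); split=> //= s.
  by move=> bs; apply/eqP; apply: contraTT bs; rewrite -leqNgt; apply: bmax.
by move=> sa; apply/eqP; apply: contraTT sa; rewrite -leqNgt => /inP; apply: amin.
Qed.

Lemma rk_zero M : (forall i j, rk M i j = 0%N) -> iso M zeromod.
Proof.
move=> z; apply/iso_zero => x; rewrite (ract_sum1 x) big1 // => i _.
by have /eqP/rk_eq0P -> := z i i.
Qed.

Definition total_rk M := (\sum_(i < n) rk M i i)%N.

Lemma total_rk_dsum_str M p N :
  iso M (dsum (str p) N) -> (total_rk N < total_rk M)%N.
Proof.
move=> MN; rewrite /total_rk; under [X in (_ < X)%N]eq_bigr => i _.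
  rewrite (rk_iso _ _ MN) rk_dsum addnC; over.
rewrite big_split /= -addn1 leq_add2l (bigD1 (psrc p)) //= rk_str //.
by rewrite leqnn (valP p).
Qed.

(** Induction on the dimension, which is [total_rk]. The hypothesis [leading M p] is passed on
    because being leading depends on ranks alone, so the same interval also splits off any module
    with equal ranks. *)
Lemma module_ind (Q : rmod A -> Prop) :
  (forall M, iso M zeromod -> Q M) ->
  (forall M p N, leading M p -> iso M (dsum (str p) N) -> Q N -> Q M) ->
  forall M, Q M.
Proof.
move=> Q0 Q1 M; have [m] := ubnP (total_rk M); elim: m M => // m IH M ltM.
case: (boolP [exists i : 'I_n, [exists j : 'I_n, rk M i j != 0%N]]).
  case/existsP=> i /existsP[j /leading_exists[p lp]].
  have [N MN] := leading_summand lp; apply: (Q1 _ _ _ lp MN); apply: IH.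
  by rewrite -ltnS (leq_trans _ ltM) // ltnS; apply: total_rk_dsum_str MN.
move=> h; apply: Q0; apply: rk_zero => i j; apply/eqP; apply: contraR h => nz.
have jn : (j < n)%N by rewrite ltnNge; apply: contra nz => /rk_out ->.
have ij : (i <= j)%N by rewrite leqNgt; apply: contra nz => /rk_gt ->.
apply/existsP; exists (Ordinal (leq_ltn_trans ij jn)).
by apply/existsP; exists (Ordinal jn).
Qed.

(** A leading interval of M is leading in N too; it splits off both, and by additivity the
    complements again have equal ranks. *)
Theorem iso_rk M N : (forall i j, rk M i j = rk N i j) -> iso M N.
Proof.
elim/module_ind: M N => [M M0 N MN|M p M' lp MM' IH N MN].
  apply: (iso_trans M0); apply/iso_sym/rk_zero => i j.
  by rewrite -MN (rk_iso _ _ M0) rk_zeromod.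
have [N' NN'] : summand (str p) N.
  apply: leading_summand; case: lp => h1 h2 h3.
  by split=> [|j bj|i ia]; rewrite -MN //; [apply: h2|apply: h3].
apply: (iso_trans MM'); apply: iso_trans (iso_sym NN').
apply: iso_dsum; first exact: iso_refl.
apply: IH => i j; have := MN i j.
by rewrite (rk_iso _ _ MM') (rk_iso _ _ NN') !rk_dsum => /addnI.
Qed.

End RankFunction.

(** * Multiplicities *)

Section Multiplicities.
Variables (k : fieldType) (n : nat).
Local Notation A := (path_alg k n).
Local Notation str := (str k).
Local Notation bigsum s := (\big[@dsum k A/zeromod]_(p <- s) str p).
Implicit Types (p q : qpath n) (M N X Y : rmod (path_alg k n)) (i j l : nat).
Implicit Types s t : seq (qpath n).

(* Inclusion-exclusion on the rank function; the term in [i - 1] is absent *)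
(* when [i = 0].                                                           *)
Definition mu M p : int :=
  let r i := (rk M i (ptgt p))%:Z - (rk M i (ptgt p).+1)%:Z in
  r (psrc p) - (if (0 < psrc p)%N then r (psrc p).-1 else 0).

(** The integer [mu M p] is never negative, by [muE]; the absolute value only changes its type. *)
Definition mult M p : nat := `|mu M p|%N.

Lemma mu_iso M N p : iso M N -> mu M p = mu N p.
Proof. by move=> MN; rewrite /mu !(rk_iso _ _ MN). Qed.

Lemma mu_dsum M N p : mu (dsum M N) p = mu M p + mu N p.
Proof. by rewrite /mu !rk_dsum; case: ifP; lia. Qed.

Lemma mu_zeromod p : mu zeromod p = 0.
Proof. by rewrite /mu !rk_zeromod; case: ifP. Qed.

Lemma eq_qpath p q : (psrc p == psrc q :> nat) && (ptgt p == ptgt q :> nat) = (p == q).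
Proof.
rewrite -[p == q]val_eqE /psrc /ptgt.
by case: (val p) (val q) => [a b] [c d]; rewrite xpair_eqE -!val_eqE.
Qed.

Lemma mu_str q p : mu (str q) p = (q == p).
Proof.
have pab := valP p; have qab := valP q.
rewrite -eq_qpath /mu; rewrite -/(psrc p) -/(ptgt p) -/(psrc q) -/(ptgt q) in pab qab *.
by case: ifP => a0; rewrite !rk_str; lia.
Qed.

Lemma mu_bigsum s p : mu (bigsum s) p = count_mem p s.
Proof.
elim: s => [|q s IH]; first by rewrite big_nil mu_zeromod.
by rewrite big_cons mu_dsum IH mu_str /=; lia.
Qed.

Lemma decomposition M : exists s, iso M (bigsum s).
Proof.
elim/module_ind: M => [M M0|M p N _ MN [s IH]].
  by exists [::]; rewrite big_nil.
exists (p :: s); rewrite big_cons; apply: (iso_trans MN).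
by apply: iso_dsum => //; apply: iso_refl.
Qed.

Lemma muE M p : mu M p = mult M p.
Proof.
have [s Ms] := decomposition M.
by rewrite /mult (mu_iso _ Ms) mu_bigsum.
Qed.

Lemma mult_iso M N p : iso M N -> mult M p = mult N p.
Proof. by move=> MN; rewrite /mult (mu_iso _ MN). Qed.

Lemma mult_dsum M N p : mult (dsum M N) p = (mult M p + mult N p)%N.
Proof. by have := mu_dsum M N p; rewrite !muE; lia. Qed.

Lemma mult_zeromod p : mult zeromod p = 0%N.
Proof. by rewrite /mult mu_zeromod. Qed.

Lemma mult_str q p : mult (str q) p = (q == p).
Proof. by rewrite /mult mu_str. Qed.

Lemma mult_bigsum s p : mult (bigsum s) p = count_mem p s.
Proof. by rewrite /mult mu_bigsum. Qed.

Lemma mult_big I (r : seq I) (P : pred I) (F : I -> rmod A) p :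
  mult (\big[@dsum k A/zeromod]_(x <- r | P x) F x) p =
  (\sum_(x <- r | P x) mult (F x) p)%N.
Proof.
apply: (big_morph (fun M => mult M p)) => [M N|]; first exact: mult_dsum.
exact: mult_zeromod.
Qed.

Lemma rk_mult M i j : (i <= j)%N ->
  rk M i j = (\sum_p mult M p * ((psrc p <= i) && (j <= ptgt p)))%N.
Proof.
move=> ij; have [s Ms] := decomposition M; rewrite (rk_iso _ _ Ms).
under [RHS]eq_bigr => p _ do rewrite (mult_iso _ Ms) mult_bigsum.
elim: s {Ms} => [|q s IH].
  by rewrite big_nil rk_zeromod big1.
rewrite big_cons rk_dsum IH rk_str //=.
under [RHS]eq_bigr => p _ do rewrite mulnDl.
rewrite big_split /=; congr (_ + _)%N.
rewrite (bigD1 q) //= eqxx mul1n big1 ?addn0 // => p.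
by rewrite eq_sym => /negPf ->.
Qed.

Lemma iso_mult M N : (forall p, mult M p = mult N p) -> iso M N.
Proof.
move=> e; apply: iso_rk => i j; have [ij|ji] := leqP i j; last by rewrite !rk_gt.
by rewrite !rk_mult //; apply: eq_bigr => p _; rewrite e.
Qed.

Lemma mult_eq0 M : (forall p, mult M p = 0%N) -> iso M zeromod.
Proof. by move=> z; apply: iso_mult => p; rewrite z mult_zeromod. Qed.

Lemma iso_str_inj p q : iso (str p) (str q) -> p = q.
Proof.
move/(mult_iso q); by rewrite !mult_str eqxx; case: eqP.
Qed.

Lemma summand_mult M N p : summand N M -> (mult N p <= mult M p)%N.
Proof. by case=> Y /(mult_iso p) ->; rewrite mult_dsum leq_addr. Qed.

Lemma summand_str M p : summand (str p) M <-> (0 < mult M p)%N.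
Proof.
split=> [/(summand_mult p)|]; first by rewrite mult_str eqxx.
have [s Ms] := decomposition M; rewrite (mult_iso _ Ms) mult_bigsum => cp.
have ps : p \in s by rewrite -has_pred1 has_count.
exists (bigsum (rem p s)); apply: iso_mult => q.
rewrite mult_dsum (mult_iso _ Ms) !mult_bigsum mult_str count_rem /= ps.
by move: cp; case: eqP => [<-|_] /=; rewrite ?subn0 // add1n subn1 => /prednK.
Qed.

Lemma str_not_zero p : ~ iso (str p) zeromod.
Proof. by move/(mult_iso p); rewrite mult_str eqxx mult_zeromod. Qed.

Lemma indecomposable_str p : indecomposable (str p).
Proof.
split=> [|X Y pXY]; first exact: str_not_zero.
have e q : (mult X q + mult Y q)%N = (p == q).
  by rewrite -mult_dsum -(mult_iso _ pXY) mult_str.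
case: (posnP (mult X p)) => [x0|x1]; [left|right]; apply: mult_eq0 => q;
  have := e q; have := e p; rewrite eqxx; case: eqP => [<-|_]; lia.
Qed.

Lemma indecomposable_is_str M : indecomposable M -> exists p, iso M (str p).
Proof.
case=> nz ind; have [[|p s] Ms] := decomposition M.
  by case: nz; move: Ms; rewrite big_nil.
rewrite big_cons in Ms; exists p; apply: iso_mult => q.
rewrite (mult_iso _ Ms) mult_dsum.
by have [/str_not_zero//|/(mult_iso q) ->] := ind _ _ Ms; rewrite mult_zeromod addn0.
Qed.

Lemma basicP M : basic M <-> forall p, (mult M p <= 1)%N.
Proof.
split=> [[m [X [ind inj MX]]] p|le1].
  rewrite (mult_iso _ MX) mult_big.
  have [Y YE] := fin_all_exists (fun i : 'I_m => indecomposable_is_str (ind i)).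
  under eq_bigr => i _ do rewrite (mult_iso _ (YE i)) mult_str.
  have -> : (\sum_(i < m) (Y i == p) = #|[pred i : 'I_m | Y i == p]|)%N.
    by rewrite -sum1_card [RHS]big_mkcond; apply: eq_bigr => i _; rewrite inE; case: eqP.
  rewrite leqNgt; apply/negP => /card_gt1P[i [j [/eqP hi /eqP hj /negP[]]]].
  apply/eqP/inj.
  by apply: (iso_trans (YE i)); apply: iso_sym; rewrite hi -hj; apply: YE.
have [s Ms] := decomposition M.
have us : uniq s.
  apply: count_mem_uniq => p; have := le1 p; rewrite (mult_iso _ Ms) mult_bigsum.
  by rewrite -has_pred1 has_count; case: (count _ _) => [|[]].
exists (size s), (fun i : 'I_(size s) => str (tnth (in_tuple s) i)); split.
- by move=> i; apply: indecomposable_str.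
- by move=> i j /iso_str_inj; apply/(tuple_uniqP (in_tuple s)).
by rewrite big_tnth in Ms.
Qed.

End Multiplicities.

(** * Quotients by idempotents *)

Section Inflation.
Variables (k : fieldType) (A : fdAlgType k) (e : A).
Local Notation B := (quot_alg e).
Implicit Types (N : rmod B) (M : rmod A).

Definition killed M := forall (x : M) a, a \in ideal_gen e -> ract x a = 0.

Lemma killed_inflation N : killed (inflation N).
Proof. by move=> x a; rewrite -alg_pi_eq0 => /eqP ae; rewrite [LHS]/= /infl_act ae ractr0. Qed.

Lemma killed_iso M M' : iso M M' -> killed M -> killed M'.
Proof.
move=> /iso_sym/isoP[f [/homspaceP hf bf]] kM x a ae.
by apply: (bij_inj bf); rewrite hf kM // linear0.
Qed.

Section Deflation.
Variables (M : rmod A) (kM : killed M).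

Definition defl_act (x : M) (b : B) : M := ract x (vsval b).

Lemma defl_act_pi x a : defl_act x (alg_pi e a) = ract x a.
Proof.
apply/eqP; rewrite -subr_eq0 /defl_act -!ractr_lfunE -linearB /= ractr_lfunE.
by rewrite kM // quot_pi_diff.
Qed.

Fact defl_linearl b : linear (defl_act^~ b).
Proof. exact: ract_linearl. Qed.
Fact defl_linearr x : linear (defl_act x).
Proof. by move=> c a b; rewrite /defl_act linearP ract_linearr. Qed.
Fact defl_act1 x : defl_act x fdone = x.
Proof. by rewrite -alg_pi1 defl_act_pi ract1. Qed.
Fact defl_actM x b c : defl_act x (b ** c) = defl_act (defl_act x b) c.
Proof.
rewrite -(quot_piK b) -(quot_piK c) -!/(alg_pi e _) -alg_piM.
by rewrite !defl_act_pi ractM.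
Qed.

Definition deflation : rmod B :=
  @RMod k B M defl_act defl_linearl defl_linearr defl_act1 defl_actM.

Lemma inflation_deflation : iso (inflation deflation) M.
Proof.
apply: (@iso_build _ _ (inflation deflation) M id id) => // x a.
exact: defl_act_pi.
Qed.
End Deflation.

(** Inflation keeps the underlying vector space, so the same linear map has both types by
    conversion. *)
Lemma homspace_inflation N N' (f : 'Hom(N, N')) :
  (f \in homspace N N') =
  ((f : 'Hom(inflation N, inflation N')) \in homspace (inflation N) (inflation N')).
Proof.
apply/homspaceP/homspaceP => h x a; first exact: h.
by rewrite -(quot_piK a); apply: h.
Qed.

Lemma iso_inflation N N' : iso N N' <-> iso (inflation N) (inflation N').
Proof.
split=> /isoP[f [hf bf]]; apply/isoP; exists f; split=> //.
  by rewrite -homspace_inflation.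
by rewrite homspace_inflation.
Qed.

Lemma inflation_dsum N N' :
  iso (inflation (dsum N N')) (dsum (inflation N) (inflation N')).
Proof. exact: iso_refl. Qed.

Lemma inflation_zero N : iso N zeromod <-> iso (inflation N) zeromod.
Proof. by rewrite !iso_zero. Qed.

Lemma summand_inflation N N' : summand N N' <-> summand (inflation N) (inflation N').
Proof.
split=> [[Y /iso_inflation h]|[Y h]]; first by exists (inflation Y).
have kY : killed Y.
  have kD := killed_iso h (@killed_inflation _) => y a ae.
  by have := kD (0, y) a ae => -[].
exists (deflation kY); apply/iso_inflation; apply: (iso_trans h).
apply: iso_trans (iso_sym (inflation_dsum _ _)); apply: iso_dsum; first exact: iso_refl.
exact/iso_sym/inflation_deflation.
Qed.

Lemma indecomposable_inflation N :
  indecomposable N <-> indecomposable (inflation N).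
Proof.
split=> -[nz ind]; (split; first by move/inflation_zero/nz) => X Y h.
  have kD := killed_iso h (@killed_inflation _).
  have kX : killed X by move=> x a ae; have := kD (x, 0) a ae => -[].
  have kY : killed Y by move=> y a ae; have := kD (0, y) a ae => -[].
  have [|z|z] := ind (deflation kX) (deflation kY).
  - apply/iso_inflation; apply: (iso_trans h).
    apply: iso_trans (iso_sym (inflation_dsum _ _)).
    by apply: iso_dsum; apply/iso_sym/inflation_deflation.
  - by left; apply: iso_trans (iso_sym (inflation_deflation kX)) _; apply/inflation_zero.
  - by right; apply: iso_trans (iso_sym (inflation_deflation kY)) _; apply/inflation_zero.
rewrite !inflation_zero; apply: ind; apply: iso_trans (inflation_dsum _ _).
exact/iso_inflation.
Qed.

End Inflation.

Section AvoidingIntervals.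
Variables (n : nat) (J : {set 'I_n}).
Implicit Types p q : qpath n.

Definition avoids p := [disjoint itv p & J].

Lemma avoidsP p :
  reflect (forall i : 'I_n, (psrc p <= i <= ptgt p)%N -> i \notin J) (avoids p).
Proof.
rewrite /avoids disjoint_subset; apply: (iffP subsetP) => h i.
  by move=> hi; have := h i; rewrite !inE; apply.
by rewrite inE => /h.
Qed.

(** The intervals that cannot be prolonged to the right without meeting J. They are the
    indecomposable projectives of the quotient algebra, one for each vertex outside J. *)
Definition proj_itv p :=
  avoids p && [forall q, (psrc q == psrc p) && avoids q ==> (ptgt q <= ptgt p)%N].

Lemma proj_itv_avoids p : proj_itv p -> avoids p.
Proof. by case/andP. Qed.

Lemma proj_itv_max p q :
  proj_itv p -> avoids q -> psrc q = psrc p -> (ptgt q <= ptgt p)%N.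
Proof. by case/andP=> _ /forallP/(_ q)/implyP h aq e; apply: h; rewrite e eqxx. Qed.

Lemma proj_itv_inj p q : proj_itv p -> proj_itv q -> psrc p = psrc q -> p = q.
Proof.
move=> pp pq e; apply/eqP; rewrite -eq_qpath e eqxx eqn_leq.
by rewrite !proj_itv_max // proj_itv_avoids.
Qed.

Lemma proj_itv_exists (i : 'I_n) : i \notin J -> exists2 p, proj_itv p & psrc p = i.
Proof.
move=> iJ; pose p0 : qpath n := exist _ (i, i) (leqnn i).
pose Q p := (psrc p == i) && avoids p.
have Q0 : Q p0.
  by rewrite /Q eqxx; apply/avoidsP => j; rewrite /psrc /ptgt /= -eqn_leq => /eqP/val_inj <-.
case: (@arg_maxnP _ p0 Q (fun p => ptgt p) Q0) => p /andP[/eqP pi ap] pmax.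
exists p => //; rewrite /proj_itv ap; apply/forallP => q; apply/implyP.
by rewrite pi => /pmax.
Qed.

Lemma card_proj_itv : #|[set p | proj_itv p]| = #|~: J|.
Proof.
have <- : [set psrc p | p in [set p | proj_itv p]] = ~: J.
  apply/setP => i; rewrite inE; apply/imsetP/idP => [[p]|].
    rewrite inE => /proj_itv_avoids/avoidsP ap ->; apply: ap.
    by rewrite leqnn (valP p).
  by case/proj_itv_exists => p pp <-; exists p; rewrite ?inE.
by rewrite card_in_imset // => p q; rewrite !inE; apply: proj_itv_inj.
Qed.

End AvoidingIntervals.

(** * Idempotents of the path algebra and the ideals they generate *)

Section QuotientOfPathAlgebra.
Variables (k : fieldType) (n : nat) (e : path_alg k n).
Hypothesis ee : e ** e = e.
Local Notation A := (path_alg k n).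
Local Notation B := (quot_alg e).
Local Notation pe := (@pe k n).
Local Notation str := (str k).
Implicit Types (p q : qpath n) (M : rmod (path_alg k n)) (N : rmod (quot_alg e)).

Definition diag_support : {set 'I_n} := [set i | pcoef e i i != 0].
Local Notation J := diag_support.
Local Notation avoids := (avoids J).

(** Expand e_st in e = e e by induction on t - s: the term with l = s contains the diagonal entry
    e_ss, and every other term contains e_lt over a shorter range. *)
Lemma idem_coef0 (s t : 'I_n) :
  (forall i : 'I_n, (s <= i <= t)%N -> pcoef e i i = 0) -> pcoef e s t = 0.
Proof.
have [m] := ubnP (t - s)%N; elim: m s t => // m IH s t ltm h.
have [st|ts] := leqP s t; last by rewrite pcoef0 // -ltnNge.
rewrite -[in LHS]ee pcoefM mxE big1 // => l _.
have [sl|ls] := leqP s l; last by rewrite [pcoef e s l]pcoef0 ?mul0r // -ltnNge.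
have [lt_|tl] := leqP l t; last by rewrite [pcoef e l t]pcoef0 ?mulr0 // -ltnNge.
have [->|nls] := eqVneq l s; first by rewrite h ?mul0r // leqnn.
rewrite [pcoef e l t]IH ?mulr0 // => [|i /andP[li it]].
  by move: nls; rewrite -val_eqE /=; lia.
by apply: h; rewrite it (leq_trans sl).
Qed.

Lemma diag_coef (i : 'I_n) : i \in J -> pcoef e i i = 1.
Proof.
rewrite inE => nz; apply: (mulIf nz); rewrite mul1r.
rewrite -[in RHS]ee pcoefM [RHS]mxE (bigD1 i) //= big1 ?addr0 // => l nl.
have [il|li] := leqP i l; last by rewrite [pcoef e i l]pcoef0 ?mul0r // -ltnNge.
rewrite [pcoef e l i]pcoef0 ?mulr0 //.
by move: nl; rewrite -val_eqE /=; lia.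
Qed.

(** Since e_ii = 1, compressing e at the vertex i gives [pe i i] itself; a path through i factors
    through [pe i i]. *)
Lemma pe_ideal (s t : nat) (i : 'I_n) :
  i \in J -> (s <= i <= t)%N -> pe s t \in ideal_gen e.
Proof.
move=> iJ /andP[si it]; suff -> : pe s t = pe s i ** e ** pe i t by exact: mem_ideal_gen.
have E : pe i i ** e ** pe i i = pe i i.
  apply: pcoef_inj; rewrite !pcoefM; apply/matrixP => u v; rewrite mxE.
  rewrite (bigD1 i) //= [X in _ + X]big1 ?addr0 => [|l nl]; last first.
    by rewrite pcoef_pe; move: nl; rewrite -val_eqE /= => /negPf ->; rewrite mulr0.
  rewrite mxE (bigD1 i) //= [X in _ + X]big1 ?addr0 => [|l nl]; last first.
    by rewrite pcoef_pe; move: nl; rewrite -val_eqE /= => /negPf ->; rewrite andbF mul0r.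
  by rewrite diag_coef // mulr1 !pcoef_pe leqnn eqxx !andbT -natrM mulnb.
transitivity (pe s i ** (pe i i ** e ** pe i i) ** pe i t).
  by rewrite E peM // peM.
by rewrite !fdmulA peM // -!fdmulA peM.
Qed.

(** The coefficient of b e c at p is a sum of terms b_sm e_ml c_lt with m and l inside p. The
    diagonal of e vanishes between m and l, hence so does e_ml. *)
Lemma ideal_coef0 a p : a \in ideal_gen e -> avoids p -> a p = 0.
Proof.
move=> ae /avoidsP ap.
have [f fE] : exists f : 'Hom(A, k^o), f =1 fun a : A => a p.
  by apply: lfun_build => c x y; rewrite !ffunE.
suff /subvP/(_ _ ae) : (ideal_gen e <= lker f)%VS by rewrite memv_ker fE => /eqP.
apply: ideal_gen_ind => b c; rewrite memv_ker fE -pcoefE !pcoefM mxE big1 // => l _.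
have [lt_|tl] := leqP l (ptgt p); last by rewrite [pcoef c _ _]pcoef0 ?mulr0 // -ltnNge.
rewrite mxE big1 ?mul0r // => m _.
have [sm|ms] := leqP (psrc p) m; last by rewrite [pcoef b _ _]pcoef0 ?mul0r // -ltnNge.
rewrite idem_coef0 ?mulr0 // => i /andP[mi il]; apply/eqP.
by have := ap i; rewrite inE negbK (leq_trans sm) ?(leq_trans il) //; apply.
Qed.

Lemma killedP M : killed e M <-> forall p, (0 < mult M p)%N -> avoids p.
Proof.
split=> [kM p mp|h x a ae].
  apply/avoidsP => i ip; apply/negP => iJ.
  have : rk M i i == 0%N.
    by apply/rk_eq0P => x; rewrite kM // (pe_ideal iJ) // leqnn.
  by rewrite rk_mult // (bigD1 p) //= ip muln1 addn_eq0 => /andP[/eqP z _]; rewrite z in mp.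
have zJ (y : M) (i : 'I_n) : i \in J -> ract y (pe i i) = 0.
  move=> iJ; move: y; apply/rk_eq0P; rewrite rk_mult // sum_nat_eq0.
  apply/forallP => p; rewrite muln_eq0 -leqn0 leqNgt.
  case: (boolP (0 < _)%N) => //= /h/avoidsP/(_ i) ip; rewrite eqb0.
  by apply/negP => /ip; rewrite iJ.
rewrite (path_alg_sum a) ractr_sum big1 // => p _; rewrite ractrZ.
have [/(ideal_coef0 ae) ->|] := boolP (avoids p); first by rewrite scale0r.
rewrite /avoids -setI_eq0 => /set0Pn[i]; rewrite !inE => /andP[/andP[si it] iJ].
rewrite -(peM _ _ si it) -(peM _ _ (leqnn i) it) !ractM zJ ?ract0 ?scaler0 //.
by rewrite inE.
Qed.

Lemma killed_str p : avoids p -> killed e (str p).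
Proof. by move=> ap; apply/killedP => q; rewrite mult_str; case: eqP => // <-. Qed.

Lemma num_summandsP N r :
  num_summands N r <-> r = #|[set p | (0 < mult (inflation N) p)%N]|.
Proof.
set S := [set p | _].
have avS p : p \in S -> avoids p.
  by rewrite inE => /(iffLR (killedP _) (@killed_inflation _ _ _ N)).
split=> [[X [XN inj surj]]|rE].
  have [Y YE] := fin_all_exists
    (fun i : 'I_r => indecomposable_is_str (iffLR (indecomposable_inflation _) (XN i).1)).
  have injY : injective Y.
    move=> i j Yij; apply: inj; apply/iso_inflation; apply: (iso_trans (YE i)).
    by rewrite Yij; apply: iso_sym.
  suff -> : S = [set Y i | i : 'I_r] by rewrite card_imset // card_ord.
  apply/setP => p; apply/idP/imsetP => [pS|[i _ ->]]; last first.
    rewrite inE; apply: leq_trans (summand_mult _ (iffLR (summand_inflation _ _) (XN i).2)).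
    by rewrite (mult_iso _ (YE i)) mult_str eqxx.
  have dp := inflation_deflation (killed_str (avS p pS)).
  have [||i pi] := surj (deflation (killed_str (avS p pS))).
  - apply/indecomposable_inflation.
    have [nz ind] := indecomposable_str k p; split.
      by move=> z; apply: nz; apply: iso_trans (iso_sym dp) z.
    by move=> X' Y' h; apply: ind; apply: iso_trans (iso_sym dp) h.
  - apply/summand_inflation; have [Z NZ] : summand (str p) (inflation N).
      by apply/summand_str; have := pS; rewrite inE.
    exists Z; apply: (iso_trans NZ).
    apply: iso_dsum; first exact: iso_sym.
    exact: iso_refl.
  exists i => //; apply: iso_str_inj; apply: iso_trans (iso_sym dp) _.
  by apply: iso_trans (YE i); apply/iso_inflation.
pose Z (i : 'I_r) : qpath n := enum_val (cast_ord rE i).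
have ZS i : Z i \in S by apply: enum_valP.
exists (fun i => deflation (killed_str (avS _ (ZS i)))).
have dp i := inflation_deflation (killed_str (avS _ (ZS i))).
split=> [i|i j /iso_inflation ij|Y indY sY].
- split.
    apply/indecomposable_inflation.
    have [nz ind] := indecomposable_str k (Z i); split.
      by move=> z; apply: nz; apply: iso_trans (iso_sym (dp i)) z.
    by move=> X' Y' h; apply: ind; apply: iso_trans (iso_sym (dp i)) h.
  apply/summand_inflation; have [X NX] : summand (str (Z i)) (inflation N).
    by apply/summand_str; have := ZS i; rewrite inE.
  exists X; apply: (iso_trans NX); apply: iso_dsum; first exact: iso_sym.
  exact: iso_refl.
- have : iso (str (Z i)) (str (Z j)).
    apply: iso_trans (iso_sym (dp i)) _; apply: iso_trans (dp j); exact: ij.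
  by move/iso_str_inj/enum_val_inj/cast_ord_inj.
have [p Yp] := indecomposable_is_str (iffLR (indecomposable_inflation _) indY).
have pS : p \in S.
  rewrite inE; apply: leq_trans (summand_mult _ (iffLR (summand_inflation _ _) sY)).
  by rewrite (mult_iso _ Yp) mult_str eqxx.
exists (cast_ord (esym rE) (enum_rank_in pS p)); apply/iso_inflation.
apply: (iso_trans Yp); apply: iso_sym; apply: iso_trans (dp _) _.
rewrite /Z cast_ordKV enum_rankK_in //; exact: iso_refl.
Qed.

End QuotientOfPathAlgebra.

(** * The regular module of a quotient *)

Section RegularModule.
Variables (k : fieldType) (n : nat) (e : path_alg k n).
Hypothesis ee : e ** e = e.
Local Notation A := (path_alg k n).
Local Notation B := (quot_alg e).
Local Notation pe := (@pe k n).
Local Notation str := (str k).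
Local Notation J := (diag_support e).
Implicit Types (p q : qpath n).

Lemma ideal_pe (s t : nat) : (forall q, psrc q = s :> nat -> ptgt q = t :> nat -> ~~ avoids J q) ->
  pe s t \in ideal_gen e.
Proof.
move=> h; have [/existsP[q /andP[/eqP sq /eqP tq]]|no] :=
    boolP [exists q : qpath n, (psrc q == s :> nat) && (ptgt q == t :> nat)].
  have := h q sq tq; rewrite /avoids -setI_eq0 => /set0Pn[i].
  by rewrite !inE sq tq => /andP[it iJ]; apply: (pe_ideal ee _ it); rewrite inE.
suff -> : pe s t = 0 by apply: mem0v.
apply/ffunP => q; rewrite !ffunE; case: (boolP (_ && _)) => // hq.
by case/negP: no; apply/existsP; exists q.
Qed.

Definition avoiding_to (i j : nat) : {set qpath n} :=
  [set q | [&& psrc q <= i, ptgt q == j :> nat & avoids J q]%N].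

(** The image of B e_i -> B e_j is spanned by the classes of the paths to j that start at or before
    i. Those meeting J are zero, and the others are independent because elements of the ideal have
    no coefficient at them. *)
Lemma rk_regmod (i j : nat) : (i <= j)%N -> (j < n)%N ->
  rk (inflation (regmod B)) i j = #|avoiding_to i j|.
Proof.
move=> ij jn; rewrite /rk; set T := avoiding_to i j; set R := ract_lfun _ _.
pose x q : B := alg_pi e (pe (psrc q) j).
pose X := [tuple of map x (enum T)].
have RE b : R b = b ** alg_pi e (pe i j) by rewrite ract_lfunE.
have lpi : linear (alg_pi e) := alg_pi_linear e.
have [P PE] := lfun_build lpi.
have spanX : limg R = <<X>>%VS.
  apply/eqP; rewrite eqEsubv; apply/andP; split.
    apply/subvP => _ /memv_imgP[b _ ->]; rewrite RE -(quot_piK b) -/(alg_pi e _) -alg_piM.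
    rewrite (path_alg_sum (vsval b)) -rmul_lfunE linear_sum -PE linear_sum rpred_sum //= => q _.
    rewrite !linearZ /= rmul_lfunE PE; apply: rpredZ.
    have [qi|nqi] := eqVneq (ptgt q : nat) i; last first.
      by rewrite peM0 // -PE linear0 mem0v.
    have qleq : (psrc q <= i)%N by rewrite -qi (valP q).
    rewrite qi peM //; have [Qe|no] := boolP (pe (psrc q) j \in ideal_gen e).
      by move: Qe; rewrite -alg_pi_eq0 => /eqP ->; apply: mem0v.
    apply: memv_span.
    pose q' : qpath n := exist (fun p : 'I_n * 'I_n => p.1 <= p.2)%N
      (psrc q, Ordinal jn) (leq_trans qleq ij).
    apply/mapP; exists q'; last by rewrite /x.
    rewrite mem_enum inE qleq eqxx /=; apply: contraR no => h.
    apply: ideal_pe => p sp tp; suff -> : p = q' by [].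
    by apply/eqP; rewrite -eq_qpath sp tp !eqxx.
  apply/span_subvP => _ /mapP[q qT ->].
  rewrite mem_enum inE in qT; case/and3P: qT => qi _ _.
  apply/memv_imgP; exists (alg_pi e (pe (psrc q) i)); rewrite ?memvf //.
  by rewrite RE -alg_piM peM.
suff /eqP fX : free X by rewrite spanX fX size_map -cardE.
apply/freeP => c c0.
have : \sum_(l < #|T|) c l *: pe (psrc (enum_val l)) j \in ideal_gen e.
  rewrite -alg_pi_eq0 -PE linear_sum; apply/eqP; rewrite -[RHS]c0.
  apply: eq_bigr => l _; rewrite linearZ /= PE; congr (_ *: _).
  by rewrite (nth_map (enum_default l)) // -cardE.
move=> /(ideal_coef0 ee) cI l.
have qT (l' : 'I_#|T|) : ptgt (enum_val l') = j :> nat.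
  by have := enum_valP l'; rewrite inE => /and3P[_ /eqP].
have aq : avoids J (enum_val l) by have := enum_valP l; rewrite inE => /and3P[].
have := cI _ aq; rewrite sum_ffunE (bigD1 l) //= big1 ?addr0 => [|l' nl].
  by rewrite !ffunE qT !eqxx => h; rewrite -[LHS]mulr1; apply: h.
rewrite !ffunE; case: eqP => [qq|_]; last by rewrite /= [LHS]mulr0.
have /enum_val_inj ll : enum_val l = enum_val l'.
  by apply/eqP; rewrite -eq_qpath qq !qT !eqxx.
by rewrite ll eqxx in nl.
Qed.

Lemma mult_regmod p : mult (inflation (regmod B)) p = proj_itv J p.
Proof.
pose D := \big[@dsum k A/zeromod]_(q | proj_itv J q) str q.
suff /mult_iso -> : iso (inflation (regmod B)) D.
  rewrite mult_big; under eq_bigr => q _ do rewrite mult_str.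
  rewrite -big_mkcondr sum1dep_card; case: (boolP (proj_itv J p)) => pp.
    suff -> : [set q | proj_itv J q && (q == p)] = [set p] by rewrite cards1.
    by apply/setP => q; rewrite !inE andbC; case: eqP => // ->.
  apply: eq_card0 => q; rewrite inE; apply/negP => /andP[pq /eqP qp].
  by rewrite qp (negPf pp) in pq.
apply: iso_rk => i j; have [ij|ji] := leqP i j; last by rewrite !rk_gt.
have [jn|nj] := ltnP j n; last by rewrite !rk_out.
rewrite rk_regmod // rk_big; under eq_bigr => q _ do rewrite rk_str //.
rewrite -big_mkcondr sum1dep_card; set S := [set q | _].
(* Both sets are matched through their sources: a path from s to j avoiding J lies inside the unique
   projective interval starting at s, which therefore ends at or after j. *)
rewrite -(card_in_imset (f := @psrc n) (D := avoiding_to i j)); last first.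
  move=> p1 p2; rewrite !inE => /and3P[_ /eqP t1 _] /and3P[_ /eqP t2 _] ss.
  by apply/eqP; rewrite -eq_qpath ss t1 t2 !eqxx.
rewrite -(card_in_imset (f := @psrc n) (D := S)); last first.
  move=> p1 p2; rewrite !inE => /andP[h1 _] /andP[h2 _]; exact: proj_itv_inj h1 h2.
apply: eq_card => s; apply/imsetP/imsetP => -[q].
  rewrite inE => /and3P[qi /eqP qj aq] ->.
  have sJ : psrc q \notin J by apply: (avoidsP _ _ aq); rewrite leqnn (valP q).
  have [q' pq' sq'] := proj_itv_exists sJ; exists q' => //.
  by rewrite inE pq' sq' qi -qj (proj_itv_max pq').
rewrite inE => /and3P[pq qi jq] ->.
pose q' : qpath n := exist (fun p : 'I_n * 'I_n => p.1 <= p.2)%N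
  (psrc q, Ordinal jn) (leq_trans qi ij).
exists q' => //; rewrite inE qi eqxx /=; apply/avoidsP => l /andP[ql lj].
apply: (avoidsP _ _ (proj_itv_avoids pq)).
by rewrite ql (leq_trans lj).
Qed.

Lemma num_summands_regmod r : num_summands (regmod B) r <-> r = #|~: J|.
Proof.
rewrite (num_summandsP ee) -card_proj_itv.
suff -> : [set p | (0 < mult (inflation (regmod B)) p)%N] = [set p | proj_itv J p] by [].
by apply/setP => p; rewrite !inE mult_regmod lt0b.
Qed.

End RegularModule.

(** * Rigidity *)

Section DeflatedHoms.
Variables (k : fieldType) (A : fdAlgType k) (e : A).
Local Notation B := (quot_alg e).
Implicit Types (N P : rmod B) (M X Y : rmod A).

Lemma homspace_to_deflation N M (kM : killed e M) (f : 'Hom(N, deflation kM)) :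
  (f \in homspace N (deflation kM)) =
  ((f : 'Hom(inflation N, M)) \in homspace (inflation N) M).
Proof.
apply/homspaceP/homspaceP => h x a; first by rewrite [LHS]h [LHS](defl_act_pi kM).
by rewrite -(quot_piK a) -/(alg_pi e _) [RHS](defl_act_pi kM); apply: h.
Qed.

Lemma projective_lift_inflation P X Y (g : 'Hom(X, Y)) (f : 'Hom(inflation P, Y)) :
  projective P -> killed e X -> killed e Y ->
  g \in homspace X Y -> f \in homspace (inflation P) Y -> limg g = fullv ->
  exists2 h : 'Hom(inflation P, X), h \in homspace (inflation P) X &
    forall x, g (h x) = f x.
Proof.
move=> prP kX kY hg hf gs.
have hg' : (g : 'Hom(deflation kX, deflation kY)) \in homspace (deflation kX) (deflation kY).
  rewrite homspace_to_deflation; apply/homspaceP => x a.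
  by rewrite -(homspaceP _ hg) [ract _ _](defl_act_pi kX).
have hf' : (f : 'Hom(P, deflation kY)) \in homspace P (deflation kY).
  by rewrite homspace_to_deflation.
have [h hh hE] := projective_lift prP hg' hf' gs.
by exists h => //; rewrite -homspace_to_deflation.
Qed.

Lemma hom_factor_inj X Y (i : 'Hom(X, Y)) (M : rmod A) (u : 'Hom(M, Y)) :
  i \in homspace X Y -> lker i = 0%VS -> u \in homspace M Y ->
  (forall x, u x \in limg i) ->
  exists2 v : 'Hom(M, X), v \in homspace M X & forall x, i (v x) = u x.
Proof.
move=> hi /eqP ki hu ui; have vE x : i (i^-1%VF (u x)) = u x by rewrite limg_lfunVK.
exists (i^-1 \o u)%VF => [|x]; last by rewrite comp_lfunE.
apply/homspaceP => x a; rewrite !comp_lfunE; apply: (lker0P ki).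
by rewrite vE (homspaceP _ hi) vE (homspaceP _ hu).
Qed.

Lemma summand_retract X M : summand X M ->
  exists f g, [/\ f \in homspace X M, g \in homspace M X & cancel (f : 'Hom(X, M)) (g : 'Hom(M, X))].
Proof.
move=> [Y [f0 [g0 [fg gf]]]].
have [i hi iE] := dsum_inl X Y; have [p hp pE] := dsum_fst X Y.
exists (vsval g0 \o i)%VF, (p \o vsval f0)%VF; split.
- exact: homspace_comp (subvsP g0) hi.
- exact: homspace_comp hp (subvsP f0).
by move=> x; rewrite !comp_lfunE gf pE iE.
Qed.

End DeflatedHoms.

Section Rigidity.
Variables (k : fieldType) (n : nat).
Local Notation A := (path_alg k n).
Local Notation pe := (@pe k n).
Local Notation str := (str k).
Implicit Types (p q r : qpath n) (M : rmod (path_alg k n)).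

Definition itv_of (a b : nat) (bn : (b < n)%N) (ab : (a <= b)%N) : qpath n :=
  exist (fun p : 'I_n * 'I_n => p.1 <= p.2)%N
    (Ordinal (leq_ltn_trans ab bn), Ordinal bn) ab.

(** The interval from [psrc p] to [ptgt q] is a quotient of [str p] and a submodule of [str q]; when
    it is empty the map is zero. *)
Lemma trunc_hom p q : (psrc q <= psrc p)%N -> (ptgt q <= ptgt p)%N ->
  exists2 f : 'Hom(str p, str q), f \in homspace (str p) (str q) &
    forall x l, co (f x) l = if (psrc q <= l <= ptgt q)%N then co x l else 0.
Proof.
move=> qp1 qp2; pose F (x : str p) : str q := mk_string (itv q) (co x).
have [f fE] : exists f : 'Hom(str p, str q), f =1 F.
  apply: lfun_build => c x y; apply: coP => l; rewrite (@co_linear k n (itv q) l) !co_mk.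
  by case: ifP => _; [exact: co_linear|rewrite scaler0 addr0].
exists f => [|x l]; last by rewrite fE co_mk.
apply: homspace_path => x s t st; rewrite !fE; apply: coP => l.
rewrite co_mk !co_ract // co_mk; case: (eqVneq l t) => [->|_] /=; last by case: ifP.
case: (leqP (psrc p) s) => [ps|sp]; last first.
  by rewrite [co x s]co_str_out ?if_same //=; lia.
by do !case: ifP => //; lia.
Qed.

Lemma hom_str_ext p M (f g : 'Hom(str p, M)) :
  f \in homspace (str p) M -> g \in homspace (str p) M ->
  f (gen k p) = g (gen k p) -> f =1 g.
Proof. by move=> hf hg fg x; rewrite (hom_str hf) (hom_str hg) fg. Qed.

(* [conflict p q] means that Ext^1(str p, str q) is nonzero: with p = [a,b] *)
(* and q = [c,d], the nonsplit extension has middle term [a,d] + [c,b].     *)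
Definition conflict p q :=
  [&& psrc p < psrc q, psrc q <= (ptgt p).+1 & ptgt p < ptgt q]%N.

Variable e : path_alg k n.
Hypothesis ee : e ** e = e.
Local Notation B := (quot_alg e).
Local Notation J := (diag_support e).
Implicit Types N : rmod (quot_alg e).

(* Write p = [a,b], q = [c,d]. The map P0 -> N -> str p -> [a,c-1] lifts to    *)
(* h : P0 -> [a,d], and h f lands in the kernel str q, so it extends to P0;    *)
(* subtracting the extension gives a map vanishing on ker g. A preimage m of   *)
(* the generator of str p then yields a contradiction, as the path from a to d *)
(* kills g m but not the image of m in [a,d].                                  *)
Lemma rigid_no_conflict N p q : tau_rigid N ->
  (0 < mult (inflation N) p)%N -> (0 < mult (inflation N) q)%N -> ~~ conflict p q.
Proof.
move=> /tau_rigidP[P1 [P0 [f [g [[prP1 prP0 gs fg _] ext]]]]] mp mq.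
apply/negP => /and3P[ac cb bd].
have kN := @killed_inflation _ _ _ N.
have /avoidsP ap := iffLR (killedP ee _) kN p mp.
have /avoidsP aq := iffLR (killedP ee _) kN q mq.
have zn : ((psrc q).-1 < n)%N by apply: leq_ltn_trans (ltn_ord (psrc q)); apply: leq_pred.
have az : (psrc p <= (psrc q).-1)%N by lia.
pose z := itv_of zn az.
have ad : (psrc p <= ptgt q)%N by have := valP p; rewrite -/(psrc p) -/(ptgt p); lia.
pose r := itv_of (ltn_ord (ptgt q)) ad.
have kz : killed e (str z).
  by apply: killed_str => //; apply/avoidsP => i /= iz; apply: ap; lia.
(* As c <= b+1, every vertex of [a,d] lies in [a,b] or in [c,d], so the middle term exists over the
   quotient. *)
have kr : killed e (str r).
  apply: killed_str => //; apply/avoidsP => i /= ir.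
  by case: (leqP i (ptgt p)) => h; [apply: ap|apply: aq]; lia.
have [ip [pp [hip hpp ipK]]] := summand_retract (iffRL (summand_str _ p) mp).
have [iq [pq [hiq hpq iqK]]] := summand_retract (iffRL (summand_str _ q) mq).
have [qz hqz qzE] := @trunc_hom p z (leqnn _) ltac:(rewrite /=; lia).
have [rz hrz rzE] := @trunc_hom r z (leqnn _) ltac:(rewrite /=; lia).
have [qr hqr qrE] := @trunc_hom q r ltac:(rewrite /=; lia) (leqnn _).
have rzs : limg rz = fullv.
  apply/limg_full => y; exists (mk_string (itv r) (co y)); apply: coP => l.
  rewrite rzE co_mk; case: ifP => h; last by rewrite co_str_out ?h.
  by rewrite ifT //; move: h; rewrite /=; lia.
have qr0 : lker qr = 0%VS.
  apply/eqP; rewrite -subv0; apply/subvP => x; rewrite memv_ker memv0 => /eqP x0.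
  apply/eqP/coP => l; have := congr1 (fun y : str r => co y l) x0; rewrite qrE !co0.
  case: ifP => // h _; rewrite co_str_out //; move: h; rewrite /=; lia.
have rzqr x : rz (qr x) = 0.
  apply: coP => l; rewrite rzE qrE co0; case: ifP => // h1; case: ifP => // h2.
  by rewrite co_str_out //; move: h1 h2; rewrite /=; lia.
have inqr y : rz y = 0 -> y \in limg qr.
  move=> y0; apply/memv_imgP; exists (mk_string (itv q) (co y)); rewrite ?memvf //.
  apply: coP => l; rewrite qrE co_mk.
  have := congr1 (fun y : str z => co y l) y0; rewrite rzE co0.
  case: (boolP (psrc r <= l <= ptgt r)%N) => h; last by rewrite co_str_out ?h.
  by do 2!case: ifP => //; move: h; rewrite /=; lia.
have hg : (vsval g : 'Hom(inflation P0, inflation N)) \in homspace (inflation P0) (inflation N).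
  by rewrite -homspace_inflation subvsP.
have hf : (vsval f : 'Hom(inflation P1, inflation P0)) \in homspace (inflation P1) (inflation P0).
  by rewrite -homspace_inflation subvsP.
have [h hh hE] := projective_lift_inflation prP0 kr kz hrz
  (homspace_comp hqz (homspace_comp hpp hg)) rzs.
have gf x : vsval g (vsval f x) = 0.
  by apply/eqP; rewrite -memv_ker -fg memv_img ?memvf.
have [u hu uE] : exists2 u : 'Hom(inflation P1, str q),
    u \in homspace (inflation P1) (str q) & forall x, qr (u x) = h (vsval f x).
  have [x|u hu uE] := hom_factor_inj hqr qr0 (homspace_comp hh hf).
    apply: inqr; rewrite [(h \o _)%VF x]comp_lfunE hE !comp_lfunE gf.
    by rewrite !linear0.
  by exists u => // x; rewrite uE comp_lfunE.
have [v hv vE] : exists2 v : 'Hom(P0, N), v \in homspace P0 N &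
    forall x, iq (u x) = v (vsval f x).
  have [|v hv vE] := ext (iq \o u)%VF.
    by rewrite homspace_inflation; exact: (homspace_comp hiq hu).
  by exists v => // x; rewrite -vE comp_lfunE.
rewrite homspace_inflation in hv.
pose h' : 'Hom(inflation P0, str r) := h - (qr \o (pq \o v))%VF.
have hh' : h' \in homspace (inflation P0) (str r).
  by apply: rpredB => //; exact: (homspace_comp hqr (homspace_comp hpq hv)).
have h'E x : h' x = h x - qr (pq (v x)).
  by rewrite /h' add_lfunE opp_lfunE !comp_lfunE.
have ker_h' x : vsval g x = 0 -> h' x = 0.
  move/eqP; rewrite -memv_ker -fg => /memv_imgP[y _ ->].
  by rewrite h'E -vE iqK uE subrr.
move/limg_full: gs => /(_ (ip (gen k p)))[m gm].
(* The correction lies in the image of [qr], which [rz] kills, so at the vertex a only the generator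
   of [str p] is seen. *)
have co1 : co (h' m) (psrc p) = 1.
  have : rz (h' m) = qz (gen k p).
    by rewrite h'E linearB /= hE rzqr subr0 !comp_lfunE gm ipK.
  move/(congr1 (fun y : str z => co y (psrc p))); rewrite rzE qzE /= leqnn az.
  by rewrite co_gen eqxx.
have := ker_h' (@ract _ _ (inflation P0) m (pe (psrc p) (ptgt q))).
rewrite [vsval g _](homspaceP _ hg) gm -(homspaceP _ hip) gen_out // linear0.
move=> /(_ erefl)/(congr1 (fun y : str r => co y (ptgt q))).
rewrite (homspaceP _ hh') co_ract // eqxx leqnn /= leqnn co1 co0 => /eqP.
by rewrite oner_eq0.
Qed.

End Rigidity.

(** * Minimal presentations of interval modules over the quotient *)

Section RigidSums.
Variables (k : fieldType) (n : nat) (e : path_alg k n).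
Hypothesis ee : e ** e = e.
Local Notation A := (path_alg k n).
Local Notation B := (quot_alg e).
Local Notation J := (diag_support e).
Local Notation pe := (@pe k n).
Local Notation str := (str k).
Local Notation avq := {p : qpath n | avoids J p}.

Definition dstr (p : avq) : rmod B :=
  deflation (killed_str ee (valP p)).

Lemma homspace_dstr (p q : avq) (f : 'Hom(dstr p, dstr q)) :
  ((f : 'Hom(str (val p), str (val q))) \in homspace (str (val p)) (str (val q))) ->
  f \in homspace (dstr p) (dstr q).
Proof. by move=> /homspaceP hf; apply/homspaceP => x a; apply: hf. Qed.

Lemma homspace_of_dstr (p q : avq) (f : 'Hom(dstr p, dstr q)) :
  f \in homspace (dstr p) (dstr q) ->
  (f : 'Hom(str (val p), str (val q))) \in homspace (str (val p)) (str (val q)).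
Proof.
rewrite homspace_to_deflation => /homspaceP hf; apply/homspaceP => x a.
rewrite -hf; congr (f _); apply/esym; exact: (defl_act_pi (killed_str ee (valP p))).
Qed.

(** By maximality the paths running past the end of p vanish in the quotient algebra, so any
    preimage of the image of the generator, cut down to its source vertex, satisfies the relations
    of [str_hom]. *)
Lemma projective_dstr (p : avq) : proj_itv J (val p) -> projective (dstr p).
Proof.
move=> pp; apply: projectiveI => X Y g f hg hf gs.
set a := psrc (val p); pose y : inflation Y := f (gen k (val p)).
have hf' : (f : 'Hom(str (val p), inflation Y)) \in homspace (str (val p)) (inflation Y).
  apply/homspaceP => x c; rewrite -(defl_act_pi (killed_str ee (valP p)) x c).
  exact: (homspaceP _ hf x (alg_pi e c)).
have hg' : (g : 'Hom(inflation X, inflation Y)) \in homspace (inflation X) (inflation Y).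
  by rewrite -homspace_inflation.
have /limg_full/(_ y)[x0 gx0] := gs.
pose x : inflation X := @ract _ _ (inflation X) x0 (pe a a).
have gx : g x = f (gen k (val p)).
  by rewrite /x (homspaceP _ hg') gx0 /y -(homspaceP _ hf') gen_src.
have [h hh hx] : exists2 h : 'Hom(str (val p), inflation X),
    h \in homspace (str (val p)) (inflation X) & h (gen k (val p)) = x.
  apply: str_hom => [|j bj]; first by rewrite -ractM peM.
  apply: (@killed_inflation _ _ _ X); apply: ideal_pe => // q sq tq.
  apply/negP => aq; have := proj_itv_max pp aq (val_inj sq).
  by rewrite leqNgt tq bj.
exists h; first by apply/homspaceP => z c; rewrite [LHS](homspaceP _ hh) /= /infl_act /alg_pi quot_piK.
move=> z; have := hom_str_ext (homspace_comp hg' hh) hf'.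
by rewrite !comp_lfunE hx => /(_ gx z); rewrite comp_lfunE.
Qed.

(** Elements of the kernel have coordinate 0 at the source of p. So in a decomposition x + w of the
    generator the part w has coordinate 1 there, and W, which contains w, contains every path
    applied to the generator. *)
Lemma superfluous_trunc (p q : avq) (g : 'Hom(dstr p, dstr q)) :
  (psrc (val q) <= psrc (val p) <= ptgt (val q))%N ->
  (forall x l, co (g x : str (val q)) l =
    if (psrc (val q) <= l <= ptgt (val q))%N then co (x : str (val p)) l else 0) ->
  superfluous (lker g).
Proof.
move=> qp gE W sW KW; set a := psrc (val p).
have : (gen k (val p) : dstr p) \in (lker g + W)%VS by rewrite KW memvf.
case/memv_addP => x; rewrite memv_ker => /eqP gx [w wW gxw].
have cx : co (x : str (val p)) a = 0.
  by have := gE x a; rewrite gx co0 qp => <-.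
have cw : co (w : str (val p)) a = 1.
  have <- : co (gen k (val p)) a = 1 by rewrite co_gen eqxx.
  have /esym := @co_linear k n (itv (val p)) a 1 x w.
  by rewrite !scale1r cx add0r gxw.
apply/eqP; rewrite eqEsubv subvf; apply/subvP => y _.
rewrite (str_gen (y : str (val p))) rpred_sum // => j _; apply: rpredZ.
have [aj|ja] := leqP a j; last first.
  suff -> : Defs.ract (gen k (val p)) (pe a j) = 0 by apply: mem0v.
  suff -> : pe a j = 0 by rewrite ractr0.
  apply/ffunP => q'; rewrite !ffunE; case: (boolP (_ && _)) => // /andP[/eqP s /eqP t].
  by have := valP q'; rewrite -/(psrc q') -/(ptgt q') s t leqNgt ja.
suff -> : Defs.ract (gen k (val p)) (pe a j) = ract w (alg_pi e (pe a j)) by apply: sW.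
rewrite [RHS](defl_act_pi (killed_str ee (valP p))); apply: coP => l.
by rewrite !co_ract // cw co_gen eqxx.
Qed.

(** For p = [a,b], the cover P0 is [a,t] with t maximal, and its kernel [b+1,t] is projective or
    zero. A map from the kernel to q is a scalar at b+1; when it is nonzero, the absence of conflict
    lets q start at or before a, and the scaled truncation from P0 to q extends it. *)
Lemma presentation_dstr (p : avq) (s : seq avq) :
  (forall q, q \in s -> ~~ conflict (val p) (val q)) ->
  has_extending_presentation (dstr p) (\big[@dsum k B/zeromod]_(q <- s) dstr q).
Proof.
case: p => p ap /= nc; have aJ : psrc p \notin J.
  by apply: (avoidsP _ _ ap); rewrite leqnn (valP p).
have abp : (psrc p <= ptgt p)%N := valP p.
have [p0 pp0 sp0] := proj_itv_exists aJ.
pose p' : avq := Sub p0 (proj_itv_avoids pp0).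
have tp0 : (ptgt p <= ptgt p0)%N by apply: proj_itv_max ap (esym sp0).
have [g hg gE] := @trunc_hom k n p0 p (eq_leq (congr1 _ (esym sp0))) tp0.
have hg' : (g : 'Hom(dstr p', dstr (exist _ p ap))) \in homspace (dstr p') (dstr (exist _ p ap)).
  exact: homspace_dstr.
have sg : superfluous (lker (g : 'Hom(dstr p', dstr (exist _ p ap)))).
  have h : (psrc p <= psrc (val p') <= ptgt p)%N.
    by rewrite /= sp0 leqnn; apply: (valP p).
  exact: (@superfluous_trunc p' (exist _ p ap) g h gE).
have gs : limg (g : 'Hom(dstr p', dstr (exist _ p ap))) = fullv.
  apply/limg_full => y; exists (mk_string (itv p0) (co (y : str p))).
  apply: coP => l; rewrite gE co_mk; case: ifP => h; last by rewrite co_str_out ?h.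
  by rewrite ifT // sp0; move: h; lia.
have prp0 : projective (dstr p') by apply: projective_dstr.
case: (ltnP (ptgt p) (ptgt p0)) => lt; last first.
  (* Here p ends where its cover does, so p is projective and P1 is zero. *)
  have z : projective (zeromod : rmod B) by apply: projective_zero => x; apply/rowP; case.
  have g0 : lker (g : 'Hom(dstr p', dstr (exist _ p ap))) = 0%VS.
    apply/eqP; rewrite -subv0; apply/subvP => x; rewrite memv_ker memv0 => /eqP x0.
    apply/eqP; apply: coP => l; have := gE x l; rewrite x0 !co0.
    by case: ifP => // h _; rewrite co_str_out //=; move: h; rewrite sp0; lia.
  exists zeromod, (dstr p'), 0, (@hom_of _ _ (dstr p') (dstr (exist _ p ap)) g); split; last first.
    by move=> u _; exists 0; [exact: mem0v|move=> x; rewrite [x](rV0_eq _ 0) !linear0].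
  split; rewrite ?hom_ofE //.
    by rewrite g0; apply/eqP; rewrite -subv0; apply/subvP => _ /memv_imgP[x _ ->];
      rewrite zero_lfunE mem0v.
  split=> //; suff -> : lker (vsval (0 : rhom (zeromod : rmod B) (dstr p'))) = 0%VS.
    exact: superfluous0.
  by apply/eqP; rewrite -subv0; apply/subvP => x _; rewrite memv0 [x](rV0_eq _ 0).
pose r0 : qpath n := @itv_of n (ptgt p).+1 (ptgt p0) (ltn_ord _) lt.
(* An interval from b+1 that avoids J can be prolonged to the left by p; the result starts at a, so
   it cannot end after t. *)
have pr0 : proj_itv J r0.
  have ar : avoids J r0.
    apply/avoidsP => i /andP[/= h1 h2]; apply: (avoidsP _ _ (proj_itv_avoids pp0)).
    by rewrite h2 andbT sp0; move: h1; rewrite /=; lia.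
  rewrite /proj_itv ar; apply/forallP => q; apply/implyP => /andP[/eqP sq aq].
  have pq : (psrc p <= ptgt q)%N.
    by have : (psrc q <= ptgt q)%N := valP q; rewrite sq /=; lia.
  pose q' := itv_of (ltn_ord (ptgt q)) pq.
  have aq' : avoids J q'.
    apply/avoidsP => i /andP[/= h1 h2].
    case: (leqP i (ptgt p)) => h; first by apply: (avoidsP _ _ ap); rewrite h1.
    by apply: (avoidsP _ _ aq); rewrite h2 sq /= h.
  by have := proj_itv_max pp0 aq'; apply; apply/val_inj; rewrite sp0.
pose r' : avq := Sub r0 (proj_itv_avoids pr0).
have [f hf fE] := @trunc_hom k n r0 p0 ltac:(rewrite /= sp0; lia) (leqnn _).
have hf' : (f : 'Hom(dstr r', dstr p')) \in homspace (dstr r') (dstr p').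
  exact: homspace_dstr.
have f0 : lker (f : 'Hom(dstr r', dstr p')) = 0%VS.
  apply/eqP; rewrite -subv0; apply/subvP => x; rewrite memv_ker memv0 => /eqP x0.
  apply/eqP; apply: coP => l; have := fE x l; rewrite x0 !co0.
  by case: ifP => // h _; rewrite co_str_out //; move: h; rewrite sp0 /=; lia.
exists (dstr r'), (dstr p'), (@hom_of _ _ (dstr r') (dstr p') f), (@hom_of _ _ (dstr p') (dstr (exist _ p ap)) g); split.
  split; rewrite ?hom_ofE //; first exact: projective_dstr.
    apply/vspaceP => x; rewrite memv_ker; apply/memv_imgP/eqP => [[y _ ->]|x0].
      apply: coP => l; rewrite gE fE co0; case: ifP => // h1; case: ifP => // h2.
      by rewrite co_str_out //; move: h1; rewrite /=; lia.
    exists (mk_string (itv r0) (co (x : str p0))); rewrite ?memvf //.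
    apply: coP => l; rewrite fE co_mk.
    case: (boolP (psrc p0 <= l <= ptgt p0)%N) => h; last by rewrite co_str_out ?h.
    case: ifP => // h'; have := gE x l; rewrite x0 co0 ifT //.
    by move: h h'; rewrite sp0 /=; lia.
  by split=> //; rewrite f0; apply: superfluous0.
elim: s nc => [|q s IH] nc; first by rewrite big_nil; apply: extends_along_zero.
rewrite big_cons; apply: extends_along_dsum; last first.
  by apply: IH => q' q's; apply: nc; rewrite inE q's orbT.
have {}nc := nc q (mem_head _ _).
rewrite /extends_along !hom_ofE // => u hu0.
have hu := homspace_of_dstr hu0.
(* The image of the generator of [b+1,t] is concentrated at the vertex b+1, so u is given by one
   scalar, which is zero when b+1 lies outside q. *)
pose lam : k := co (u (gen k r0) : str (val q)) (ptgt p).+1.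
have uE l : co (u (gen k r0) : str (val q)) l =
    if l == (ptgt p).+1 then lam else 0.
  rewrite -gen_src [u _](homspaceP _ hu) co_ract // /lam.
  case: (eqVneq l) => [_|_] //=; case: (boolP (_ && _)) => // h.
  by rewrite co_str_out.
case: (boolP (psrc (val q) <= (ptgt p).+1 <= ptgt (val q))%N) => hq; last first.
  exists 0; first exact: mem0v.
  move=> x; rewrite zero_lfunE.
  have := hom_str_ext hu (mem0v _); rewrite zero_lfunE; move=> /(_ _ x).
  rewrite zero_lfunE; apply; apply: coP => l; rewrite uE co0; case: eqP => // _.
  by rewrite /lam co_str_out.
case/andP: hq => qs qt.
(* Since q contains b+1, starting after a would put it in conflict with p. *)
have qp : (psrc (val q) <= psrc p)%N.
  by rewrite leqNgt; apply: contra nc => h; rewrite /conflict h qs qt.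
have tq : (ptgt (val q) <= ptgt p0)%N.
  have pq : (psrc p <= ptgt (val q))%N := leq_trans abp (ltnW qt).
  pose q' := itv_of (ltn_ord (ptgt (val q))) pq.
  have aq' : avoids J q'.
    apply/avoidsP => i /andP[/= h1 h2].
    by apply: (avoidsP _ _ (valP q)); rewrite h2 (leq_trans qp).
  by have := proj_itv_max pp0 aq'; apply; apply/val_inj; rewrite sp0.
have [t ht tE] := @trunc_hom k n p0 (val q) ltac:(rewrite sp0 //) tq.
have htl : lam *: t \in homspace (str p0) (str (val q)) by rewrite memvZ.
exists (lam *: t : 'Hom(dstr p', dstr q)); first exact: (@homspace_dstr p' q).
move=> x; have := hom_str_ext hu (homspace_comp htl hf).
rewrite comp_lfunE => /(_ _ x); rewrite comp_lfunE; apply.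
apply: coP => l; rewrite uE scale_lfunE coZ tE fE co_gen /=.
rewrite [l == _]eq_sym; case: eqP => [<-|_]; last by rewrite !if_same mulr0.
by move: qs qt => /= -> ->; rewrite sp0 (leqW abp) lt mulr1.
Qed.

End RigidSums.

Section SupportTauTiltingSums.
Variables (k : fieldType) (n : nat) (e : path_alg k n).
Hypothesis ee : e ** e = e.
Local Notation A := (path_alg k n).
Local Notation B := (quot_alg e).
Local Notation J := (diag_support e).
Local Notation avq := {p : qpath n | avoids J p}.
Local Notation dstr := (dstr ee).
Local Notation bigdstr s := (\big[@dsum k B/zeromod]_(q <- s) dstr q).
Implicit Types (s : seq avq) (p : qpath n).

Lemma tau_rigid_bigdstr s :
  (forall x y, x \in s -> y \in s -> ~~ conflict (val x) (val y)) ->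
  tau_rigid (bigdstr s).
Proof.
move=> nc; apply/tau_rigidP.
(* The copies of s are separated: the induction runs over the presented module, while the target
   stays the full sum. *)
have : {subset s <= s} by [].
elim: {1 3}s => [|p t IH] ts.
  by rewrite big_nil; apply: extending_presentation_zero.
rewrite big_cons; apply: extending_presentation_dsum.
  by apply: presentation_dstr => q; apply: nc; apply: ts; apply: mem_head.
by apply: IH => q qt; apply: ts; rewrite inE qt orbT.
Qed.

Lemma mult_bigdstr s p :
  mult (inflation (bigdstr s)) p = count_mem p (map val s).
Proof.
elim: s => [|q s IH].
  rewrite big_nil /=; apply/eqP; rewrite -(mult_zeromod k p); apply/eqP/mult_iso.
  exact/inflation_zero/iso_refl.
rewrite big_cons (mult_iso _ (inflation_dsum _ _)) mult_dsum IH /=.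
by rewrite (mult_iso _ (inflation_deflation _)) mult_str.
Qed.

End SupportTauTiltingSums.

(** * Support tau-tilting modules in terms of intervals *)

Section SupportTauTilting.
Variables (k : fieldType) (n : nat).
Local Notation A := (path_alg k n).
Implicit Types (M : rmod (path_alg k n)) (p q : qpath n).

Lemma support_tau_tilting_spec M : support_tau_tilting M ->
  exists J : {set 'I_n},
    [/\ forall p, (0 < mult M p)%N -> avoids J p,
        forall p q, (0 < mult M p)%N -> (0 < mult M q)%N -> ~~ conflict p q
      & #|[set p | (0 < mult M p)%N]| = #|~: J|].
Proof.
move=> [e [ee [N [[rigN [r [/(num_summandsP ee) rN /(num_summands_regmod ee) rB]]] MN]]]].
have mE p : mult M p = mult (inflation N) p := mult_iso p MN.
exists (diag_support e); split=> [p|p q|].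
- by rewrite mE; apply: (iffLR (killedP ee _)); apply: killed_inflation.
- by rewrite !mE; apply: (rigid_no_conflict ee rigN).
by rewrite -rB rN; apply: eq_card => p; rewrite !inE mE.
Qed.

Lemma support_tau_tiltingI M (J : {set 'I_n}) :
  (forall p, (0 < mult M p)%N -> avoids J p) ->
  (forall p q, (0 < mult M p)%N -> (0 < mult M q)%N -> ~~ conflict p q) ->
  (forall p, (mult M p <= 1)%N) ->
  #|[set p | (0 < mult M p)%N]| = #|~: J| -> support_tau_tilting M.
Proof.
move=> aJ nc le1 cJ.
pose e : path_alg k n := \sum_(i in J) pe k n i i.
have eE (i j : 'I_n) : pcoef e i j = ((i == j) && (i \in J))%:R.
  rewrite /e linear_sum summxE /=.
  under eq_bigr => l _ do rewrite pcoef_pe leqnn andbT !val_eqE.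
  case: (boolP (i \in J)) => iJ; last first.
    rewrite andbF big1 // => l lJ; case: eqP => // il.
    by rewrite il lJ in iJ.
  rewrite (bigD1 i) //= eqxx big1 ?addr0 ?andbT 1?eq_sym // => l /andP[_ li].
  by rewrite eq_sym (negPf li).
have ee : e ** e = e.
  apply: pcoef_inj; rewrite pcoefM; apply/matrixP => i j; rewrite mxE.
  rewrite (bigD1 i) //= big1 ?addr0 => [|l li]; last first.
    by rewrite eE eq_sym (negPf li) mul0r.
  by rewrite !eE eqxx; case: (i \in J); rewrite ?andbF ?mul1r ?mul0r.
have JE : diag_support e = J.
  by apply/setP => i; rewrite inE eE eqxx /=; case: (i \in J); rewrite ?oner_eq0 ?eqxx.
exists e; split=> //.
(* As multiplicities are at most 1, M is the sum over this duplicate-free list. *)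
pose s := enum [pred p : {p : qpath n | avoids (diag_support e) p} | (0 < mult M (val p))%N].
have mE p : mult (inflation (\big[@dsum k (quot_alg e)/zeromod]_(q <- s) dstr ee q)) p = mult M p.
  rewrite mult_bigdstr count_uniq_mem; last first.
    by rewrite map_inj_uniq ?enum_uniq //; apply: val_inj.
  suff -> : (p \in map val s) = (0 < mult M p)%N.
    by move: (le1 p); case: (mult M p) => [|[]].
  apply/mapP/idP => [[q]|mp].
    by rewrite mem_enum inE => h ->.
  have ap : avoids (diag_support e) p by rewrite JE aJ.
  by exists (Sub p ap); rewrite ?mem_enum ?inE.
exists (\big[@dsum k (quot_alg e)/zeromod]_(q <- s) dstr ee q); split; last first.
  by apply: iso_mult => p; rewrite mE.
split.
  by apply: tau_rigid_bigdstr => x y; rewrite !mem_enum !inE => hp hq; apply: nc.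
exists #|~: J|; split.
  apply/(num_summandsP ee); rewrite -cJ; apply: eq_card => p.
  by rewrite !inE mE.
by apply/(num_summands_regmod ee); rewrite JE.
Qed.

End SupportTauTilting.

(** * Dissections of a polygon *)

Section PolygonDissections.
Variable N : nat.
Local Notation pt := 'I_N.
Implicit Types (u v w : pt * pt) (F : {set pt * pt}) (lo hi : pt).
Local Open Scope nat_scope.

Definition meets u v := (u.1 < v.1) && (v.1 < u.2) && (u.2 < v.2).

Definition within lo hi u := [&& lo <= u.1, u.1.+2 <= u.2 & u.2 <= hi].

Definition dissection lo hi F :=
  (forall u, u \in F -> within lo hi u) /\
  (forall u v, u \in F -> v \in F -> ~~ meets u v).

Definition maximal_in lo hi F := forall u, within lo hi u ->
  (forall v, v \in F -> ~~ meets u v /\ ~~ meets v u) -> u \in F.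

(* The diagonal [(lo, k)] with [k] maximal below [hi], or the boundary edge *)
(* [(lo, lo + 1)], is a side of the triangle on [(lo, hi)] and cuts the     *)
(* polygon into the polygons on [lo..k] and on [k..hi].                     *)
Lemma dissection_apex lo hi F : lo.+1 < hi -> dissection lo hi F ->
  exists k : pt, [/\ lo < k, k < hi &
    forall u, u \in F -> [\/ u = (lo, hi), within lo k u | within k hi u]].
Proof.
move=> lh [wF mF].
have l1 : lo.+1 < N by apply: leq_trans lh (ltnW (ltn_ord hi)).
pose P (k : pt) := [&& lo < k, k < hi & (k == lo.+1 :> nat) || ((lo, k) \in F)].
have P0 : P (Ordinal l1) by rewrite /P /= leqnn lh eqxx.
case: (@arg_maxnP _ (Ordinal l1) P (fun k => k) P0) => k /and3P[lk kh kF] kmax.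
exists k; split=> // u uF; have := wF u uF; rewrite {1}/within => /and3P[lu u2 uh].
have [ku|uk] := leqP k u.1; first by apply: Or33; rewrite /within ku u2.
have [uk2|ku2] := leqP u.2 k; first by apply: Or32; rewrite /within lu u2.
(* Now u passes over the apex k. Starting after [lo] it would cross (lo, k), or, if k = lo + 1,
   leave no room for its start. *)
have lu1 : lo = u.1.
  apply/val_inj/eqP; rewrite /= eqn_leq lu /= leqNgt; apply/negP => ltlu.
  case/orP: kF => [/eqP k1|kF]; first by lia.
  by have := mF _ _ kF uF; rewrite /meets /= ltlu uk ku2.
(* The diagonal is (lo, y) with y beyond k, and the maximal choice of k forces y = hi. *)
apply: Or31; case: u lu1 uF uh ku2 {lu u2 uk} => [x y] /= <- uF yh ky.
congr pair; apply/val_inj/eqP; rewrite eqn_leq yh /= leqNgt; apply/negP => yhi.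
by have /= := kmax y; rewrite /P yhi uF orbT (ltn_trans lk ky) => /(_ isT); lia.
Qed.

(** Apart from the base, F splits at the apex k into disjoint dissections of the two pieces, and
    (k-lo-1) + (hi-k-1) + 1 = hi-lo-1. Maximality passes to each piece because a diagonal inside it
    meets neither the base nor anything in the other piece; the base itself meets nothing, so a
    maximal F contains it. *)
Lemma card_dissection lo hi F : lo < hi -> dissection lo hi F ->
  #|F| <= (hi - lo).-1 /\ (maximal_in lo hi F -> #|F| = (hi - lo).-1).
Proof.
have [m] := ubnP (hi - lo); elim: m lo hi F => // m IH lo hi F hm lh dF.
have [wF mF] := dF.
have [lh1|hl1] := ltnP lo.+1 hi; last first.
  have F0 : F = set0.
    apply/setP => u; rewrite inE; apply/negP => /wF; rewrite /within; lia.
  have -> : (hi - lo).-1 = 0 by lia.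
  by rewrite F0 cards0.
have [k [lk kh split_k]] := dissection_apex lh1 dF.
pose F1 := [set u in F | within lo k u]; pose F2 := [set u in F | within k hi u].
have d1 : dissection lo k F1.
  by split=> [u|u v]; rewrite !inE => /andP[uF //] _ /andP[vF _]; apply: mF.
have d2 : dissection k hi F2.
  by split=> [u|u v]; rewrite !inE => /andP[uF //] _ /andP[vF _]; apply: mF.
have F12 : F :\ (lo, hi) = F1 :|: F2.
  apply/setP => u; rewrite !inE; apply/andP/orP => [[nu uF]|].
    by case: (split_k u uF) => [/eqP|->|->]; rewrite ?(negPf nu) ?uF; [|left|right].
  case=> /andP[uF wu]; split=> //; move: wu; apply: contraTneq => ->;
    by rewrite /within /=; lia.
have dis : F1 :&: F2 = set0.
  apply/setP => u; rewrite !inE; apply/negP => /andP[/andP[_ w1] /andP[_ w2]].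
  by move: w1 w2; rewrite /within; lia.
have cF : #|F| = ((lo, hi) \in F) + (#|F1| + #|F2|).
  by rewrite (cardsD1 (lo, hi)) F12 cardsU dis cards0 subn0.
have [le1 eq1] := IH lo k F1 ltac:(lia) lk d1.
have [le2 eq2] := IH k hi F2 ltac:(lia) kh d2.
split=> [|maxF]; first by rewrite cF; case: (_ \in F); lia.
have hF : (lo, hi) \in F.
  apply: maxF => [|v vF]; first by rewrite /within /= !leqnn lh1.
  by have := wF v vF; rewrite /within /meets /=; lia.
rewrite cF hF eq1 ?eq2; first by lia.
- move=> u wu cu; rewrite inE wu andbT; apply: maxF => [|v vF].
    by move: wu; rewrite /within; lia.
  case: (split_k v vF) => [->|wv|wv].
  + by move: wu; rewrite /within /meets /=; lia.
  + by move: wu wv; rewrite /within /meets /=; lia.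
  by apply: cu; rewrite inE vF.
move=> u wu cu; rewrite inE wu andbT; apply: maxF => [|v vF].
  by move: wu; rewrite /within; lia.
case: (split_k v vF) => [->|wv|wv].
+ by move: wu; rewrite /within /meets /=; lia.
+ by apply: cu; rewrite inE vF.
by move: wu wv; rewrite /within /meets /=; lia.
Qed.

End PolygonDissections.

(** * Curves of the surface as diagonals of a polygon *)

Section Chords.
Variable n : nat.
Local Notation point := 'I_n.+3.
Implicit Types (c d : curve n) (G : {set curve n}) (u v : point * point).

Fact chord0_subproof : #|[set (ord0 : point); ord_max]| == 2.
Proof. by rewrite cards2. Qed.
(** The default curve arises only when the two points coincide; requiring u.1 < u.2 selects one pair
    for each curve. *)
Definition chord u : curve n :=
  insubd (Sub [set ord0; ord_max] chord0_subproof : curve n) [set u.1; u.2].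

Lemma endpoints_chord u : (u.1 < u.2)%N -> endpoints (chord u) = [set u.1; u.2].
Proof.
move=> lt; rewrite /endpoints insubdK // unfold_in cards2 -val_eqE neq_ltn lt.
by [].
Qed.

Lemma set2_lt_inj (x y z w : point) : (x < y)%N -> (z < w)%N ->
  [set x; y] = [set z; w] -> x = z /\ y = w.
Proof.
move=> xy zw /setP e.
have := e x; have := e y; have := e z; have := e w; rewrite !inE !eqxx /= ?orbT.
by rewrite -!val_eqE /= => ? ? ? ?; split; apply/val_inj; rewrite /=; lia.
Qed.

Lemma chord_inj u v : (u.1 < u.2)%N -> (v.1 < v.2)%N -> chord u = chord v -> u = v.
Proof.
move=> hu hv /(congr1 (@endpoints n)); rewrite !endpoints_chord // => e.
have [e1 e2] := set2_lt_inj hu hv e.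
by rewrite [u]surjective_pairing [v]surjective_pairing e1 e2.
Qed.

Lemma chord_surj c : exists2 u : point * point, (u.1 < u.2)%N & c = chord u.
Proof.
have /cards2P[x [y [nxy cE]]] := valP c.
have [xy|yx|e] := ltngtP x y; last by rewrite -val_eqE /= e eqxx in nxy.
  by exists (x, y) => //; apply/val_inj; rewrite [RHS]endpoints_chord.
by exists (y, x) => //; apply/val_inj; rewrite [RHS]endpoints_chord //= setUC.
Qed.

Lemma alternateE u v : (u.1 < u.2)%N -> (v.1 < v.2)%N ->
  alternate [set u.1; u.2] [set v.1; v.2] = meets u v.
Proof.
case: u v => [x y] [z w] /= xy zw; apply/idP/idP => [|/andP[/andP[/= h1 h2] h3]].
  case/exists_inP => a; rewrite !inE => ha /exists_inP[b]; rewrite !inE => hb.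
  move=> /exists_inP[a']; rewrite !inE => ha' /exists_inP[b'].
  rewrite !inE => hb' /and3P[ab ba' ab']; rewrite /meets /=.
  by move: ha ha' hb hb'; rewrite -!val_eqE /=; lia.
apply/exists_inP; exists x; rewrite ?inE ?eqxx //.
apply/exists_inP; exists z; rewrite ?inE ?eqxx //.
apply/exists_inP; exists y; rewrite ?inE ?eqxx ?orbT //.
apply/exists_inP; exists w; rewrite ?inE ?eqxx ?orbT //.
by rewrite h1 h2.
Qed.

Lemma crosses_chord u v : (u.1 < u.2)%N -> (v.1 < v.2)%N ->
  crosses (endpoints (chord u)) (endpoints (chord v)) = meets u v || meets v u.
Proof. by move=> hu hv; rewrite !endpoints_chord // /crosses !alternateE. Qed.

(** The excluded pair is the boundary segment from x_(n+1) to p, where the numbering of the points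
    wraps around. *)
Definition diagonal u := ((u.1).+2 <= u.2)%N && (u != (ord0, ord_max)).

Lemma boundary_chord u : (u.1 < u.2)%N ->
  boundary_segment (endpoints (chord u)) = ~~ diagonal u.
Proof.
case: u => [x y] /= xy; rewrite endpoints_chord //= /diagonal xpair_eqE /=.
rewrite -!val_eqE /=; apply/existsP/idP => [[q /eqP]|].
  have [qm|qm] := eqVneq (q : nat) n.+2.
    have qs : ordS q = ord0 by apply/val_inj; rewrite /= qm modnn.
    rewrite qs [RHS]setUC => e; have [|-> ->] := set2_lt_inj xy _ e; rewrite /= qm //.
    by rewrite eqxx andbF.
  have qs : ordS q = q.+1 :> nat by rewrite /= modn_small // ltn_neqAle ltn_ord eqSS qm.
  move=> e; have [|-> ->] := set2_lt_inj xy _ e; rewrite qs //.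
  by rewrite ltnn.
rewrite negb_and negbK -ltnNge => /orP[yx|/andP[/eqP x0 /eqP ym]].
  exists x; rewrite (_ : y = ordS x) //; apply/val_inj.
  by rewrite /= modn_small; have := ltn_ord y; lia.
exists y; rewrite setUC (_ : x = ordS y) //; apply/val_inj.
by rewrite /= ym modnn.
Qed.

Lemma noncrossingP G : reflect
  ((forall u, (u.1 < u.2)%N -> chord u \in G -> diagonal u) /\
   (forall u v, (u.1 < u.2)%N -> (v.1 < v.2)%N -> chord u \in G -> chord v \in G ->
      ~~ meets u v))
  (noncrossing G).
Proof.
apply: (iffP andP) => [[/forall_inP h1 /forall_inP h2]|[h1 h2]].
  split=> [u hu uG|u v hu hv uG vG].
    by have := h1 _ uG; rewrite boundary_chord // negbK.
  have /forall_inP/(_ _ vG) := h2 _ uG; rewrite crosses_chord //.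
  by apply: contra => ->.
split; apply/forall_inP => c.
  have [u hu ->] := chord_surj c => uG; rewrite boundary_chord // negbK.
  exact: h1.
have [u hu ->] := chord_surj c => uG; apply/forall_inP => d.
have [v hv ->] := chord_surj d => vG; rewrite crosses_chord // negb_or.
by rewrite !h2.
Qed.

(** The boundary segment from p to x_(n+1) is added to serve as the base of the dissection; it
    accounts for the difference between n + 1 and n. *)
Definition dissection_of G : {set point * point} :=
  (ord0, ord_max) |: [set u : point * point | ((u.1 < u.2)%N) && (chord u \in G)].

Lemma card_dissection_of G : noncrossing G -> #|dissection_of G| = #|G|.+1.
Proof.
move=> /noncrossingP[h1 _]; rewrite cardsU1 inE /=.
case: (boolP (chord _ \in G)) => [/h1 /= /(_ isT)|_]; first by rewrite /diagonal eqxx andbF.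
congr S; rewrite -(card_in_imset (f := chord)); last first.
  by move=> u v; rewrite !inE => /andP[hu _] /andP[hv _]; apply: chord_inj.
apply: eq_card => c; apply/imsetP/idP => [[u] | cG].
  by rewrite inE => /andP[_ uG] ->.
have [u hu cE] := chord_surj c; exists u => //.
by rewrite inE hu -cE.
Qed.

Lemma dissectionP G : noncrossing G -> dissection ord0 ord_max (dissection_of G).
Proof.
move=> /noncrossingP[h1 h2]; split=> [u|u v].
  rewrite !inE => /orP[/eqP ->|/andP[hu uG]]; first by rewrite /within /= leqnn.
  by have /andP[u2 _] := h1 u hu uG; rewrite /within u2 /= leq_ord.
rewrite !inE => /orP[/eqP ->|/andP[hu uG]] /orP[/eqP ->|/andP[hv vG]].
- by rewrite /meets.
- by have := ltn_ord v.2; rewrite /meets /=; lia.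
- by rewrite /meets /=; lia.
exact: h2.
Qed.

Lemma noncrossing_card G : noncrossing G -> (#|G| <= n)%N.
Proof.
move=> nG; have [] := card_dissection (ltn0Sn _ : (ord0 : point) < ord_max)%N (dissectionP nG).
by rewrite card_dissection_of //= subn0.
Qed.

(** A diagonal meeting nothing in a triangulation can be added to it, so its dissection is maximal
    and attains the bound. Conversely, a noncrossing set of n curves leaves no room for a larger
    one. *)
Lemma triangulation_card G : triangulation G <-> noncrossing G /\ #|G| = n.
Proof.
split=> [/maxsetP[nG maxG]|[nG cG]].
  split=> //; have [_] := card_dissection (ltn0Sn _ : (ord0 : point) < ord_max)%N (dissectionP nG).
  rewrite card_dissection_of //= => h; apply: succn_inj; apply: h => u /and3P[_ u2 _] cu.
  rewrite !inE; case: eqVneq => //= nu; have hu : (u.1 < u.2)%N by apply: ltnW.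
  rewrite hu /=; have /noncrossingP[h1 h2] := nG.
  have inF v : (v.1 < v.2)%N -> chord v \in G -> v \in dissection_of G.
    by move=> hv vG; rewrite !inE hv vG orbT.
  rewrite -(maxG (chord u |: G)) ?setU11 ?subsetUr //.
  apply/noncrossingP; split=> [v hv|v w hv hw]; rewrite !inE.
    by case/orP=> [/eqP/(chord_inj hv hu) ->|/h1->//]; rewrite /diagonal u2.
  case/orP=> [/eqP/(chord_inj hv hu) ->|vG] /orP[/eqP/(chord_inj hw hu) ->|wG].
  - by rewrite /meets ltnn.
  - by case: (cu w (inF _ hw wG)).
  - by case: (cu v (inF _ hv vG)).
  exact: h2.
apply/maxsetP; split=> // G' nG' GG'; apply/esym/eqP.
by rewrite eqEcard GG' cG noncrossing_card.
Qed.

End Chords.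

(** * Triangulations and support tau-tilting modules *)

Section Correspondence.
Variable n : nat.
Local Notation point := 'I_n.+3.
Implicit Types (p q : qpath n) (i j : 'I_n) (c d : curve n) (G : {set curve n}).

(** In zero-based numbers, [a,b] consists of the vertices a+1, ..., b+1, so its curve is x_a
    x_(b+2); the point x_i has number i+1. *)
Definition itv_chord p : point * point := (inord (psrc p).+1, inord (ptgt p).+3).
Definition itv_curve p : curve n := chord (itv_chord p).
(** The index i stands for the vertex i+1, and x_(i+1) has number i+2. *)
Definition arc_chord i : point * point := (ord0, inord i.+2).
Definition arc_curve i : curve n := chord (arc_chord i).

Lemma itv_chord1 p : (itv_chord p).1 = (psrc p).+1 :> nat.
Proof. by rewrite inordK //; have := ltn_ord (psrc p); lia. Qed.
Lemma itv_chord2 p : (itv_chord p).2 = (ptgt p).+3 :> nat.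
Proof. by rewrite inordK //; have := ltn_ord (ptgt p); lia. Qed.
Lemma arc_chord2 i : (arc_chord i).2 = i.+2 :> nat.
Proof. by rewrite inordK //; have := ltn_ord i; lia. Qed.

Lemma itv_chord_lt p : ((itv_chord p).1 < (itv_chord p).2)%N.
Proof. by rewrite itv_chord1 itv_chord2; have : (psrc p <= ptgt p)%N := valP p; lia. Qed.
Lemma arc_chord_lt i : ((arc_chord i).1 < (arc_chord i).2)%N.
Proof. by rewrite arc_chord2. Qed.

Lemma itv_curve_inj : injective itv_curve.
Proof.
move=> p q /(chord_inj (itv_chord_lt p) (itv_chord_lt q)) e.
apply/eqP; rewrite -eq_qpath; have := itv_chord1 p; have := itv_chord2 p.
by rewrite e itv_chord1 itv_chord2; lia.
Qed.

Lemma arc_curve_inj : injective arc_curve.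
Proof.
move=> i j /(chord_inj (arc_chord_lt i) (arc_chord_lt j)) e; apply/val_inj.
by have := arc_chord2 i; rewrite e arc_chord2 /=; lia.
Qed.

Lemma itv_arc_neq p i : itv_curve p <> arc_curve i.
Proof.
move=> /(chord_inj (itv_chord_lt p) (arc_chord_lt i)) e.
by have := itv_chord1 p; rewrite e.
Qed.

Lemma diagonal_cases (u : point * point) : diagonal u ->
  (exists p, u = itv_chord p) \/ (exists i, u = arc_chord i).
Proof.
case: u => [x y]; rewrite /diagonal xpair_eqE -!val_eqE /= => /andP[xy nb].
have yn := ltn_ord y.
have [x0|x0] := posnP x; [right|left].
  (* From p, the point x_0 is excluded by the gap of two, and x_(n+1) by [nb]. *)
  have iN : (y.-2 < n)%N by move: nb; rewrite x0 /=; lia.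
  exists (Ordinal iN); rewrite [RHS]surjective_pairing; congr pair; apply/val_inj.
    by rewrite /= x0.
  by rewrite [RHS]arc_chord2 /=; lia.
have bn : (y - 3 < n)%N by lia.
have ab : (x.-1 <= y - 3)%N by lia.
exists (itv_of bn ab); rewrite [RHS]surjective_pairing; congr pair; apply/val_inj.
  by rewrite [RHS]itv_chord1 /=; lia.
by rewrite [RHS]itv_chord2 /=; lia.
Qed.

Lemma diagonal_itv p : diagonal (itv_chord p).
Proof.
rewrite /diagonal itv_chord1 itv_chord2 !ltnS; have -> : (psrc p <= ptgt p)%N := valP p.
rewrite [itv_chord p]surjective_pairing xpair_eqE -val_eqE.
by rewrite [X in X == _]itv_chord1.
Qed.

Lemma diagonal_arc i : diagonal (arc_chord i).
Proof.
rewrite /diagonal arc_chord2 /=; rewrite [arc_chord i]surjective_pairing xpair_eqE /=.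
by rewrite -val_eqE /= [X in X == _]arc_chord2 eqSS; have := ltn_ord i; lia.
Qed.

Lemma meets_itv p q : meets (itv_chord p) (itv_chord q) = conflict p q.
Proof. by rewrite /meets /conflict !itv_chord1 !itv_chord2; lia. Qed.

Lemma meets_arc_itv i p : meets (arc_chord i) (itv_chord p) = (i \in itv p).
Proof. by rewrite /meets inE !itv_chord1 itv_chord2 arc_chord2 /=; lia. Qed.

Lemma meets_arc u i : meets u (arc_chord i) = false.
Proof. by rewrite /meets /=; lia. Qed.

Definition itv_part G : {set qpath n} := [set p | itv_curve p \in G].
Definition arc_part G : {set 'I_n} := [set i | arc_curve i \in G].

(** The equation for G says that it contains no boundary segment, as every diagonal is an interval
    chord or an arc. Arcs share the endpoint p, so crossings arise only between two chords or
    between an arc and a chord. *)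
Lemma noncrossing_parts G : noncrossing G <->
  [/\ G = itv_curve @: itv_part G :|: arc_curve @: arc_part G,
      forall p q, p \in itv_part G -> q \in itv_part G -> ~~ conflict p q
    & forall p, p \in itv_part G -> avoids (arc_part G) p].
Proof.
split=> [/noncrossingP[h1 h2]|[GE h2 h3]].
  split=> [|p q|p].
  - apply/setP => c; rewrite inE; apply/idP/orP => [cG|]; last first.
      by case=> /imsetP[x]; rewrite inE => xG ->.
    have [u hu cE] := chord_surj c.
    have [[p uE]|[i uE]] := diagonal_cases (h1 u hu ltac:(by rewrite -cE)).
      by left; apply/imsetP; exists p; rewrite ?inE /itv_curve -uE -?cE.
    by right; apply/imsetP; exists i; rewrite ?inE /arc_curve -uE -?cE.
  - rewrite !inE -meets_itv => pG qG.
    by apply: h2 => //; apply: itv_chord_lt.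
  rewrite inE => pG; apply/avoidsP => i ip; rewrite inE; apply/negP => iG.
  have := h2 _ _ (arc_chord_lt i) (itv_chord_lt p) iG pG.
  by rewrite meets_arc_itv inE ip.
have cases (u : point * point) : (u.1 < u.2)%N -> chord u \in G ->
    (exists2 p, p \in itv_part G & u = itv_chord p) \/
    (exists2 i, i \in arc_part G & u = arc_chord i).
  move=> hu; rewrite {1}GE inE => /orP[] /imsetP[x xG e]; [left|right]; exists x => //.
    exact: chord_inj (itv_chord_lt _) e.
  exact: chord_inj (arc_chord_lt _) e.
apply/noncrossingP; split=> [u hu /(cases _ hu)|u v hu hv /(cases _ hu) cu /(cases _ hv) cv].
  by case=> -[x _ ->]; [apply: diagonal_itv|apply: diagonal_arc].
case: cv => -[y yG ->]; last by rewrite meets_arc.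
case: cu => -[x xG ->]; first by rewrite meets_itv h2.
rewrite meets_arc_itv inE; apply/negP => xy.
by have /avoidsP/(_ x xy) := h3 y yG; rewrite xG.
Qed.

Lemma card_parts G : noncrossing G -> #|G| = (#|itv_part G| + #|arc_part G|)%N.
Proof.
move=> /noncrossing_parts[GE _ _]; rewrite {1}GE cardsU.
rewrite !card_imset; [|exact: arc_curve_inj|exact: itv_curve_inj].
suff -> : itv_curve @: itv_part G :&: arc_curve @: arc_part G = set0.
  by rewrite cards0 subn0.
apply/setP => c; rewrite !inE; apply/negP => /andP[/imsetP[p _ ->] /imsetP[i _]].
exact: itv_arc_neq.
Qed.

Lemma crossed_itv p : crossed (itv_curve p) = itv p.
Proof.
apply/setP => i; rewrite !inE endpoints_chord ?itv_chord_lt // crosses_arc ?itv_chord_lt //.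
by rewrite itv_chord1 itv_chord2; lia.
Qed.

Lemma crossed_arc i : crossed (arc_curve i) = set0.
Proof.
apply/setP => j; rewrite !inE endpoints_chord ?arc_chord_lt //.
by rewrite crosses_arc ?arc_chord_lt.
Qed.

End Correspondence.

Section TriangulationModules.
Variables (k : fieldType) (n : nat).
Implicit Types (p q : qpath n) (G : {set curve n}).

Lemma mult_tri_mod G p : noncrossing G -> mult (tri_mod k G) p = (p \in itv_part G).
Proof.
move=> /noncrossing_parts[GE _ _]; rewrite inE mult_big.
transitivity (\sum_(c in G) (c == itv_curve p))%N.
  apply: eq_bigr => c; rewrite {1}GE inE => /orP[] /imsetP[x _ ->].
    rewrite /curve_mod crossed_itv (mult_str k x p).
    by rewrite (inj_eq (@itv_curve_inj n)).
  rewrite /curve_mod crossed_arc; case: eqP => [e|_]; first by case: (itv_arc_neq (esym e)).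
  apply: etrans (mult_zeromod k p); apply: mult_iso; apply/iso_zero => y.
  by apply: coP => l; rewrite !co_out // => u; rewrite inE.
case: (boolP (_ \in G)) => pG; last first.
  rewrite big1 // => c cG; case: eqP => // cp.
  by rewrite -cp cG in pG.
rewrite (bigD1 _ pG) /= eqxx big1 // => c /andP[_ /negPf ->].
by [].
Qed.

End TriangulationModules.

Theorem corollary3p5 (k : closedFieldType) (n : nat) (hn : (1 <= n)%N) :
  [/\ forall G : {set curve n}, triangulation G ->
        basic (tri_mod k G) /\ support_tau_tilting (tri_mod k G),
      forall G G' : {set curve n}, triangulation G -> triangulation G' ->
        iso (tri_mod k G) (tri_mod k G') -> G = G'
    & forall M : rmod (path_alg k n), basic M -> support_tau_tilting M ->
        exists G : {set curve n}, triangulation G /\ iso M (tri_mod k G)].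
Proof.
split=> [G /triangulation_card[nG cG]|G G' tG tG' GG'|M bM /support_tau_tilting_spec].
- have mE p := mult_tri_mod k p nG.
  have le1 p : (mult (tri_mod k G) p <= 1)%N by rewrite mE; case: (_ \in _).
  split; first exact/basicP.
  have [_ nc av] := iffLR (noncrossing_parts G) nG.
  apply: (@support_tau_tiltingI _ _ _ (arc_part G)) => // [p|p q|].
  + by rewrite mE lt0b; apply: av.
  + by rewrite !mE !lt0b; apply: nc.
  transitivity #|itv_part G|; first by apply: eq_card => p; rewrite inE mE lt0b.
  have := cardsC (arc_part G); have := card_parts nG; rewrite cG card_ord.
  by move=> h1 h2; apply: (@addnI #|arc_part G|); rewrite h2 addnC -h1.
- have [nG cG] := iffLR (triangulation_card G) tG.
  have [nG' cG'] := iffLR (triangulation_card G') tG'.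
  have e : itv_part G = itv_part G'.
    apply/setP => p; have := mult_iso p GG'; rewrite !mult_tri_mod //.
    by do 2!case: (_ \in _).
  have [GE nc av] := iffLR (noncrossing_parts G) nG.
  have [GE' nc' av'] := iffLR (noncrossing_parts G') nG'.
  (* The union has the same chords, and these avoid the arcs of both G and G'. It is therefore
     noncrossing and, by maximality, equal to each of them. *)
  have iU : itv_part (G :|: G') = itv_part G.
    apply/setP => p; rewrite !inE; have /setP/(_ p) := e; rewrite !inE => ->.
    by rewrite orbb.
  have aU : arc_part (G :|: G') = arc_part G :|: arc_part G'.
    by apply/setP => i; rewrite !inE.
  have nU : noncrossing (G :|: G').
    apply/noncrossing_parts; rewrite iU aU; split=> // [|p pG].
      rewrite imsetU setUA -GE [X in _ :|: X = _]GE' -e setUA; congr (_ :|: _).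
      by apply/setUidPl; have := subsetUl (@itv_curve n @: itv_part G) (@arc_curve n @: arc_part G); rewrite -GE.
    apply/avoidsP => i ip; rewrite inE negb_or.
    rewrite (avoidsP _ _ (av p pG) i ip) /=.
    by rewrite e in pG; apply: (avoidsP _ _ (av' p pG)).
  have maxG := maxsetsup tG nU (subsetUl _ _).
  have maxG' := maxsetsup tG' nU (subsetUr _ _).
  by rewrite -[LHS]maxG.
move=> [J [av nc cS]].
pose S := [set p | (0 < mult M p)%N].
(* The set J supplied by the idempotent gives the arcs; the equality of the numbers of summands
   makes the total n, hence G maximal. *)
pose G := (@itv_curve n) @: S :|: (@arc_curve n) @: J.
have iG : itv_part G = S.
  apply/setP => p; rewrite inE /G inE mem_imset; last exact: itv_curve_inj.
  by case: imsetP => [[i _ /itv_arc_neq//]|]; rewrite orbF.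
have aG : arc_part G = J.
  apply/setP => i; rewrite inE /G inE [in X in _ || X]mem_imset; last exact: arc_curve_inj.
  by case: imsetP => [[p _ /esym/itv_arc_neq//]|].
have nG : noncrossing G.
  apply/noncrossing_parts; rewrite iG aG; split=> // [p q|p].
    by rewrite !inE; apply: nc.
  by rewrite inE; apply: av.
exists G; split.
  apply/triangulation_card; split=> //.
  by rewrite (card_parts nG) iG aG cS addnC cardsC card_ord.
apply: iso_mult => p; rewrite mult_tri_mod // iG inE.
by have := iffLR (basicP M) bM p; case: (mult M p) => [|[]].
Qed.
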